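(* Let $U\subseteq\mathbf{R}^d$ be open, let $u\in\mathcal{D}'(U)$, and let $P(D)=\sum_{|\alpha|\le m}a_\alpha D^\alpha$ be a partial differential operator of order $m$ with constant coefficients. Then $$\mathrm{WF}_{0,\infty}(P(D)u)\subseteq \mathrm{WF}_{0,\infty}(u)\subseteq \mathrm{WF}_{0,\infty}(P(D)u)\cup\bigl(U\times\mathrm{Char}(P(D))\bigr).$$
   Context: $\mathcal{D}'(U)$ denotes the Schwartz distributions on $U$, $\mathcal{E}'(U)$ the compactly supported ones, $\mathbf{N}=\{0,1,2,\dots\}$, and $\lfloor\cdot\rfloor$ is the floor function. The Fourier transform is $\widehat f(\xi)=\int_{\mathbf{R}^d}f(x)e^{-2\pi i x\xi}\,dx$, extended to distributions by duality. A conic neighborhood of $\xi_0\in\mathbf{R}^d\setminus\{0\}$ is an open cone $\Gamma\subset\mathbf{R}^d$ with $\xi_0\in\Gamma$. Wave front sets: let $\tau>0$, $\sigma>1$, $u\in\mathcal{D}'(U)$, $(x_0,\xi_0)\in U\times(\mathbf{R}^d\setminus\{0\})$. Then $(x_0,\xi_0)\notin \mathrm{WF}_{\{\tau,\sigma\}}(u)$ if there exist an open neighborhood $\Omega\subset U$ of $x_0$, a conic neighborhood $\Gamma$ of $\xi_0$, and a bounded sequence $\{u_N\}_{N\in\mathbf{N}}$ in $\mathcal{E}'(U)$ such that $u_N=u$ on $\Omega$ for every $N$ and, for some constants $A,h>0$, $$|\widehat u_N(\xi)|\le A\,\frac{h^N N!^{\tau/\sigma}}{|\xi|^{\lfloor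 N^{1/\sigma}\rfloor}},\qquad N\in\mathbf{N},\ \xi\in\Gamma\setminus\{0\}.$$ Furthermore $$\mathrm{WF}_{0,\infty}(u)=\bigcup_{\sigma>1}\bigcap_{\tau>0}\mathrm{WF}_{\{\tau,\sigma\}}(u).$$ For $P(D)=\sum_{|\alpha|\le m}a_\alpha D^\alpha$ with constant coefficients, the principal symbol is $P_m(\xi)=\sum_{|\alpha|=m}a_\alpha\xi^\alpha$, and the characteristic set is $\mathrm{Char}(P(D))=\{\xi\in\mathbf{R}^d\setminus\{0\}: P_m(\xi)=0\}$. Here $D^\alpha$ is $\partial^\alpha$ up to the usual normalizing factor $c^{|\alpha|}$ ($c\ne0$ constant, e.g. $c=-i$), whose choice is immaterial. *)

(* Defs.v *)
From mathcomp Require Import all_boot all_order all_algebra.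
From mathcomp Require Import complex.
From mathcomp Require Import all_classical all_reals all_analysis.

Set Implicit Arguments.
Unset Strict Implicit.
Unset Printing Implicit Defensive.

Import Order.TTheory GRing.Theory Num.Theory.
Import numFieldNormedType.Exports.

Local Open Scope classical_set_scope.
Local Open Scope ring_scope.

Section Distributions.
Variables (R : realType) (d : nat).

Local Notation E := 'rV[R]_d.
Local Notation C := R[i].
Implicit Types (U Omega K : set E) (f g phi psi chi : E -> C) (x xi : E).
Implicit Types (u v : (E -> C) -> C).

Definition cmod (z : C) : R := ComplexField.Normc.normc z.

Definition dot x xi : R := \sum_(j < d) x 0 j * xi 0 j.

(* The library norm on row vectors is the sup norm. *)
Definition enorm2 x : R := Num.sqrt (dot x x).

Definition cpartial (j : 'I_d) f : E -> C :=
  fun x => ('D_(delta_mx 0 j) (fun y => complex.Re (f y)) x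
            +i* 'D_(delta_mx 0 j) (fun y => complex.Im (f y)) x)%C.

(* [:: j1; ...; jr] stands for the iterated derivative d_{j1} ... d_{jr}. *)
Definition cpartials (s : seq 'I_d) f : E -> C := foldr cpartial f s.

Definition mi_order (alpha : 'I_d -> nat) : nat := (\sum_(j < d) alpha j)%N.

Definition mi_partial (alpha : 'I_d -> nat) f : E -> C :=
  cpartials (flatten [seq nseq (alpha j) j | j <- enum 'I_d]) f.

Definition cdifferentiable f x : Prop :=
  differentiable (fun y => complex.Re (f y)) x /\
  differentiable (fun y => complex.Im (f y)) x.

(* For U open this is C^oo(U); the values of f outside U are irrelevant. *)
Definition smooth_on U f : Prop :=
  forall (s : seq 'I_d) x, U x -> cdifferentiable (cpartials s f) x.

Definition csupport f : set E := closure [set x | f x != 0].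

(* C_c^oo(U), each function being extended by 0 outside U. *)
Definition test_function U phi : Prop :=
  [/\ smooth_on setT phi, compact (csupport phi) & csupport phi `<=` U].

Definition ck_norm K (k : nat) f : R :=
  sup [set r | exists (s : seq 'I_d) x,
         [/\ (size s <= k)%N, K x & r = cmod (cpartials s f x)]].

(* Distributions on U are represented by functionals on all functions, of which
   only the values on the test functions of U are ever used. *)
Definition distribution_on U u : Prop :=
  (forall (a : C) phi psi, test_function U phi -> test_function U psi ->
     u (fun x => a * phi x + psi x) = a * u phi + u psi) /\
  (forall K, compact K -> K `<=` U ->
     exists (k : nat) (M : R), forall phi,
       test_function U phi -> csupport phi `<=` K ->
       cmod (u phi) <= M * ck_norm K k phi).

Definition eq_distr_on Omega u v : Prop :=
  forall phi, test_function Omega phi -> u phi = v phi.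

Definition distr_support U u : set E :=
  [set x | U x /\ ~ exists Omega : set E,
     [/\ open Omega, Omega `<=` U, Omega x & eq_distr_on Omega u (fun=> 0)]].

Definition compactly_supported_distribution U u : Prop :=
  distribution_on U u /\ compact (distr_support U u).

Definition cutoff U u chi : Prop :=
  test_function U chi /\
  exists V : set E, [/\ open V, distr_support U u `<=` V &
                        forall x, V x -> chi x = 1].

(* The pairing of u in E'(U) with psi in C^oo(U), namely u(chi psi) for any
   cutoff chi equal to 1 near the support of u. *)
Definition distr_pairing U u psi : C :=
  let chi := xget (fun=> 0) [set chi | cutoff U u chi] in
  u (fun x => chi x * psi x).

Definition bounded_smooth U (B : set (E -> C)) : Prop :=
  (forall psi, B psi -> smooth_on U psi) /\
  (forall K (k : nat), compact K -> K `<=` U ->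
     exists M : R, forall psi, B psi -> ck_norm K k psi <= M).

(* Boundedness in E'(U) for the strong dual topology: uniform boundedness on
   each bounded subset of C^oo(U). *)
Definition bounded_compact_distributions U (w : nat -> (E -> C) -> C) : Prop :=
  (forall N, compactly_supported_distribution U (w N)) /\
  (forall B, bounded_smooth U B ->
     exists M : R, forall N psi, B psi -> cmod (distr_pairing U (w N) psi) <= M).

(* x |-> exp (- 2 pi i x xi) *)
Definition fourier_kernel xi : E -> C :=
  fun x => (cos (2 * pi * dot x xi) +i* - sin (2 * pi * dot x xi))%C.

(* For u in E'(U), the distribution <u^, phi> = <u, phi^> is the smooth function
   xi |-> <u, exp (- 2 pi i . xi)>. *)
Definition fourier_distr U u xi : C := distr_pairing U u (fourier_kernel xi).

Definition conic_neighborhood xi (Gamma : set E) : Prop :=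
  [/\ open Gamma, forall (t : R) eta, 0 < t -> Gamma eta -> Gamma (t *: eta)
    & Gamma xi].

Definition WF_regular U (tau sigma : R) u x0 xi0 : Prop :=
  exists (Omega Gamma : set E) (w : nat -> (E -> C) -> C) (A h : R),
    [/\ [/\ open Omega, Omega x0 & Omega `<=` U],
        conic_neighborhood xi0 Gamma,
        bounded_compact_distributions U w /\
        (forall N, eq_distr_on Omega (w N) u),
        0 < A /\ 0 < h
      & forall (N : nat) xi, Gamma xi -> xi != 0 ->
          cmod (fourier_distr U (w N) xi) <=
          A * (h ^+ N * (N`!)%:R `^ (tau / sigma)
               / enorm2 xi ^+ Num.truncn (N%:R `^ (sigma^-1)))].

Definition WF_tau_sigma U (tau sigma : R) u : set (E * E) :=
  [set p | [/\ U p.1, p.2 != 0 & ~ WF_regular U tau sigma u p.1 p.2]].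

Definition WF_0_infty U u : set (E * E) :=
  \bigcup_(sigma in [set s : R | 1 < s])
    \bigcap_(tau in [set t : R | 0 < t]) WF_tau_sigma U tau sigma u.

Section Operators.
Variable m : nat.

(* Every multi-index of order at most m has its entries in {0, ..., m}. *)
Definition multi_index := {ffun 'I_d -> 'I_m.+1}.

Definition mi_fun (alpha : multi_index) : 'I_d -> nat := fun j => alpha j.
Coercion mi_fun : multi_index >-> Funclass.

Variable (c : C) (a : multi_index -> C).

(* a is only read on multi-indices of order at most m; D^alpha stands for
   c^|alpha| d^alpha. *)
Definition has_order : Prop :=
  exists alpha : multi_index, mi_order alpha = m /\ a alpha != 0.

(* The distribution P(D) u, where <D^alpha u, phi> = (-1)^|alpha| <u, D^alpha phi>. *)
Definition pdo_distr u : (E -> C) -> C := fun phi =>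
  \sum_(alpha : multi_index | (mi_order alpha <= m)%N)
     a alpha * ((-1) ^+ mi_order alpha *
                u (fun x => c ^+ mi_order alpha * mi_partial alpha phi x)).

Definition principal_symbol xi : C :=
  \sum_(alpha : multi_index | mi_order alpha == m)
     a alpha * \prod_(j < d) ((xi 0 j)%:C)%C ^+ alpha j.

Definition Char : set E := [set xi | xi != 0 /\ principal_symbol xi = 0].

End Operators.

End Distributions.

(* Main.v *)
Require Import Defs.
From HB Require Import structures.
From mathcomp Require Import all_boot all_order all_algebra.
From mathcomp Require Import complex.
From mathcomp Require Import all_classical all_reals all_analysis.
From mathcomp Require Import ring lra zify.
Import numFieldNormedType.Exports.

(** The point is that regularity of type [(tau, sigma)] for some unspecified [tau] is a
    loose condition: at stage [N] it asks for [N ^ (1 / sigma)] powers of decay and allows a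
    constant which is a power of [N`!], that is, much more than the factorial of any multiple
    of the number of powers. Since [sigma] is the same on both sides while [tau] is quantified
    existentially, each inclusion reduces to one implication between regularity statements
    with a worse [tau].

    For the first inclusion ([WF_regular_pdo]), [P(D)] multiplies the Fourier transforms of
    the sequence by a polynomial of degree [m]. The lost [m] powers are recovered by going
    to the stage [K * N.+1] of the sequence ([decay_shift]), and the factorials remain
    powers of [N`!] ([fgrowth_fact]).

    For the second inclusion ([WF_regular_elliptic]), let [w_N] be the sequence given by
    the regularity of [f = P(D) u] and let [chi] be a product of plateau functions of one
    variable, of Gevrey class 2 ([plateau_exists]). The constant sequence [chi u] is a witness
    of the regularity of [u]. Put [G_gam = u (d^gam chi * e_xi)] and
    [F_gam = f (d^gam chi * e_xi)], with [e_xi] the plane wave. Moving [P(D)] to the test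
    function and dividing by the principal symbol, which is elliptic in a cone, one gets
    [|xi| |G_gam| <= K (|xi| |F_gam| + max |G_gam'|)], where [gam'] has at most [m] more
    derivatives ([elliptic_step]). Iterating turns the a priori polynomial bound
    on [G] ([wave_baseline]) into the wanted decay ([elliptic_iteration]), as soon as the [F_gam]
    decay.

    For that, [F_gam = w_N (d^gam chi * e_xi)] is expressed through the Fourier transform
    of [w_N]. All the [w_N] live in a common ball ([bounded_common_support]), on
    which [chi] is the limit, with all its derivatives, of the Fejer means of its Fourier series
    for a large period ([fejer_cvg]). These are finite sums of plane waves, whose coefficients
    decay in terms of the derivatives of [chi] ([fejer_coef_sum]); so [F_gam] is
    controlled by [w_N^(xi - kap)] with rapidly decreasing weights in [kap] ([tensor_wave_le]).
    Close to [xi] the decay of [w_N^] in the cone applies, and far from it a polynomial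
    bound uniform in [N] ([bounded_fourier_growth]) together with [|kap| >= eps |xi|]
    ([fourier_split]). *)

Set Implicit Arguments.
Unset Strict Implicit.
Unset Printing Implicit Defensive.

Import Order.TTheory GRing.Theory Num.Theory.

Local Open Scope classical_set_scope.
Local Open Scope ring_scope.

(** * Calculus of complex-valued functions *)

Section Modulus.
Variable R : realType.
Local Notation C := R[i].
Implicit Types z w : C.

Lemma cmod0 : cmod (0 : C) = 0.
Proof. exact: ComplexField.Normc.normc0. Qed.

Lemma cmod1 : cmod (1 : C) = 1.
Proof. exact: ComplexField.Normc.normc1. Qed.

Lemma cmodM z w : cmod (z * w) = cmod z * cmod w.
Proof. exact: ComplexField.Normc.normcM. Qed.

Lemma cmodD z w : cmod (z + w) <= cmod z + cmod w.
Proof. exact: le_normcD. Qed.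

Lemma cmodN z : cmod (- z) = cmod z.
Proof. exact: normcN. Qed.

Lemma cmod_ge0 z : 0 <= cmod z.
Proof. by case: z => a b; exact: sqrtr_ge0. Qed.

Lemma cmod_eq0 z : cmod z = 0 -> z = 0.
Proof. exact: ComplexField.Normc.eq0_normc. Qed.

Lemma cmod_real (r : R) : cmod (r%:C)%C = `|r|.
Proof. by rewrite /cmod /= expr0n/= addr0 sqrtr_sqr. Qed.

Lemma cmodX z n : cmod (z ^+ n) = cmod z ^+ n.
Proof. by elim: n => [|n IH]; rewrite ?cmod1// !exprS cmodM IH. Qed.

Lemma cmod_sum I (r : seq I) (P : pred I) (F : I -> C) :
  cmod (\sum_(i <- r | P i) F i) <= \sum_(i <- r | P i) cmod (F i).
Proof.
elim/big_rec2: _ => [|i y1 y2 _ h]; first by rewrite cmod0.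
by apply: le_trans (cmodD _ _) _; rewrite lerD2l.
Qed.

Lemma cmod_prod I (r : seq I) (P : pred I) (F : I -> C) :
  cmod (\prod_(i <- r | P i) F i) = \prod_(i <- r | P i) cmod (F i).
Proof. by elim/big_rec2: _ => [|i y1 y2 _ <-]; rewrite ?cmod1 ?cmodM. Qed.

Lemma cmodB z w : cmod (z - w) <= cmod z + cmod w.
Proof. by rewrite -[cmod w]cmodN; exact: cmodD. Qed.

End Modulus.

Section Differentiation.
Variables (R : realType) (d : nat).
Local Notation E := 'rV[R]_d.
Local Notation C := R[i].
Implicit Types (f g : E -> C) (x : E) (j : 'I_d) (s : seq 'I_d).

(** The differential is chosen by description, so its invariance under a change of
    the function away from [x] goes through uniqueness of the expansion at [x]. *)
Lemma near_eq_differentiable (V W : normedModType R) (h k : V -> W) (x : V) :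
  {near x, h =1 k} -> differentiable h x -> differentiable k x.
Proof.
move=> hk dh; have hx := nbhs_singleton hk.
have H : k \o shift x = cst (k x) + 'd h x +o_ 0 id.
  apply/eqaddoP => _/posnumP[e].
  have /eqaddoP /(_ _ (gt0 e)) He := diff_locally dh.
  have hk' : \forall y \near (0 : V), h (y + x) = k (y + x).
    by have := hk; rewrite (near_shift 0) /= subr0.
  near=> y.
  have -> : (k \o shift x - (cst (k x) + 'd h x)) y =
            (h \o shift x - (cst (h x) + 'd h x)) y.
    by rewrite !fctE /= hx (near hk' y).
  by near: y.
have c : continuous ('d h x) by exact: diff_continuous.
have dk : 'd k x = 'd h x :> (V -> W) by exact: diff_unique.
by apply/diff_locallyP; split; rewrite dk.
Unshelve. all: by end_near. Qed.

Lemma cdifferentiable_cst (a : C) x : cdifferentiable (fun=> a) x.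
Proof. by split; exact: differentiable_cst. Qed.

Lemma cdifferentiableD f g x : cdifferentiable f x -> cdifferentiable g x ->
  cdifferentiable (fun y => f y + g y) x.
Proof.
move=> [f1 f2] [g1 g2]; split.
  rewrite (_ : (fun y => _) = (fun y => complex.Re (f y)) \+ (fun y => complex.Re (g y))).
    exact: differentiableD.
  by apply/funext => y /=; case: (f y) (g y) => [? ?] [? ?].
rewrite (_ : (fun y => _) = (fun y => complex.Im (f y)) \+ (fun y => complex.Im (g y))).
  exact: differentiableD.
by apply/funext => y /=; case: (f y) (g y) => [? ?] [? ?].
Qed.

Lemma Re_mul (z w : C) : complex.Re (z * w) =
  complex.Re z * complex.Re w - complex.Im z * complex.Im w.
Proof. by case: z w => [? ?] [? ?]. Qed.

Lemma Im_mul (z w : C) : complex.Im (z * w) =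
  complex.Re z * complex.Im w + complex.Im z * complex.Re w.
Proof. by case: z w => [? ?] [? ?]. Qed.

Lemma cdifferentiableM f g x : cdifferentiable f x -> cdifferentiable g x ->
  cdifferentiable (fun y => f y * g y) x.
Proof.
move=> [f1 f2] [g1 g2]; split.
  under eq_fun do rewrite Re_mul.
  by apply: differentiableB; apply: differentiableM.
under eq_fun do rewrite Im_mul.
by apply: differentiableD; apply: differentiableM.
Qed.

Lemma cpartialD j f g x : cdifferentiable f x -> cdifferentiable g x ->
  cpartial j (fun y => f y + g y) x = cpartial j f x + cpartial j g x.
Proof.
move=> [f1 f2] [g1 g2]; rewrite /cpartial.
have ReD y : complex.Re (f y + g y) = complex.Re (f y) + complex.Re (g y).
  by case: (f y) (g y) => [? ?] [? ?].
have ImD y : complex.Im (f y + g y) = complex.Im (f y) + complex.Im (g y).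
  by case: (f y) (g y) => [? ?] [? ?].
rewrite (funext ReD) (funext ImD).
rewrite !deriveD//; by apply: diff_derivable.
Qed.

Lemma cpartialM j f g x : cdifferentiable f x -> cdifferentiable g x ->
  cpartial j (fun y => f y * g y) x = cpartial j f x * g x + f x * cpartial j g x.
Proof.
move=> [f1 f2] [g1 g2]; rewrite /cpartial.
rewrite (funext (fun y => Re_mul (f y) (g y))) (funext (fun y => Im_mul (f y) (g y))).
have dv (h : E -> R) v : differentiable h x -> derivable h x v.
  by move=> ?; exact: diff_derivable.
rewrite deriveB ?deriveD ?deriveM//; try (by apply: dv => //); try by apply: derivableM; apply: dv.
rewrite /GRing.scale /=.
move: ('D__ (fun y => complex.Re (f y)) x) ('D__ (fun y => complex.Im (f y)) x)
  ('D__ (fun y => complex.Re (g y)) x) ('D__ (fun y => complex.Im (g y)) x) => r1 i1 r2 i2.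
case: (f x) (g x) => [a b] [a' b'] /=; apply/eqP; rewrite eq_complex /=.
by apply/andP; split; apply/eqP; ring.
Qed.

Lemma cpartial_cst j (a : C) x : cpartial j (fun=> a) x = 0.
Proof. by rewrite /cpartial !derive_cst. Qed.

Lemma near_eq_cdifferentiable f g x :
  {near x, f =1 g} -> cdifferentiable f x -> cdifferentiable g x.
Proof.
move=> fg [f1 f2]; split.
- by apply: near_eq_differentiable f1; apply: filterS fg => y ->.
- by apply: near_eq_differentiable f2; apply: filterS fg => y ->.
Qed.

Lemma near_eq_cpartial j f g x : {near x, f =1 g} ->
  cpartial j f x = cpartial j g x.
Proof.
move=> fg; rewrite /cpartial; congr (_ +i* _)%C; apply: near_eq_derive.
- by apply: filterS fg => y ->.
- by apply: filterS fg => y ->.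
Qed.

Lemma cpartials_cat s t f : cpartials (s ++ t) f = cpartials s (cpartials t f).
Proof. by rewrite /cpartials foldr_cat. Qed.

Lemma cpartials_rcons s j f : cpartials (rcons s j) f = cpartials s (cpartial j f).
Proof. by rewrite /cpartials foldr_rcons. Qed.

Lemma eq_cpartials (O : set E) f g s : open O -> (forall x, O x -> f x = g x) ->
  forall x, O x -> cpartials s f x = cpartials s g x.
Proof.
move=> oO fg; elim: s => [|j s IH] //= x Ox.
by apply: near_eq_cpartial; apply: filterS (open_nbhs_nbhs (conj oO Ox)) => y /IH.
Qed.

Lemma eq_smooth_on (O : set E) f g : open O -> (forall x, O x -> f x = g x) ->
  smooth_on O f -> smooth_on O g.
Proof.
move=> oO fg sf s x Ox; apply: near_eq_cdifferentiable (sf s x Ox).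
apply: filterS (open_nbhs_nbhs (conj oO Ox)) => y Oy.
exact: (eq_cpartials s oO fg Oy).
Qed.

Lemma smooth_on_sub (O O' : set E) f : O' `<=` O -> smooth_on O f -> smooth_on O' f.
Proof. by move=> sO sf s x /sO; exact: sf. Qed.

Lemma smooth_on_partials (O : set E) s f : smooth_on O f -> smooth_on O (cpartials s f).
Proof. by move=> sf t x Ox; rewrite -cpartials_cat; exact: sf. Qed.

Lemma smooth_on_bigU (O1 O2 : set E) f : smooth_on O1 f -> smooth_on O2 f ->
  smooth_on (O1 `|` O2) f.
Proof. by move=> s1 s2 s x [/s1|/s2]. Qed.

Lemma cpartials_cst (a : C) s x : cpartials s (fun=> a) x = if s is [::] then a else 0.
Proof.
elim: s x => [|j s IH] x //=.
have -> : cpartials s (fun _ : E => a) = (fun=> if s is [::] then a else 0).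
  by apply/funext.
by rewrite cpartial_cst.
Qed.

Lemma smooth_on_cst (O : set E) (a : C) : smooth_on O (fun=> a).
Proof.
move=> s x _; have -> : cpartials s (fun _ : E => a) = (fun=> if s is [::] then a else 0).
  by apply/funext => y; exact: cpartials_cst.
exact: cdifferentiable_cst.
Qed.

Section Closure.
Variable O : set E.
Hypothesis oO : open O.

Let nearO x : O x -> \forall y \near x, O y.
Proof. by move=> Ox; exact: open_nbhs_nbhs. Qed.

Lemma cpartialsD s f g : smooth_on O f -> smooth_on O g -> forall x, O x ->
  cpartials s (fun y => f y + g y) x = cpartials s f x + cpartials s g x.
Proof.
move=> sf sg; elim: s => [|j s IH] //= x Ox.
rewrite -cpartialD//; [|exact: sf|exact: sg].
by apply: near_eq_cpartial; apply: filterS (nearO Ox) => y /IH.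
Qed.

Lemma smooth_onD f g : smooth_on O f -> smooth_on O g ->
  smooth_on O (fun y => f y + g y).
Proof.
move=> sf sg s x Ox.
apply: near_eq_cdifferentiable (cdifferentiableD (sf s x Ox) (sg s x Ox)).
by apply: filterS (nearO Ox) => y Oy; rewrite (cpartialsD s sf sg Oy).
Qed.

Lemma smooth_on_sum I (r : seq I) (P : pred I) (F : I -> E -> C) :
  (forall i, P i -> smooth_on O (F i)) ->
  smooth_on O (fun x => \sum_(i <- r | P i) F i x).
Proof.
move=> sF; elim: r => [|i r IH].
  by under eq_fun do rewrite big_nil; exact: smooth_on_cst.
under eq_fun do rewrite big_cons; case Pi : (P i) => //.
exact: (smooth_onD (sF i Pi) IH).
Qed.

(** The ways of distributing a list of derivatives over the two factors of a
    product, in the order in which Leibniz's rule produces them. *)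
Fixpoint splits s : seq (seq 'I_d * seq 'I_d) :=
  if s is j :: s' then
    [seq (j :: p.1, p.2) | p <- splits s'] ++ [seq (p.1, j :: p.2) | p <- splits s']
  else [:: ([::], [::])].

Lemma size_splits s : size (splits s) = (2 ^ size s)%N.
Proof. by elim: s => //= j s IH; rewrite size_cat !size_map IH addnn expnS mul2n. Qed.

Lemma splits_size s p : p \in splits s -> (size p.1 + size p.2)%N = size s.
Proof.
elim: s p => [|j s IH] p /=; first by rewrite inE => /eqP ->.
by rewrite mem_cat => /orP[] /mapP[q /IH qs ->] /=; rewrite ?addnS ?addSn qs.
Qed.

Let prodsum (r : seq (seq 'I_d * seq 'I_d)) f g x :=
  \sum_(p <- r) cpartials p.1 f x * cpartials p.2 g x.

Let cdiff_term f g p x : smooth_on O f -> smooth_on O g -> O x ->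
  cdifferentiable (fun y => cpartials p.1 f y * cpartials p.2 g y) x.
Proof. by move=> sf sg Ox; apply: cdifferentiableM; [exact: sf|exact: sg]. Qed.

Let cdiff_prodsum f g r x : smooth_on O f -> smooth_on O g -> O x ->
  cdifferentiable (prodsum r f g) x.
Proof.
move=> sf sg Ox; elim: r => [|p r IH].
  rewrite /prodsum; under eq_fun do rewrite big_nil.
  exact: cdifferentiable_cst.
rewrite /prodsum; under eq_fun do rewrite big_cons.
by apply: cdifferentiableD => //; exact: cdiff_term.
Qed.

Let cpartial_prodsum j f g r x : smooth_on O f -> smooth_on O g -> O x ->
  cpartial j (prodsum r f g) x =
  prodsum ([seq (j :: p.1, p.2) | p <- r] ++ [seq (p.1, j :: p.2) | p <- r]) f g x.
Proof.
move=> sf sg Ox; rewrite /prodsum big_cat !big_map /= -big_split /=.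
elim: r => [|p r IH].
  rewrite big_nil; under eq_fun do rewrite big_nil.
  exact: cpartial_cst.
rewrite big_cons -IH; under eq_fun do rewrite big_cons.
rewrite cpartialD; [|exact: cdiff_term|exact: cdiff_prodsum].
by rewrite cpartialM; [|exact: sf|exact: sg].
Qed.

Lemma cpartialsM s f g : smooth_on O f -> smooth_on O g -> forall x, O x ->
  cpartials s (fun y => f y * g y) x =
  \sum_(p <- splits s) cpartials p.1 f x * cpartials p.2 g x.
Proof.
move=> sf sg; elim: s => [|j s IH] x Ox /=; first by rewrite big_seq1.
rewrite -/(prodsum _ f g x) -cpartial_prodsum//.
by apply: near_eq_cpartial; apply: filterS (nearO Ox) => y /IH.
Qed.

Lemma smooth_onM f g : smooth_on O f -> smooth_on O g ->
  smooth_on O (fun y => f y * g y).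
Proof.
move=> sf sg s x Ox.
apply: near_eq_cdifferentiable (cdiff_prodsum (splits s) sf sg Ox).
by apply: filterS (nearO Ox) => y Oy; rewrite (cpartialsM s sf sg Oy).
Qed.

Lemma cpartialsZ s (a : C) f : smooth_on O f -> forall x, O x ->
  cpartials s (fun y => a * f y) x = a * cpartials s f x.
Proof.
move=> sf; elim: s => [|j s IH] //= x Ox.
have -> : cpartial j (cpartials s (fun y => a * f y)) x =
          cpartial j (fun y => a * cpartials s f y) x.
  by apply: near_eq_cpartial; apply: filterS (nearO Ox) => y /IH.
rewrite cpartialM; [|exact: cdifferentiable_cst|exact: sf].
by rewrite cpartial_cst mul0r add0r.
Qed.

Lemma smooth_onZ (a : C) f : smooth_on O f -> smooth_on O (fun y => a * f y).
Proof. by move=> sf; apply: smooth_onM => //; exact: smooth_on_cst. Qed.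

End Closure.
End Differentiation.

(** * The flat exponential *)

Section RealDerivatives.
Variable R : realType.
Implicit Types (f g : R -> R) (x a b df dg : R).

Lemma is_derive_mul f g x df dg : is_derive x 1 f df -> is_derive x 1 g dg ->
  is_derive x 1 (fun y => f y * g y) (df * g x + f x * dg).
Proof.
move=> f1 g1; apply: is_derive_eq (is_deriveM f1 g1) _.
by rewrite /GRing.scale /=; ring.
Qed.

Lemma is_derive_add f g x df dg : is_derive x 1 f df -> is_derive x 1 g dg ->
  is_derive x 1 (fun y => f y + g y) (df + dg).
Proof. by move=> f1 g1; exact: is_deriveD. Qed.

Lemma is_derive_scale f x a df : is_derive x 1 f df ->
  is_derive x 1 (fun y => a * f y) (a * df).
Proof.
move=> f1; apply: is_derive_eq (is_derive_mul (is_derive_cst a x 1) f1) _.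
by rewrite mul0r add0r.
Qed.

Lemma is_derive_affine f a b x df : is_derive (a * x + b) 1 f df ->
  is_derive x 1 (fun y => f (a * y + b)) (a * df).
Proof.
move=> f1.
have h : is_derive x 1 (fun y => a * y + b) a.
  apply: is_derive_eq (is_derive_add (is_derive_scale a (is_derive_id x 1))
                                     (is_derive_cst b x 1)) _.
  by rewrite mulr1 addr0.
by rewrite mulrC; exact: (@is_derive1_comp _ f (fun y => a * y + b)).
Qed.

Lemma near_lt x a : x < a -> \forall y \near x, y < a.
Proof. by move=> xa; apply: open_nbhs_nbhs; split => //; exact: open_lt. Qed.

Lemma near_gt x a : a < x -> \forall y \near x, a < y.
Proof. by move=> xa; apply: open_nbhs_nbhs; split => //; exact: open_gt. Qed.

Lemma is_derive_continuous f x df : is_derive x 1 f df -> {for x, continuous f}.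
Proof. by move=> [/derivable1_diffP /differentiable_continuous]. Qed.

End RealDerivatives.

Section FlatExponential.
Variable R : realType.
Implicit Types (x y : R) (k n i j : nat).

(** A smooth function of one variable presented as the list of its derivatives. *)
Definition tower (F : nat -> R -> R) : Prop :=
  forall n x, is_derive x 1 (F n) (F n.+1 x).

Lemma tower_continuous F n : tower F -> continuous (F n).
Proof. by move=> tF x; exact: is_derive_continuous (tF n x). Qed.

(** The factor [x^-1 ^+ k] makes the family stable under differentiation. *)
Definition flat k x : R := if 0 < x then x^-1 ^+ k * expR (- x^-1) else 0.

Lemma flat_ge0 k x : 0 <= flat k x.
Proof.
rewrite /flat; case: ifP => // x0.
by rewrite mulr_ge0 ?expR_ge0 ?exprn_ge0 ?invr_ge0 ?ltW.
Qed.

Lemma flat_le0 k x : x <= 0 -> flat k x = 0.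
Proof. by rewrite /flat leNgt => /negbTE ->. Qed.

Lemma flat_le k x : flat k x <= k`!%:R.
Proof.
rewrite /flat; case: ifP => // x0.
set y := x^-1; have y0 : 0 <= y by rewrite invr_ge0 ltW.
rewrite expRN ler_pdivrMr ?expR_gt0//.
case: k => [|k].
  by rewrite expr0 mul1r; apply: le_trans (expR_ge1Dx y); rewrite lerDl.
have h := expR_ge1Dxn k y0; rewrite -ler_pdivrMl ?ltr0n ?fact_gt0// mulrC.
by apply: le_trans h; rewrite lerDr.
Qed.

Lemma flatS k x : flat k x = x * flat k.+1 x.
Proof.
rewrite /flat; case: ifP => [x0|]; last by rewrite mulr0.
by rewrite exprS !mulrA divff ?mul1r// gt_eqF.
Qed.

(** Away from [0] this is calculus; at [0] the difference quotient of [flat k] is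
    [flat k.+1], which is continuous there because [flat k.+1 x = x * flat k.+2 x]
    with a bounded second factor. *)
Lemma is_derive_flat k x :
  is_derive x 1 (flat k) (- k%:R * flat k.+1 x + flat k.+2 x).
Proof.
have [x0|x0|->] := ltgtP x 0.
- apply: (@near_eq_is_derive _ _ _ (cst 0)).
    by near=> z; rewrite flat_le0// ltW//; near: z; exact: near_lt.
  by rewrite !flat_le0 ?ltW// mulr0 addr0; exact: is_derive_cst.
- apply: (@near_eq_is_derive _ _ _ (fun x => x^-1 ^+ k * expR (- x^-1))).
    by near=> z; rewrite /flat ifT//; near: z; exact: near_gt.
  have dV : is_derive x 1 (fun y : R => y^-1) (- x^-1 ^+ 2).
    apply: is_derive_eq; first by apply: is_deriveV; rewrite gt_eqF.
    by rewrite /GRing.scale /= mulr1 exprVn.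
  have dX : is_derive x 1 (fun y : R => y^-1 ^+ k)
                 (k%:R * x^-1 ^+ k.-1 * - x^-1 ^+ 2).
    have := @is_deriveX _ _ (fun y : R => y^-1) k x 1 _ dV.
    by rewrite (_ : (fun y : R => y^-1) ^+ k = (fun y : R => y^-1 ^+ k))// exprfctE.
  have dE : is_derive x 1 (fun y : R => expR (- y^-1)) (expR (- x^-1) * x^-1 ^+ 2).
    apply: (@is_derive1_comp _ expR (fun y => - y^-1)).
    by apply: is_derive_eq; rewrite opprK.
  apply: is_derive_eq (is_derive_mul dX dE) _.
  rewrite /flat x0; set y := x^-1; move: (expR _) => e.
  by case: k {dX} => [|k] /=; rewrite !exprS; ring.
- rewrite !flat_le0// mulr0 addr0; apply/is_derive1_caratheodory.
  exists (flat k.+1); split; last by rewrite flat_le0.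
    by move=> z; rewrite (flat_le0 k (lexx 0)) !subr0 mulrC -flatS.
  apply/cvgrPdist_le => _/posnumP[e]; rewrite flat_le0//.
  have c : 0 < e%:num / (k.+2)`!%:R :> R by rewrite divr_gt0// ltr0n fact_gt0.
  near=> z; rewrite sub0r normrN flatS normrM (ger0_norm (flat_ge0 _ _)).
  apply: (@le_trans _ _ (`|z| * (k.+2)`!%:R)).
    by rewrite ler_wpM2l// flat_le.
  have f0 : 0 < (k.+2)`!%:R :> R by rewrite ltr0n fact_gt0.
  rewrite -(ler_pdivlMr _ _ f0).
  near: z; exact: (@nbhs0_le _ R^o).
Unshelve. all: by end_near. Qed.

(** [dflat n k] is the [n]-th derivative of [flat k]. *)
Fixpoint dflat n k x : R :=
  if n is n'.+1 then - k%:R * dflat n' k.+1 x + dflat n' k.+2 x else flat k x.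

Lemma dflat_tower k : tower (dflat^~ k).
Proof.
move=> n x; elim: n k => [|n IH] k /=; first exact: is_derive_flat.
exact: (is_derive_add (is_derive_scale _ (IH _)) (IH _)).
Qed.

Lemma dflat_le0 n k x : x <= 0 -> dflat n k x = 0.
Proof.
by move=> x0; elim: n k => [|n IH] k /=; rewrite ?flat_le0// !IH mulr0 addr0.
Qed.

Lemma ler_fact m n : (m <= n)%N -> m`!%:R <= n`!%:R :> R.
Proof. by move=> mn; rewrite ler_nat leq_fact. Qed.

(** [flat k] is at most [k`!], and each derivative of [flat k] is a combination of
    [flat k.+1] and [flat k.+2]. *)
Lemma dflat_le n k x : `|dflat n k x| <= 2 ^+ n * (k + n.*2)`!%:R.
Proof.
elim: n k => [|n IH] k /=.
  by rewrite expr0 mul1r addn0 ger0_norm ?flat_ge0 ?flat_le.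
apply: le_trans (ler_normD _ _) _.
rewrite normrM normrN normr_nat exprS -mulrA (mulr_natl (_ * _) 2) mulr2n.
have -> : (k + n.+1.*2 = (k + n.*2).+2)%N by rewrite doubleS !addnS.
apply: lerD.
  apply: (@le_trans _ _ (k%:R * (2 ^+ n * (k.+1 + n.*2)`!%:R))).
    by rewrite ler_wpM2l.
  rewrite mulrCA ler_wpM2l ?exprn_ge0// -natrM ler_nat addSn [in leqRHS]factS.
  by rewrite leq_mul// leqW// leqW// leq_addr.
by apply: le_trans (IH _) _; rewrite !addSn.
Qed.

End FlatExponential.

(** * Plateau functions of Gevrey class 2 *)

Lemma le_of_eq (R : realType) (x y : R) : x = y -> x <= y.
Proof. by move->. Qed.

Section Gevrey.
Variable R : realType.
Implicit Types (x y a b A C : R) (n i j : nat) (F G : nat -> R -> R).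

Definition gevrey A C F : Prop :=
  forall n x, `|F n x| <= A * C ^+ n * n`!%:R ^+ 2.

Lemma gevrey_weak A A' C C' F : A <= A' -> 0 <= A' -> 0 <= C -> C <= C' ->
  gevrey A C F -> gevrey A' C' F.
Proof.
move=> AA A0 C0 CC gF n x; apply: le_trans (gF n x) _.
rewrite ler_wpM2r ?exprn_ge0// (le_trans (ler_wpM2r _ AA)) ?exprn_ge0//.
by rewrite ler_wpM2l// lerXn2r ?nnegrE// (le_trans C0).
Qed.

Lemma tower_affine F a b : tower F -> tower (fun n x => a ^+ n * F n (a * x + b)).
Proof.
move=> tF n x; rewrite exprSr -mulrA.
exact: (is_derive_scale _ (is_derive_affine (tF n _))).
Qed.

Lemma gevrey_affine A C F a b :
  gevrey A C F -> gevrey A (`|a| * C) (fun n x => a ^+ n * F n (a * x + b)).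
Proof.
move=> gF n x; rewrite normrM normrX exprMn (le_trans (ler_wpM2l _ (gF n _)))//.
by apply: le_of_eq; ring.
Qed.

(** [prodT F G 0 i j] is [F i * G j], and differentiation raises the first index,
    so that [prodT F G ^~ 0 ^~ 0] lists the derivatives of [F 0 * G 0]. *)
Fixpoint prodT F G n i j x : R :=
  if n is n'.+1 then prodT F G n' i.+1 j x + prodT F G n' i j.+1 x else F i x * G j x.

Lemma prodT_tower F G : tower F -> tower G -> tower (fun n => prodT F G n 0 0).
Proof.
move=> tF tG n x; move: 0%N {2 4}0%N => i j.
elim: n i j => [|n IH] i j; first exact: is_derive_mul.
exact: (is_derive_add (IH i.+1 j) (IH i j.+1)).
Qed.

Lemma prodT_gevrey A A' C F G : 0 <= A -> 0 <= A' -> 0 <= C ->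
  gevrey A C F -> gevrey A' C G ->
  gevrey (A * A') (2 * C) (fun n => prodT F G n 0 0).
Proof.
move=> A0 A'0 C0 gF gG n x.
suff h i j : `|prodT F G n i j x| <=
    A * A' * (2 ^+ n * C ^+ (n + i + j)) * (n + i + j)`!%:R ^+ 2.
  by have := h 0%N 0%N; rewrite !addn0 exprMn.
elim: n i j => [|n IH] i j /=.
  rewrite normrM (le_trans (ler_pM _ _ (gF i x) (gG j x)))//.
  rewrite expr0 mul1r add0n exprD.
  rewrite (_ : _ * _ * _ * (_ * _ * _) = A * A' * (C ^+ i * C ^+ j) * (i`! * j`!)%:R ^+ 2); last first.
    rewrite natrM. move: (C ^+ i) (C ^+ j) (i`!%:R : R) (j`!%:R : R) => c1 c2 f1 f2. ring.
  rewrite ler_wpM2l ?mulr_ge0 ?exprn_ge0// lerXn2r ?nnegrE// ler_nat.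
  by rewrite -(bin_fact (leq_addr j i)) addKn leq_pmull// bin_gt0 leq_addr.
apply: le_trans (ler_normD _ _) _.
apply: (le_trans (lerD (IH _ _) (IH _ _))).
rewrite !addnS !addSn (exprS 2); move: ((n + i + j).+1) => k.
by move: (_%:R ^+ 2) (C ^+ k) (2 ^+ n) => f c e; apply: le_of_eq; ring.
Qed.

Lemma prodT_eq0 F G n x : (forall i, F i x = 0) \/ (forall j, G j x = 0) ->
  prodT F G n 0 0 x = 0.
Proof.
move=> h; move: 0%N {2}0%N => i j.
elim: n i j => [|n IH] i j /=; last by rewrite !IH addr0.
by case: h => ->; rewrite ?mul0r ?mulr0.
Qed.

Lemma fact_double n : (n.*2)`!%:R <= 4 ^+ n * n`!%:R ^+ 2 :> R.
Proof.
elim: n => [|n IH]; first by rewrite expr0 mul1r expr1n.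
rewrite doubleS !factS !natrM.
apply: (@le_trans _ _ (((n.*2).+2 * (n.*2).+1)%:R * (4 ^+ n * n`!%:R ^+ 2))).
  by rewrite mulrA -natrM ler_wpM2l.
rewrite (exprS 4) exprMn.
rewrite (_ : 4 * _ * (_ * _) = (4 * n.+1%:R ^+ 2) * (4 ^+ n * n`!%:R ^+ 2)); last ring.
rewrite ler_wpM2r ?mulr_ge0 ?exprn_ge0// -natrX -natrM ler_nat.
by rewrite -mul2n; nia.
Qed.

Lemma dflat_gevrey : gevrey 1 8 (fun n => @dflat R n 0).
Proof.
move=> n x; rewrite mul1r (le_trans (dflat_le _ _ _))// add0n.
rewrite (_ : 8 = 2 * 4 :> R); last by ring.
by rewrite exprMn -mulrA ler_wpM2l ?exprn_ge0// fact_double.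
Qed.

(** Flat at both ends of [[0, 1]] and positive in between. *)
Definition hump n : R -> R :=
  prodT (fun n => dflat n 0) (fun n x => (-1) ^+ n * dflat n 0 (-1 * x + 1)) n 0 0.

Lemma hump_tower : tower hump.
Proof.
exact: prodT_tower (dflat_tower 0) (tower_affine (-1) 1 (dflat_tower 0)).
Qed.

Lemma hump_gevrey : gevrey 1 16 hump.
Proof.
have := gevrey_affine (-1) 1 dflat_gevrey; rewrite normrN1 mul1r => g.
have := @prodT_gevrey 1 1 8 _ _ ler01 ler01 (ler0n _ _) dflat_gevrey g.
by rewrite mulr1 (_ : 16 = 2 * 8 :> R); [exact|ring].
Qed.

Lemma hump_eq0 n x : x <= 0 \/ 1 <= x -> hump n x = 0.
Proof.
move=> h; apply: prodT_eq0; case: h => h; [left=> i|right=> i].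
  by rewrite dflat_le0.
by rewrite dflat_le0 ?mulr0//; lra.
Qed.

Lemma hump_ge0 x : 0 <= hump 0 x.
Proof. by rewrite /hump /= expr0 mul1r mulr_ge0// flat_ge0. Qed.

Lemma hump_gt0 x : 0 < x < 1 -> 0 < hump 0 x.
Proof.
move=> /andP[x0 x1]; rewrite /hump /= expr0 mul1r /flat x0 ifT; last lra.
by rewrite !expr0 !mul1r mulr_gt0 ?expR_gt0.
Qed.

Lemma hump_primitive : exists S : R -> R,
  (forall x, x <= 0 -> S x = 0) /\ (forall x, is_derive x 1 S (hump 0 x)).
Proof.
pose S x : R := (\int[lebesgue_measure]_(t in `[(-1)%R, x]) hump 0 t)%R.
have S0 x : x <= 0 -> S x = 0.
  move=> x0; rewrite /S (@eq_Rintegral _ _ _ _ _ (cst 0)).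
    by rewrite Rintegral_cst// mul0r.
  move=> t; rewrite inE/= in_itv/= => /andP[_ tx].
  by rewrite hump_eq0//; left; exact: le_trans x0.
exists S; split=> // x; have [x0|x0] := ltP x 0.
  apply: (@near_eq_is_derive _ _ _ (cst 0)).
    by near=> z; rewrite S0// ltW//; near: z; exact: near_lt.
  by rewrite hump_eq0; [exact: is_derive_cst|left; exact: ltW].
have [||||] := @continuous_FTC1_closed R (hump 0) (-1) x (x + 1).
- lra.
- apply: continuous_compact_integrable; first exact: segment_compact.
  by apply: continuous_subspaceT => z; exact: (tower_continuous hump_tower).
- lra.
- exact: (tower_continuous hump_tower).
- by move=> d1 d2; apply: DeriveDef; [exact: d1|rewrite -derive1E; exact: d2].
Unshelve. all: by end_near. Qed.

Section Step.
Variable S : R -> R.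
Hypothesis S_le0 : forall x, x <= 0 -> S x = 0.
Hypothesis is_derive_S : forall x, is_derive x 1 S (hump 0 x).

Let S_mvt x y : x < y -> exists2 c, x < c < y & S y - S x = hump 0 c * (y - x).
Proof.
move=> xy; have cS : {within `[x, y], continuous S}.
  by apply: continuous_subspaceT => z; exact: is_derive_continuous (is_derive_S z).
have [c] := MVT xy (fun z _ => is_derive_S z) cS.
by rewrite in_itv/= => cxy Sxy; exists c.
Qed.

Let S1_gt0 : 0 < S 1.
Proof.
have [c c01] := S_mvt (@ltr01 R); rewrite (S_le0 (lexx 0)) !subr0 mulr1 => ->.
exact: hump_gt0.
Qed.

Let S_homo x y : x <= y -> S x <= S y.
Proof.
rewrite le_eqVlt => /orP[/eqP->//|xy]; have [c _ h] := S_mvt xy.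
by rewrite -subr_ge0 h mulr_ge0 ?hump_ge0// subr_ge0 ltW.
Qed.

Let S_ge1 x : 1 <= x -> S x = S 1.
Proof.
rewrite le_eqVlt => /orP[/eqP->//|x1]; have [c cx h] := S_mvt x1.
apply/eqP; rewrite -subr_eq0 h hump_eq0 ?mul0r//.
by right; lra.
Qed.

(** The primitive of [hump], normalised to climb from 0 to 1 on [[0, 1]]. *)
Let step n x : R := if n is n'.+1 then (S 1)^-1 * hump n' x else (S 1)^-1 * S x.

Let step_tower : tower step.
Proof.
case=> [|n] x; first exact: (is_derive_scale _ (is_derive_S x)).
exact: (is_derive_scale _ (hump_tower n x)).
Qed.

Let step_le0 n x : x <= 0 -> step n x = 0.
Proof.
move=> x0; case: n => [|n] /=; first by rewrite (S_le0 x0) mulr0.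
by rewrite hump_eq0 ?mulr0//; left.
Qed.

Let step_ge1 x : 1 <= x -> step 0 x = 1.
Proof. by move=> x1; rewrite /= S_ge1// mulVf// gt_eqF. Qed.

Let step_gevrey : gevrey (1 + (S 1)^-1) 16 step.
Proof.
have V0 : 0 <= (S 1)^-1 by rewrite invr_ge0 ltW.
case=> [|n] x; rewrite /step.
  rewrite expr0 expr1n !mulr1 normrM ger0_norm//.
  apply: (@le_trans _ _ 1); last by rewrite lerDl.
  have [x0|x0] := leP x 0; first by rewrite (S_le0 x0) normr0 mulr0.
  rewrite ger0_norm; last by rewrite -(S_le0 (lexx 0)) S_homo// ltW.
  rewrite mulrC ler_pdivrMr// mul1r.
  by have [x1|/ltW x1] := leP x 1; [exact: S_homo|rewrite S_ge1].
rewrite normrM (ger0_norm V0) (le_trans (ler_wpM2l _ (hump_gevrey n x)))// mul1r.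
rewrite mulrA; apply: ler_pM.
- by rewrite mulr_ge0// exprn_ge0.
- by rewrite exprn_ge0.
- apply: ler_pM; rewrite ?exprn_ge0//; first by rewrite lerDr.
  by rewrite ler_weXn2l//; lra.
- by rewrite lerXn2r ?nnegrE// ler_fact.
Qed.

Lemma plateau_of_step (r : R) : 0 < r -> exists F A C,
  [/\ tower F, 1 <= A, 1 <= C, gevrey A C F &
      (forall n x, r <= `|x| -> F n x = 0) /\ (forall x, `|x| <= r / 2 -> F 0 x = 1)].
Proof.
move=> r0; pose a := 2 / r; have a0 : 0 < a by rewrite divr_gt0.
have ar : a * r = 2 by rewrite /a divfK// gt_eqF.
pose u n x := a ^+ n * step n (a * x + 2).
pose v n x := (- a) ^+ n * step n (- a * x + 2).
have V0 : 0 < (S 1)^-1 by rewrite invr_gt0.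
have gu : gevrey (1 + (S 1)^-1) (a * 16) u.
  by have := gevrey_affine a 2 step_gevrey; rewrite gtr0_norm.
have gv : gevrey (1 + (S 1)^-1) (a * 16) v.
  by have := gevrey_affine (- a) 2 step_gevrey; rewrite normrN gtr0_norm.
exists (fun n => prodT u v n 0 0), ((1 + (S 1)^-1) * (1 + (S 1)^-1)),
  (1 + 2 * (a * 16)); split.
- by apply: prodT_tower; exact: tower_affine.
- by rewrite -[leLHS]mulr1 ler_pM ?lerDl ?ltW.
- lra.
- have a16 : 0 <= a * 16 by rewrite mulr_ge0// ltW.
  have S0 : 0 <= 1 + (S 1)^-1 by rewrite addr_ge0// ltW.
  apply: gevrey_weak (prodT_gevrey S0 S0 a16 gu gv) => //.
  + by rewrite mulr_ge0.
  + by rewrite mulr_ge0.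
  + by rewrite lerDr.
- split.
    move=> n x; rewrite ler_normr => /orP[h|h]; apply: prodT_eq0; [right|left] => i.
      rewrite /v step_le0 ?mulr0//; have := ler_wpM2l (ltW a0) h; lra.
    rewrite /u step_le0 ?mulr0//; have := ler_wpM2l (ltW a0) h; lra.
  move=> x; rewrite ler_norml => /andP[h1 h2]; rewrite /= /u /v !expr0 !mul1r.
  have := ler_wpM2l (ltW a0) h2; have := ler_wpM2l (ltW a0) h1; rewrite mulrN mulrA ar => k1 k2.
  by rewrite !step_ge1 ?mulr1//; lra.
Qed.

End Step.

(** The product of a rising and of a falling step. Since the derivatives of order [n]
    grow like a power of [n`!], one such function serves as a cutoff at all stages. *)
Lemma plateau_exists (r : R) : 0 < r -> exists F A C,
  [/\ tower F, 1 <= A, 1 <= C, gevrey A C F &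
      (forall n x, r <= `|x| -> F n x = 0) /\ (forall x, `|x| <= r / 2 -> F 0 x = 1)].
Proof. by have [S [S0 S1]] := hump_primitive; exact: plateau_of_step S0 S1 r. Qed.

End Gevrey.

(** * Means over a period and trigonometric inequalities *)

HB.lock Definition avg (R : realType) (L : R) (f : R -> R) : R :=
  L^-1 * (\int[lebesgue_measure]_(t in `[(- (L / 2))%R, (L / 2)%R]) f t)%R.

Section Average.
Variables (R : realType) (L : R).
Hypothesis L0 : 0 < L.
Implicit Types f g : R -> R.

Let itg f : continuous f -> lebesgue_measure.-integrable `[(- (L / 2))%R, (L / 2)%R] (EFin \o f).
Proof.
move=> cf; apply: continuous_compact_integrable; first exact: segment_compact.
by apply: continuous_subspaceT => z; exact: cf.
Qed.

Lemma avgD f g : continuous f -> continuous g ->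
  avg L (fun t => f t + g t) = avg L f + avg L g.
Proof.
move=> cf cg; rewrite !avg.unlock -mulrDr; congr (_ * _).
by apply: RintegralD => //; exact: itg.
Qed.

Lemma avgZ (a : R) f : continuous f -> avg L (fun t => a * f t) = a * avg L f.
Proof.
move=> cf; rewrite !avg.unlock mulrCA; congr (_ * _).
by apply: RintegralZl => //; exact: itg.
Qed.

Lemma avg_le f g : continuous f -> continuous g ->
  (forall t, `|t| <= L / 2 -> f t <= g t) -> avg L f <= avg L g.
Proof.
move=> cf cg fg; rewrite !avg.unlock; apply: ler_wpM2l; first by rewrite invr_ge0 ltW.
apply: le_Rintegral => //; [exact: itg|exact: itg|].
by move=> t /=; rewrite in_itv/= -ler_norml; exact: fg.
Qed.

Lemma avg_cst (a : R) : avg L (fun=> a) = a.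
Proof.
rewrite avg.unlock Rintegral_cst//= lebesgue_measure_itv/=.
rewrite lte_fin ifT; last by have := L0; lra.
rewrite -EFinB/= opprK -splitr mulrCA mulVf ?mulr1//.
by rewrite gt_eqF.
Qed.

Lemma avg_derive (F f : R -> R) : (forall t : R, is_derive t 1 F (f t)) -> continuous f ->
  avg L f = L^-1 * (F (L / 2) - F (- (L / 2))).
Proof.
move=> dF cf; rewrite avg.unlock; congr (_ * _).
have cF : continuous F by move=> z; exact: is_derive_continuous (dF z).
rewrite /Rintegral (@continuous_FTC2 R f F)//.
- by have := L0; lra.
- by apply: continuous_subspaceT => z; exact: cf.
- split.
  + by move=> t _; have [] := dF t.
  + by apply: cvg_at_right_filter; exact: cF.
  + by apply: cvg_at_left_filter; exact: cF.
- by move=> t _; rewrite derive1E; have [_ ->] := dF t.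
Qed.

End Average.

Section Calculus.
Variable R : realType.
Implicit Types f g : R -> R.

Lemma continuous_cst_fun (a : R) : continuous (fun _ : R => a).
Proof. by move=> x; exact: cst_continuous. Qed.

Lemma continuous_mul f g : continuous f -> continuous g ->
  continuous (fun t => f t * g t).
Proof. by move=> cf cg x; apply: cvgM; [exact: cf|exact: cg]. Qed.

Lemma continuous_add f g : continuous f -> continuous g ->
  continuous (fun t => f t + g t).
Proof. by move=> cf cg x; apply: cvgD; [exact: cf|exact: cg]. Qed.

Lemma is_derive_cosM (w x : R) : is_derive x 1 (fun t => cos (w * t)) (- (w * sin (w * x))).
Proof.
have := is_derive_affine (is_derive_cos (w * x + 0)); rewrite !addr0 mulrN.
by under [X in is_derive _ _ X]funext do rewrite addr0.
Qed.

Lemma is_derive_sinM (w x : R) : is_derive x 1 (fun t => sin (w * t)) (w * cos (w * x)).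
Proof.
have := is_derive_affine (is_derive_sin (w * x + 0)); rewrite !addr0.
by under [X in is_derive _ _ X]funext do rewrite addr0.
Qed.

Lemma continuous_cosM (w : R) : continuous (fun t => cos (w * t)).
Proof. by move=> x; exact: is_derive_continuous (is_derive_cosM w x). Qed.

Lemma continuous_sinM (w : R) : continuous (fun t => sin (w * t)).
Proof. by move=> x; exact: is_derive_continuous (is_derive_sinM w x). Qed.

Lemma is_derive_big I (r : seq I) (h : I -> R -> R) (dh : I -> R) (x : R) :
  (forall i, is_derive (x : R) 1 (h i) (dh i)) ->
  is_derive x 1 (fun y => \sum_(i <- r) h i y) (\sum_(i <- r) dh i).
Proof.
move=> hd; elim: r => [|i r IH].
  by rewrite big_nil; under eq_fun do rewrite big_nil; exact: is_derive_cst.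
rewrite big_cons; under eq_fun do rewrite big_cons.
exact: is_derive_add (hd i) IH.
Qed.

Lemma continuous_big I (r : seq I) (h : I -> R -> R) :
  (forall i, continuous (h i)) -> continuous (fun y => \sum_(i <- r) h i y).
Proof.
move=> hd; elim: r => [|i r IH].
  by under eq_fun do rewrite big_nil; exact: continuous_cst_fun.
by under eq_fun do rewrite big_cons; exact: continuous_add (hd i) IH.
Qed.

Lemma avg_big (L : R) (L0 : 0 < L) I (r : seq I) (h : I -> R -> R) :
  (forall i, continuous (h i)) ->
  avg L (fun y => \sum_(i <- r) h i y) = \sum_(i <- r) avg L (h i).
Proof.
move=> hd; elim: r => [|i r IH].
  by rewrite big_nil; under eq_fun do rewrite big_nil; exact: avg_cst.
rewrite big_cons; under eq_fun do rewrite big_cons.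
by rewrite avgD ?IH//; exact: continuous_big.
Qed.

(** Up to [pi / 4] the derivative of sine is at least [cos (pi / 4)], and from there to
    [3 pi / 4] sine itself is. *)
Lemma sin_chord : exists2 c : R, 0 < c &
  forall z, 0 <= z <= 3 * pi / 4 -> c * z <= sin z.
Proof.
have p0 := pi_gt0 R; have p4 : pi < 4 :> R by have := pihalf_lt2 R; lra.
pose s : R := cos (pi / 4).
have s0 : 0 < s by apply: cos_gt0_pihalf; lra.
have cos_lb y : `|y| <= pi / 4 -> s <= cos y.
  move=> yp; rewrite -cos_norm /s; have y0 := normr_ge0 y.
  by rewrite leNgt ltr_cos ?in_itv/= -?leNgt; lra.
exists (s / 3); first by rewrite divr_gt0.
move=> z /andP[z0 z3]; have [z1|z1] := leP z (pi / 4).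
  move: z0; rewrite le_eqVlt => /orP[/eqP<-|z0]; first by rewrite mulr0 sin0.
  have cs : {within `[0, z], continuous (@sin R)}.
    by apply: continuous_subspaceT => y; exact: continuous_sin.
  have [c] := MVT z0 (fun x _ => is_derive_sin x) cs.
  rewrite in_itv/= sin0 !subr0 => /andP[c0 cz] ->.
  apply: ler_wpM2r; [exact: ltW|apply: (@le_trans _ _ s); first by lra].
  by apply: cos_lb; rewrite gtr0_norm//; lra.
rewrite -cosBpihalf; apply: (@le_trans _ _ s).
  rewrite -[leRHS]mulr1 -mulrA; apply: ler_wpM2l; [exact: ltW|lra].
by apply: cos_lb; rewrite ler_norml; lra.
Qed.

Lemma sqr_le_1Bcos : exists2 c : R, 0 < c &
  forall y, `|y| <= 3 * pi / 2 -> y ^+ 2 <= c * (1 - cos y).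
Proof.
have [c c0 hc] := sin_chord; exists (2 / c ^+ 2); first by rewrite divr_gt0 ?exprn_gt0.
move=> y hy; pose z := `|y| / 2.
have z0 : 0 <= z by rewrite divr_ge0.
have sz : c * z <= sin z by apply: hc; rewrite z0/= /z; lra.
have -> : 1 - cos y = 2 * sin z ^+ 2.
  rewrite -cos_norm (_ : `|y| = z *+ 2); last by rewrite /z mulr2n -splitr.
  by rewrite cos_mulr2n cos2sin2; ring.
have -> : y ^+ 2 = 4 * z ^+ 2 by rewrite /z -(real_normK (num_real y)); field.
have c2 : 0 < c ^+ 2 by rewrite exprn_gt0.
rewrite mulrA (_ : 2 / c ^+ 2 * 2 = 4 * (c ^+ 2)^-1); last by ring.
rewrite -mulrA ler_wpM2l// mulrC ler_pdivlMr// mulrC -exprMn.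
by rewrite lerXn2r ?nnegrE ?mulr_ge0 ?(ltW c0)// (le_trans _ sz) ?mulr_ge0 ?(ltW c0).
Qed.

Lemma sin_nat_pi k : sin (k%:R * pi) = 0 :> R.
Proof.
elim: k => [|k IH]; first by rewrite mul0r sin0.
by rewrite -addn1 natrD mulrDl mul1r sinDpi IH oppr0.
Qed.

(** The geometric sum of the unit complex numbers of angle [i theta], written in real
    terms: multiplied by [exp(i theta) - 1] it telescopes. *)
Lemma dirichlet_sq n (y : R) :
  (1 - cos y) * ((\sum_(i < n) cos (i%:R * y)) ^+ 2 + (\sum_(i < n) sin (i%:R * y)) ^+ 2)
  <= 2.
Proof.
set A := \sum_(i < n) _; set B := \sum_(i < n) _.
have E k : k.+1%:R * y = k%:R * y + y by rewrite -addn1 natrD mulrDl mul1r.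
have tA : (cos y - 1) * A - sin y * B = cos (n%:R * y) - 1.
  rewrite /A /B {A B}; elim: n => [|n IH]; first by rewrite !big_ord0 mul0r cos0; ring.
  rewrite !big_ord_recr /= E cosD.
  rewrite (_ : _ * (_ + _) - _ = ((cos y - 1) * (\sum_(i < n) cos (i%:R * y)) -
    sin y * (\sum_(i < n) sin (i%:R * y))) +
    ((cos y - 1) * cos (n%:R * y) - sin y * sin (n%:R * y))); last by ring.
  by rewrite IH; ring.
have tB : sin y * A + (cos y - 1) * B = sin (n%:R * y).
  rewrite {tA}/A /B {A B}; elim: n => [|n IH]; first by rewrite !big_ord0 mul0r sin0; ring.
  rewrite !big_ord_recr /= E sinD.
  rewrite (_ : _ * (_ + _) + _ = (sin y * (\sum_(i < n) cos (i%:R * y)) +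
    (cos y - 1) * (\sum_(i < n) sin (i%:R * y))) +
    (sin y * cos (n%:R * y) + (cos y - 1) * sin (n%:R * y))); last by ring.
  by rewrite IH; ring.
have : 2 * ((1 - cos y) * (A ^+ 2 + B ^+ 2)) = 2 - 2 * cos (n%:R * y).
  transitivity (((cos y - 1) ^+ 2 + sin y ^+ 2) * (A ^+ 2 + B ^+ 2)).
    by rewrite mulrA; congr (_ * _); rewrite (sin2cos2 y); ring.
  transitivity (((cos y - 1) * A - sin y * B) ^+ 2 + (sin y * A + (cos y - 1) * B) ^+ 2).
    by ring.
  by rewrite tA tB (sin2cos2 (n%:R * y)); ring.
by have := cos_geN1 (n%:R * y); lra.
Qed.

End Calculus.

(** * Fejer means *)

Section Fejer.
Variables (R : realType) (L : R).
Hypothesis L0 : 0 < L.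
Local Notation C := R[i].
Implicit Types (f : R -> R) (F : nat -> R -> R) (x t k w B : R) (n J : nat).

Definition cos_coef f w : R := avg L (fun t => f t * cos (w * t)).
Definition sin_coef f w : R := avg L (fun t => f t * sin (w * t)).

Definition freq n (p : 'I_n * 'I_n) : R := (p.1%:R - p.2%:R) / L.
Local Notation ang p := (2 * pi * freq p).

(** The [n]-th Fejer mean of the [L]-periodic Fourier series of [f], the sum over the
    pairs [p] producing the triangular weights. *)
Definition fejer n f x : R := \sum_(p : 'I_n * 'I_n)
  n%:R^-1 * (cos_coef f (ang p) * cos (ang p * x) + sin_coef f (ang p) * sin (ang p * x)).

Definition fourier_coef f k : C :=
  (cos_coef f (2 * pi * k) +i* - sin_coef f (2 * pi * k))%C.

Definition cexp x : C := (cos x +i* sin x)%C.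

Let cc f w : continuous f -> continuous (fun t => f t * cos (w * t)).
Proof. by move=> cf; apply: continuous_mul => //; exact: continuous_cosM. Qed.

Let cs f w : continuous f -> continuous (fun t => f t * sin (w * t)).
Proof. by move=> cf; apply: continuous_mul => //; exact: continuous_sinM. Qed.

Lemma freq_swap n (p : 'I_n * 'I_n) : freq (p.2, p.1) = - freq p.
Proof. by rewrite /freq /= -mulNr opprB. Qed.

(** The conjugate frequencies pair up, so the exponential sum is real. *)
Lemma fejerE n f x : continuous f -> ((fejer n f x)%:C)%C =
  \sum_(p : 'I_n * 'I_n) (n%:R^-1)%:C%C * fourier_coef f (freq p) * cexp (ang p * x).
Proof.
move=> cf.
pose a (p : 'I_n * 'I_n) : R := n%:R^-1 *
  (cos_coef f (ang p) * cos (ang p * x) + sin_coef f (ang p) * sin (ang p * x)).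
pose b (p : 'I_n * 'I_n) : R := n%:R^-1 *
  (cos_coef f (ang p) * sin (ang p * x) - sin_coef f (ang p) * cos (ang p * x)).
have -> : \sum_(p : 'I_n * 'I_n) (n%:R^-1)%:C%C * fourier_coef f (freq p) * cexp (ang p * x)
    = (((\sum_p a p)%:C)%C + 'i%C * ((\sum_p b p)%:C)%C).
  rewrite !rmorph_sum mulr_sumr -big_split; apply: eq_bigr => p _ /=.
  rewrite /fourier_coef /cexp /a /b; apply/eqP; rewrite eq_complex /=.
  by apply/andP; split; apply/eqP; ring.
suff -> : \sum_p b p = 0 by rewrite mulr0 addr0.
have : \sum_p b p = - \sum_p b p.
  rewrite -sumrN (reindex_inj (h := fun p : 'I_n * 'I_n => (p.2, p.1))).
    apply: eq_bigr => p _; rewrite /b freq_swap mulrN !mulNr cosN sinN.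
    have -> : cos_coef f (- ang p) = cos_coef f (ang p).
      rewrite /cos_coef; congr (avg L _).
      by apply/funext => t; rewrite mulNr cosN.
    have -> : sin_coef f (- ang p) = - sin_coef f (ang p).
      rewrite /sin_coef -[RHS]mulN1r -avgZ//; last exact: cs.
      congr (avg L _); apply/funext => t; rewrite mulNr sinN; ring.
    by ring.
  by move=> [p1 p2] [q1 q2] [-> ->].
by move=> h; apply/eqP; rewrite -[_ == 0](mulrn_eq0 _ 2) mulr2n {1}h addNr.
Qed.

Section Derivative.
Variable F : nat -> R -> R.
Hypotheses (tF : tower F) (F_supp : forall n t, L / 2 <= `|t| -> F n t = 0).

Let cF n : continuous (F n). Proof. exact: (tower_continuous tF). Qed.

Let F_end n : F n (L / 2) = 0 /\ F n (- (L / 2)) = 0.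
Proof.
have h : 0 <= L / 2 by rewrite divr_ge0// ltW.
by rewrite !F_supp ?normrN ?ger0_norm.
Qed.

Lemma cos_coefS n w : cos_coef (F n.+1) w = w * sin_coef (F n) w.
Proof.
have [e1 e2] := F_end n.
have dd t : is_derive t 1 (fun t => F n t * cos (w * t))
    (F n.+1 t * cos (w * t) + - w * (F n t * sin (w * t))).
  apply: is_derive_eq (is_derive_mul (tF n t) (is_derive_cosM w t)) _; ring.
have c1 : continuous (fun t => F n.+1 t * cos (w * t)) by exact: cc.
have c2 : continuous (fun t => - w * (F n t * sin (w * t))).
  by apply: continuous_mul; [exact: continuous_cst_fun|exact: cs].
have := avg_derive L0 dd (continuous_add c1 c2).
rewrite e1 e2 !mul0r subrr mulr0 avgD// avgZ; last exact: cs.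
by move/eqP; rewrite mulNr subr_eq0 => /eqP.
Qed.

Lemma sin_coefS n w : sin_coef (F n.+1) w = - w * cos_coef (F n) w.
Proof.
have [e1 e2] := F_end n.
have dd t : is_derive t 1 (fun t => F n t * sin (w * t))
    (F n.+1 t * sin (w * t) + w * (F n t * cos (w * t))).
  apply: is_derive_eq (is_derive_mul (tF n t) (is_derive_sinM w t)) _; ring.
have c1 : continuous (fun t => F n.+1 t * sin (w * t)) by exact: cs.
have c2 : continuous (fun t => w * (F n t * cos (w * t))).
  by apply: continuous_mul; [exact: continuous_cst_fun|exact: cc].
have := avg_derive L0 dd (continuous_add c1 c2).
rewrite e1 e2 !mul0r subrr mulr0 avgD// avgZ; last exact: cc.
by move/eqP; rewrite addr_eq0 mulNr => /eqP.
Qed.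

Lemma fejer_tower m : tower (fun n => fejer m (F n)).
Proof.
move=> n x; apply: is_derive_big => p; apply: is_derive_scale.
rewrite cos_coefS sin_coefS.
apply: is_derive_eq (is_derive_add (is_derive_scale _ (is_derive_cosM _ x))
                                   (is_derive_scale _ (is_derive_sinM _ x))) _.
ring.
Qed.

Lemma fourier_coefS n k :
  cmod (fourier_coef (F n.+1) k) = `|2 * pi * k| * cmod (fourier_coef (F n) k).
Proof.
rewrite /fourier_coef cos_coefS sin_coefS; move: (2 * pi * k) => w.
rewrite /cmod /= -mulNr opprK !exprMn sqrrN -mulrDr sqrtrM ?sqr_ge0// sqrtr_sqr.
by rewrite addrC.
Qed.

Lemma fourier_coefD n i k : cmod (fourier_coef (F (i + n)) k) =
  `|2 * pi * k| ^+ i * cmod (fourier_coef (F n) k).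
Proof. by elim: i => [|i IH]; rewrite ?mul1r// addSn fourier_coefS IH exprS mulrA. Qed.

Lemma fourier_coef_le f B k : continuous f -> (forall t, `|f t| <= B) ->
  cmod (fourier_coef f k) <= 2 * B.
Proof.
move=> cf fB; have B0 : 0 <= B := le_trans (normr_ge0 _) (fB 0).
have bnd (g : R -> R) : continuous g -> (forall t, `|g t| <= 1) ->
    `|avg L (fun t => f t * g t)| <= B.
  move=> cg g1; have h t : `|f t * g t| <= B.
    by rewrite normrM -[B]mulr1 ler_pM.
  rewrite ler_norml; apply/andP; split.
    rewrite -(avg_cst L0 (- B)); apply: avg_le => //; first exact: continuous_cst_fun.
      exact: continuous_mul.
    by move=> t _; have := h t; rewrite ler_norml => /andP[].
  rewrite -[leRHS](avg_cst L0 B); apply: avg_le => //; last first.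
    by move=> t _; have := h t; rewrite ler_norml => /andP[].
  - exact: continuous_cst_fun.
  - exact: continuous_mul.
rewrite /fourier_coef; set w := 2 * pi * k.
have -> : (cos_coef f w +i* - sin_coef f w)%C =
    ((cos_coef f w)%:C + 'i * (- sin_coef f w)%:C)%C.
  by apply/eqP; rewrite eq_complex /=; apply/andP; split; apply/eqP; ring.
apply: le_trans (cmodD _ _) _; rewrite cmodM !cmod_real normrN.
have -> : cmod 'i%C = 1 :> R by rewrite /cmod /= expr0n expr1n add0r sqrtr1.
rewrite mul1r mulr_natl mulr2n; apply: lerD; apply: bnd.
- exact: continuous_cosM.
- by move=> t; exact: cos_max.
- exact: continuous_sinM.
- by move=> t; exact: sin_max.
Qed.

(** Decay of the Fourier coefficients: each power of the frequency costs a derivative. *)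
Lemma fourier_coef_decay n J k B : (forall t, `|F n t| <= B) ->
  (forall t, `|F (J + n) t| <= B) ->
  cmod (fourier_coef (F n) k) * (1 + `|k|) ^+ J <= 2 ^+ J.+2 * B.
Proof.
move=> h1 h2.
have b1 := @fourier_coef_le (F n) B k (@cF n) h1.
have b2 := @fourier_coef_le (F (J + n)) B k (@cF (J + n)) h2.
have B0 : 0 <= B := le_trans (normr_ge0 _) (h1 0).
have p1 : 1 <= 2 * pi :> R by have := pi_ge2 R; lra.
have K0 := normr_ge0 k; have c0 := cmod_ge0 (fourier_coef (F n) k).
have kJ : cmod (fourier_coef (F n) k) * `|k| ^+ J <= 2 * B.
  apply: le_trans b2; rewrite fourier_coefD mulrC ler_wpM2r//.
  rewrite lerXn2r ?nnegrE// normrM ler_peMl//.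
  by rewrite (le_trans p1)// ler_norm.
have kk : (1 + `|k|) ^+ J <= 2 ^+ J * (1 + `|k| ^+ J).
  have [k1|/ltW k1] := leP `|k| 1.
    apply: (@le_trans _ _ (2 ^+ J)); first by rewrite lerXn2r ?nnegrE//; lra.
    by rewrite ler_peMr ?exprn_ge0// lerDl exprn_ge0.
  apply: (@le_trans _ _ (2 ^+ J * `|k| ^+ J)).
    by rewrite -exprMn lerXn2r ?nnegrE//; lra.
  by rewrite ler_wpM2l ?exprn_ge0// lerDr.
apply: le_trans (ler_wpM2l c0 kk) _.
rewrite mulrCA !exprS (_ : 2 * (2 * 2 ^+ J) * B = 2 ^+ J * (2 * B + 2 * B)); last ring.
by rewrite ler_wpM2l ?exprn_ge0// mulrDr mulr1 lerD.
Qed.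

End Derivative.

Section Convergence.

Let kern n x : R := n%:R^-1 * \sum_(p : 'I_n * 'I_n) cos (ang p * x).

Let kernE n x : kern n x = n%:R^-1 *
  ((\sum_(i < n) cos (i%:R * (2 * pi * x / L))) ^+ 2 +
   (\sum_(i < n) sin (i%:R * (2 * pi * x / L))) ^+ 2).
Proof.
rewrite /kern !expr2 !big_distrlr /= -big_split /=; congr (_ * _).
under [RHS]eq_bigr => i _ do rewrite -big_split.
rewrite pair_bigA; apply: eq_bigr => p _ /=.
by rewrite -cosB; congr cos; rewrite /freq; ring.
Qed.

Let kern_ge0 n x : 0 <= kern n x.
Proof. by rewrite kernE mulr_ge0// addr_ge0// sqr_ge0. Qed.

Let kern_le n x : (1 - cos (2 * pi * x / L)) * kern n x <= 2 / n%:R.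
Proof.
rewrite kernE mulrCA mulrC ler_wpM2r ?invr_ge0//.
exact: dirichlet_sq.
Qed.

Let cont_cosB w x : continuous (fun t => cos (w * (x - t))).
Proof.
have -> : (fun t => cos (w * (x - t))) =
    (fun t => cos (w * x) * cos (w * t) + sin (w * x) * sin (w * t)).
  by apply/funext => t; rewrite mulrBr cosB.
apply: continuous_add; apply: continuous_mul; try exact: continuous_cst_fun.
- exact: continuous_cosM.
- exact: continuous_sinM.
Qed.

Let cont_kern n x : continuous (fun t => kern n (x - t)).
Proof.
apply: continuous_mul; first exact: continuous_cst_fun.
by apply: continuous_big => p; exact: cont_cosB.
Qed.

Let avg_cos n (p : 'I_n * 'I_n) x :
  avg L (fun t => cos (ang p * (x - t))) = (p.1 == p.2)%:R.
Proof.
have [pp|pp] := eqVneq p.1 p.2.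
  rewrite -(avg_cst L0 1); congr avg; apply/funext => t.
  by rewrite /freq pp subrr mul0r mulr0 mul0r cos0.
set w := ang p.
have p0 := pi_gt0 R.
have w0 : w != 0.
  rewrite /w /freq; apply: mulf_neq0; first by rewrite mulf_neq0// gt_eqF.
  apply: mulf_neq0; last by rewrite invr_eq0 gt_eqF.
  by rewrite subr_eq0 eqr_nat; exact: pp.
have dd t : is_derive (t : R) 1 (fun t => - w^-1 * sin (- w * t + w * x)) (cos (w * (x - t))).
  apply: is_derive_eq
    (is_derive_scale (- w^-1) (is_derive_affine (is_derive_sin (- w * t + w * x)))) _.
  rewrite mulrA mulrNN mulVf// mul1r; congr cos; ring.
rewrite (avg_derive L0 dd); last exact: cont_cosB.
have wL : w * (L / 2) = (p.1%:R - p.2%:R) * pi.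
  by rewrite /w /freq; field; rewrite gt_eqF.
have sb : sin (w * (L / 2)) = 0.
  by rewrite wL mulrBl sinB !sin_nat_pi mul0r mulr0 subrr.
rewrite (mulrNN w) (mulNr w) !sinD sinN cosN sb /=; ring.
Qed.

Let avg_kern n x : (0 < n)%N -> avg L (fun t => kern n (x - t)) = 1.
Proof.
move=> n0; rewrite avgZ//; last by apply: continuous_big => p; exact: cont_cosB.
rewrite avg_big; [|exact: L0|by move=> p; exact: cont_cosB].
under eq_bigr do rewrite avg_cos.
rewrite -(pair_bigA _ (fun i j : 'I_n => (i == j)%:R)) /=.
rewrite (eq_bigr (fun=> 1)); last first.
  move=> i _; rewrite (bigD1 i)//= eqxx big1 ?addr0// => j ji.
  by rewrite eq_sym (negbTE ji).
by rewrite sumr_const card_ord mulVf// pnatr_eq0 -lt0n.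
Qed.

Let fejer_avg n f x : continuous f -> fejer n f x = avg L (fun t => f t * kern n (x - t)).
Proof.
move=> cf; have -> : (fun t => f t * kern n (x - t)) = (fun t => \sum_(p : 'I_n * 'I_n)
    ((n%:R^-1 * cos (ang p * x)) * (f t * cos (ang p * t)) +
     (n%:R^-1 * sin (ang p * x)) * (f t * sin (ang p * t)))).
  apply/funext => t; rewrite /kern mulrCA mulr_sumr mulr_sumr; apply: eq_bigr => p _.
  by rewrite mulrBr cosB; ring.
have c1 (a w : R) : continuous (fun t => a * (f t * cos (w * t))).
  by apply: continuous_mul; [exact: continuous_cst_fun|exact: cc].
have c2 (a w : R) : continuous (fun t => a * (f t * sin (w * t))).
  by apply: continuous_mul; [exact: continuous_cst_fun|exact: cs].
rewrite avg_big; [|exact: L0|by move=> p; exact: continuous_add].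
apply: eq_bigr => p _; rewrite avgD// !avgZ; [|exact: cs|exact: cc].
by rewrite -/(cos_coef f _) -/(sin_coef f _); ring.
Qed.

(** The error [fejer n f x - f x] is the mean of [v * kern] with [v t = f t - f x]
    and [v ^+ 2 <= K * (1 - cos)], a quantity whose product with the kernel is
    [O(1 / n)]; the bound [|v| <= e + v ^+ 2 / e] brings the square in. *)
Lemma fejer_cvg f Lam e : continuous f -> 0 <= Lam ->
  (forall x t, `|f x - f t| <= Lam * `|x - t|) -> 0 < e ->
  \forall n \near \oo, forall x, `|x| <= L / 4 -> `|fejer n f x - f x| <= e.
Proof.
move=> cf Lam0 lip e0; have [c c0 hc] := sqr_le_1Bcos R.
pose K := Lam ^+ 2 * (c * L ^+ 2).
have K0 : 0 <= K by rewrite mulr_ge0 ?sqr_ge0// mulr_ge0 ?sqr_ge0// ltW.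
have e2 : 0 < e / 2 by rewrite divr_gt0.
near=> n => x xL.
have n0 : (0 < n)%N by near: n; exact: nbhs_infty_gt.
have nR : 0 < n%:R :> R by rewrite ltr0n.
have hn : 8 * K / e ^+ 2 <= n%:R by near: n; exact: nbhs_infty_ger.
have ck : continuous (fun t => kern n (x - t)) := @cont_kern n x.
have cfk : continuous (fun t => f t * kern n (x - t)) by exact: continuous_mul.
have cxk (a : R) : continuous (fun t => a * kern n (x - t)).
  by apply: continuous_mul => //; exact: continuous_cst_fun.
pose m := e / 2 * 1 + (K * (2 / n%:R)) / (e / 2).
have mle : m <= e.
  rewrite /m mulr1 {3}(splitr e) lerD2l.
  rewrite ler_pdivrMr// mulrA ler_pdivrMr//.
  move: hn; rewrite ler_pdivrMr ?exprn_gt0//; move: (n%:R : R) => N hN.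
  rewrite (_ : e / 2 * (e / 2) * N = (N * e ^+ 2) / 4); last by field.
  by rewrite ler_pdivlMr//; apply: le_trans hN; apply: le_of_eq; ring.
have bnd t : `|t| <= L / 2 ->
    `|f t - f x| * kern n (x - t) <= e / 2 * kern n (x - t) + (K * (2 / n%:R)) / (e / 2).
  move=> tL; have k0 := kern_ge0 n (x - t).
  have v2 : `|f t - f x| ^+ 2 <= K * (1 - cos (2 * pi * (x - t) / L)).
    apply: (@le_trans _ _ ((Lam * `|x - t|) ^+ 2)).
      by rewrite lerXn2r ?nnegrE ?mulr_ge0// distrC lip.
    rewrite exprMn real_normK ?num_real// /K -mulrA ler_wpM2l ?sqr_ge0//.
    have : (2 * pi * (x - t) / L) ^+ 2 <= c * (1 - cos (2 * pi * (x - t) / L)).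
      apply: hc; rewrite normrM normfV (gtr0_norm L0) ler_pdivrMr// normrM.
      rewrite gtr0_norm ?mulr_gt0 ?pi_gt0//.
      rewrite (_ : 3 * pi / 2 * L = 2 * pi * (3 * L / 4)); last by field.
      rewrite ler_wpM2l ?mulr_ge0 ?pi_ge0//.
      by apply: le_trans (ler_normB _ _) _; move: xL tL; lra.
    move=> h; apply: (@le_trans _ _ ((2 * pi * (x - t) / L) ^+ 2 * L ^+ 2)).
      rewrite (_ : _ ^+ 2 * _ = (2 * pi) ^+ 2 * (x - t) ^+ 2); last by field; rewrite gt_eqF.
      by rewrite ler_peMl ?sqr_ge0// -[1]mulr1 expr2 ler_pM//; have := pi_ge2 R; lra.
    by rewrite (mulrAC c) ler_wpM2r ?sqr_ge0.
  have amgm : `|f t - f x| <= e / 2 + `|f t - f x| ^+ 2 / (e / 2).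
    rewrite -(ler_pM2r e2) mulrDl divfK ?gt_eqF//.
    by have := sqr_ge0 (`|f t - f x| - e / 2 / 2); nra.
  apply: le_trans (ler_wpM2r k0 amgm) _.
  rewrite mulrDl lerD2l mulrAC ler_wpM2r ?invr_ge0 ?(ltW e2)//.
  apply: le_trans (ler_wpM2r k0 v2) _.
  by have := ler_wpM2l K0 (kern_le n (x - t)); rewrite [X in X <= _]mulrA.
have ub (s : R) : `|s| = 1 -> s * (fejer n f x - f x) <= m.
  move=> s1.
  have -> : s * (fejer n f x - f x) = avg L (fun t => s * (f t * kern n (x - t)) +
      (- (s * f x)) * kern n (x - t)).
    rewrite avgD//; last by apply: continuous_mul => //; exact: continuous_cst_fun.
    rewrite avgZ// avgZ// avg_kern// fejer_avg//; ring.
  have -> : m = avg L (fun t => e / 2 * kern n (x - t) + (K * (2 / n%:R)) / (e / 2)).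
    by rewrite avgD//; [rewrite avgZ// avg_kern// avg_cst|exact: continuous_cst_fun].
  apply: avg_le => //.
  - by apply: continuous_add => //; apply: continuous_mul => //; exact: continuous_cst_fun.
  - by apply: continuous_add => //; exact: continuous_cst_fun.
  - move=> t tL; apply: le_trans (bnd t tL).
    rewrite (_ : _ + _ = (s * (f t - f x)) * kern n (x - t)); last by ring.
    rewrite ler_wpM2r// (le_trans (ler_norm _))// normrM s1 mul1r//.
apply: le_trans mle; rewrite ler_norml; apply/andP; split.
  by have := ub (-1); rewrite normrN1 => /(_ erefl); lra.
by have := ub 1; rewrite normr1 => /(_ erefl); lra.
Unshelve. all: by end_near. Qed.

End Convergence.
End Fejer.

Section Weights.
Variables (R : realType) (L : R).
Hypothesis L1 : 1 <= L.
Implicit Types (F : nat -> R -> R) (n J : nat) (B : R).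

Let L0 : 0 < L. Proof. exact: lt_le_trans L1. Qed.

(** [1 / (1 + |k|) ^ 2] is dominated by twice the increment at [k] of the bounded
    increasing function [k / (1 + |k|)]. *)
Let telescoping_bound (i l : nat) : (1 + `|l%:R - i%:R : R|) ^- 2 <=
  2 * ((l.+1%:R - i%:R) / (1 + `|l.+1%:R - i%:R|) - (l%:R - i%:R) / (1 + `|l%:R - i%:R|)) :> R.
Proof.
have e : l.+1%:R - i%:R = (l%:R - i%:R) + 1 :> R by rewrite -addn1 natrD; ring.
have [il|li] := leqP i l.
  have k0 : 0 <= l%:R - i%:R :> R by rewrite subr_ge0 ler_nat.
  rewrite e; move: k0; move: (_ - _) => k k0.
  rewrite !ger0_norm//; last by rewrite addr_ge0.
  have -> : 2 * ((k + 1) / (1 + (k + 1)) - k / (1 + k)) = 2 / ((1 + k) * (2 + k)).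
    by field; rewrite !gt_eqF//; lra.
  rewrite ler_pdivlMr ?mulr_gt0//; [|lra|lra].
  rewrite (_ : (1 + k) ^- 2 * _ = (2 + k) / (1 + k)); last by field; rewrite gt_eqF//; lra.
  by rewrite ler_pdivrMr; lra.
have k0 : 0 <= i%:R - l.+1%:R :> R by rewrite subr_ge0 ler_nat.
have -> : l%:R - i%:R = - (i%:R - l.+1%:R + 1) :> R by rewrite -addn1 natrD; ring.
have -> : l.+1%:R - i%:R = - (i%:R - l.+1%:R) :> R by ring.
move: k0; move: (_ - _) => k k0.
rewrite !normrN !ger0_norm//; last by rewrite addr_ge0.
have -> : 2 * (- k / (1 + k) - - (k + 1) / (1 + (k + 1))) = 2 / ((1 + k) * (2 + k)).
  by field; rewrite !gt_eqF//; lra.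
rewrite ler_pdivlMr ?mulr_gt0//; [|lra|lra].
rewrite (_ : 1 + (k + 1) = 2 + k); last by ring.
rewrite (_ : (2 + k) ^- 2 * _ = (1 + k) / (2 + k)); last by field; rewrite gt_eqF//; lra.
by rewrite ler_pdivrMr; lra.
Qed.

Lemma freq_weight_sum n : (0 < n)%N ->
  \sum_(p : 'I_n * 'I_n) n%:R^-1 * (1 + `|freq L p|) ^- 2 <= 4 * L ^+ 2.
Proof.
move=> n0; rewrite -mulr_sumr.
rewrite -(pair_bigA _ (fun i j : 'I_n => (1 + `|freq L (i, j)|) ^- 2)) /=.
have row (i : 'I_n) : \sum_(j < n) (1 + `|freq L (i, j)|) ^- 2 <= 4 * L ^+ 2.
  apply: (@le_trans _ _ (\sum_(j < n) L ^+ 2 * (1 + `|j%:R - i%:R : R|) ^- 2)).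
    apply: ler_sum => j _; rewrite /freq /= normrM distrC normfV (gtr0_norm L0).
    set k := `|_ : R|; have k0 : 0 <= k by exact: normr_ge0.
    have p1 : 0 < 1 + k / L by rewrite ltr_wpDr ?divr_ge0// ltW.
    have p2 : 0 < 1 + k by rewrite ltr_wpDr.
    rewrite -ler_pdivrMl ?exprn_gt0// -invfM lef_pV2 ?posrE.
    - rewrite -exprMn lerXn2r ?nnegrE ?mulr_ge0 ?addr_ge0 ?divr_ge0 ?(ltW L0)//.
      by rewrite mulrDr mulr1 mulrCA divff ?gt_eqF// mulr1 lerD2r.
    - by rewrite mulr_gt0// exprn_gt0.
    - by rewrite exprn_gt0.
  rewrite -mulr_sumr mulrC ler_wpM2r ?sqr_ge0//.
  apply: (le_trans (ler_sum _ (fun (l : 'I_n) _ => telescoping_bound i l))).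
  rewrite -mulr_sumr (_ : 4 = 2 * 2 :> R); last by ring.
  rewrite ler_wpM2l//.
  rewrite -(big_mkord xpredT (fun l => (l.+1%:R - i%:R) / (1 + `|l.+1%:R - i%:R|) -
    (l%:R - i%:R) / (1 + `|l%:R - i%:R : R|))).
  rewrite telescope_sumr//.
  have b (k : R) : `|k / (1 + `|k|)| <= 1.
    have p : 0 < 1 + `|k| by rewrite ltr_wpDr.
    by rewrite normrM normfV (gtr0_norm p) ler_pdivrMr// mul1r lerDr.
  have := b (n%:R - i%:R); have := b (0 - i%:R).
  rewrite !ler_norml => /andP[h1 h2] /andP[h3 h4].
  by move: h1 h4; rewrite (_ : 0%:R = 0 :> R)//; lra.
apply: (@le_trans _ _ (n%:R^-1 * \sum_(i < n) 4 * L ^+ 2)).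
  by rewrite ler_wpM2l ?invr_ge0//; apply: ler_sum => i _; exact: row.
by rewrite sumr_const card_ord -[X in _ * X <= _]mulr_natl mulKf// pnatr_eq0 -lt0n.
Qed.

(** Two of the [J.+2] derivatives pay for the summable weight [(1 + |freq|) ^- 2], which
    makes the bound independent of the order [m] of the mean. *)
Lemma fejer_coef_sum F n J m B : tower F ->
  (forall i t, L / 2 <= `|t| -> F i t = 0) -> (0 < m)%N ->
  (forall t, `|F n t| <= B) -> (forall t, `|F (J.+2 + n)%N t| <= B) ->
  \sum_(p : 'I_m * 'I_m)
    cmod ((m%:R^-1)%:C%C * fourier_coef L (F n) (freq L p)) * (1 + `|freq L p|) ^+ J
  <= 4 * L ^+ 2 * (2 ^+ (J + 4) * B).
Proof.
move=> tF F0 m0 h1 h2; have B0 : 0 <= B := le_trans (normr_ge0 _) (h1 0).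
apply: (@le_trans _ _ (\sum_(p : 'I_m * 'I_m)
    m%:R^-1 * (1 + `|freq L p|) ^- 2 * (2 ^+ (J + 4) * B))); last first.
  rewrite -mulr_suml; apply: ler_wpM2r; last exact: freq_weight_sum.
  by rewrite mulr_ge0 ?exprn_ge0.
apply: ler_sum => p _; rewrite cmodM cmod_real ger0_norm ?invr_ge0//.
rewrite -!mulrA ler_wpM2l ?invr_ge0//.
have := fourier_coef_decay L0 tF F0 (freq L p) h1 h2.
have w0 : 0 < 1 + `|freq L p| by rewrite ltr_wpDr.
move=> h; rewrite ler_pdivlMl ?exprn_gt0//; move: h; rewrite -(addn4 J) => h.
by apply: le_trans h; apply: le_of_eq; rewrite -(addn2 J) exprD; ring.
Qed.

End Weights.

(** * Tensor products and plane waves *)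

Section Products.
Variables (R : realType) (d : nat).
Local Notation E := 'rV[R]_d.
Local Notation C := R[i].
Implicit Types (x a xi : E) (j : 'I_d) (s : seq 'I_d) (gam : 'I_d -> nat).

Lemma derive_line (f : E -> R) x v :
  'D_v f x = 'D_1 (fun t : R => f (t *: v + x)) 0.
Proof.
rewrite /derive; set g1 := (X in X @ _); set g2 := (X in _ = lim (X @ _)).
suff -> : g1 = g2 by [].
apply/funext => h; rewrite /g1 /g2 /=.
by rewrite scale0r add0r addr0 [h *: 1]mulr1.
Qed.

Lemma is_derive_const_mul (f : R -> R) (k x df : R) :
  is_derive x 1 f df -> is_derive x 1 (fun y => f y * k) (df * k).
Proof.
move=> fd; rewrite mulrC (_ : (fun y => f y * k) = (fun y => k * f y)).
  exact: is_derive_scale.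
by apply/funext => y; rewrite mulrC.
Qed.

Definition madd gam j : 'I_d -> nat := fun i => (gam i + (i == j))%N.

Definition maddl gam s : 'I_d -> nat := foldr (fun j g => madd g j) gam s.

Lemma mi_order_madd gam j : mi_order (madd gam j) = (mi_order gam).+1.
Proof.
rewrite /mi_order /madd big_split /= -addn1; congr (_ + _)%N.
rewrite (bigD1 j)//= eqxx big1 ?addn0// => i ij; by rewrite (negbTE ij).
Qed.

Lemma mi_order_maddl gam s : mi_order (maddl gam s) = (size s + mi_order gam)%N.
Proof. by elim: s => //= j s IH; rewrite mi_order_madd IH. Qed.

(** The analogue of [tower] in several variables: every iterated derivative is again a
    member of the family. *)
Definition mtower (G : ('I_d -> nat) -> E -> C) : Prop := forall gam x,
  cdifferentiable (G gam) x /\ forall j, cpartial j (G gam) x = G (madd gam j) x.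

Lemma mtower_partials G s gam : mtower G -> cpartials s (G gam) = G (maddl gam s).
Proof.
by move=> mG; elim: s => //= j s ->; apply/funext => x; have [_ ->] := mG (maddl gam s) x.
Qed.

Lemma mtower_smooth (O : set E) G gam : mtower G -> smooth_on O (G gam).
Proof. by move=> mG s x _; rewrite mtower_partials//; have [] := mG (maddl gam s) x. Qed.

Lemma mtowerB G H : mtower G -> mtower H -> mtower (fun gam x => G gam x - H gam x).
Proof.
move=> mG mH gam x; have [g1 g2] := mG gam x; have [h1 h2] := mH gam x.
have mN y : - H gam y = -1 * H gam y by rewrite mulN1r.
have eN : (fun y => G gam y - H gam y) = (fun y => G gam y + -1 * H gam y).
  by apply/funext => y; rewrite mN.
have dc : cdifferentiable (fun _ : E => -1 : C) x by exact: cdifferentiable_cst.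
have dN : cdifferentiable (fun y => -1 * H gam y) x by exact: cdifferentiableM.
rewrite eN; split; first exact: cdifferentiableD.
move=> j; rewrite (cpartialD j g1 dN) (cpartialM j dc h1).
by rewrite cpartial_cst mul0r add0r g2 h2 mulN1r.
Qed.

(** Tensor powers, centred at [a], of functions of one variable. *)
Definition tensor (F : nat -> R -> R) a gam x : C :=
  ((\prod_j F (gam j) (x 0 j - a 0 j))%:C)%C.

Lemma differentiable_coord_comp (f : R -> R) (b : R) j x :
  (forall y : R, derivable f y 1) -> differentiable (fun y : E => f (y 0 j - b)) x.
Proof.
move=> df.
have d1 : differentiable (fun y : E => y 0 j - b) x.
  apply: differentiableB; first exact: differentiable_coord.
  exact: differentiable_cst.
have d2 : differentiable f (x 0 j - b) by apply/derivable1_diffP.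
exact: (differentiable_comp d1 d2).
Qed.

Lemma mtower_tensor F a : tower F -> mtower (tensor F a).
Proof.
move=> tF gam x; split.
  split => /=; last exact: differentiable_cst.
  elim: (index_enum _) => [|j r IH].
    by under eq_fun do rewrite big_nil; exact: differentiable_cst.
  under eq_fun do rewrite big_cons.
  apply: differentiableM => //; apply: differentiable_coord_comp => y.
  by have [] := tF (gam j) y.
move=> i; rewrite /cpartial /tensor /= derive_cst.
apply/eqP; rewrite eq_complex /= eqxx andbT; apply/eqP.
rewrite derive_line.
set k := \prod_(j | j != i) F (gam j) (x 0 j - a 0 j).
have -> : (fun t : R => \prod_j F (gam j) ((t *: delta_mx 0 i + x) 0 j - a 0 j)) =
    (fun t : R => F (gam i) (1 * t + (x 0 i - a 0 i)) * k).
  apply/funext => t; rewrite (bigD1 i)//=; congr (F _ _ * _).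
    by rewrite !mxE !eqxx mulr1 mul1r addrA.
  by apply: eq_bigr => j ji; rewrite !mxE (negbTE ji) andbF mulr0 add0r.
have [_ ->] := is_derive_const_mul k (is_derive_affine (tF (gam i) (1 * 0 + (x 0 i - a 0 i)))).
rewrite mul1r mul1r add0r (bigD1 i)//= /madd eqxx addn1; congr (_ * _).
by apply: eq_bigr => j ji; rewrite (negbTE ji) addn0.
Qed.

(** The eigenvalue of the [j]-th partial derivative on the plane wave of frequency [xi]. *)
Definition zfreq xi j : C := (0 +i* - (2 * pi * xi 0 j))%C.

Lemma dot_line x v xi t : dot (t *: v + x) xi = t * dot v xi + dot x xi.
Proof.
rewrite /dot mulr_sumr -big_split /=; apply: eq_bigr => j _.
by rewrite !mxE mulrDl mulrA.
Qed.

Lemma dot_delta j xi : dot (delta_mx 0 j) xi = xi 0 j.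
Proof.
rewrite /dot (bigD1 j)//= !mxE !eqxx mul1r big1 ?addr0// => i ij.
by rewrite !mxE (negbTE ij) andbF mul0r.
Qed.

Lemma differentiable_dot xi x : differentiable (fun y => dot y xi) x.
Proof.
rewrite /dot; elim: (index_enum _) => [|j r IH].
  by under eq_fun do rewrite big_nil; exact: differentiable_cst.
under eq_fun do rewrite big_cons.
apply: differentiableD => //; apply: differentiableM; last exact: differentiable_cst.
exact: differentiable_coord.
Qed.

Lemma cdifferentiable_kernel xi x : cdifferentiable (fourier_kernel xi) x.
Proof.
have dd : differentiable (fun y => 2 * pi * dot y xi) x.
  apply: differentiableM; first exact: differentiable_cst.
  exact: differentiable_dot.
split => /=.
  apply: (differentiable_comp dd); apply/derivable1_diffP; exact: derivable_cos.
apply: differentiableN.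
apply: (differentiable_comp dd); apply/derivable1_diffP; exact: derivable_sin.
Qed.

Lemma cpartial_kernel j xi x :
  cpartial j (fourier_kernel xi) x = zfreq xi j * fourier_kernel xi x.
Proof.
rewrite /cpartial /fourier_kernel /=.
set w := 2 * pi * xi 0 j; set b := 2 * pi * dot x xi.
have e t : 2 * pi * dot (t *: delta_mx 0 j + x) xi = w * t + b.
  by rewrite dot_line dot_delta /w /b; ring.
have d1 : 'D_(delta_mx 0 j) (fun y => cos (2 * pi * dot y xi)) x = - (w * sin b).
  rewrite derive_line; under eq_fun do rewrite e.
  have [_ ->] := is_derive_affine (is_derive_cos (w * 0 + b)).
  by rewrite mulr0 add0r mulrN.
have d2 : 'D_(delta_mx 0 j) (fun y => - sin (2 * pi * dot y xi)) x = - (w * cos b).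
  rewrite derive_line; under eq_fun do rewrite e -mulN1r.
  have [_ ->] := is_derive_scale (-1) (is_derive_affine (is_derive_sin (w * 0 + b))).
  by rewrite mulr0 add0r mulN1r.
rewrite d1 d2 /zfreq; apply/eqP; rewrite eq_complex /= -/w.
by apply/andP; split; apply/eqP; ring.
Qed.

Lemma cpartials_kernel s xi :
  cpartials s (fourier_kernel xi) = (fun x => (\prod_(j <- s) zfreq xi j) * fourier_kernel xi x).
Proof.
elim: s => [|j s IH] /=.
  by apply/funext => x; rewrite big_nil mul1r.
rewrite IH; apply/funext => x; rewrite cpartialM.
- by rewrite cpartial_cst mul0r add0r cpartial_kernel big_cons mulrCA mulrA.
- exact: cdifferentiable_cst.
- exact: cdifferentiable_kernel.
Qed.

Lemma smooth_kernel (O : set E) xi : smooth_on O (fourier_kernel xi).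
Proof.
move=> s x _; rewrite cpartials_kernel; apply: cdifferentiableM.
- exact: cdifferentiable_cst.
- exact: cdifferentiable_kernel.
Qed.

Lemma cmod_kernel xi x : cmod (fourier_kernel xi x) = 1.
Proof. by rewrite /cmod /= sqrrN cos2Dsin2 sqrtr1. Qed.

Lemma coord_le_norm x j : `|x 0 j| <= `|x|.
Proof.
rewrite /Num.Def.normr /= mx_normrE.
exact: (le_bigmax _ (fun i : 'I_1 * 'I_d => `|x i.1 i.2|) (0, j)).
Qed.

Lemma norm_le_coord x (B : R) : 0 <= B -> (forall j, `|x 0 j| <= B) -> `|x| <= B.
Proof.
move=> B0 h; rewrite /Num.Def.normr /= mx_normrE; apply/bigmax_leP; split => //.
by move=> [i j] _ /=; rewrite (ord1 i); exact: h.
Qed.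

Lemma norm_lt_coord x (B : R) : 0 < B -> (forall j, `|x 0 j| < B) -> `|x| < B.
Proof.
move=> B0 h; rewrite /Num.Def.normr /= mx_normrE; apply/bigmax_ltP; split => //.
by move=> [i j] _ /=; rewrite (ord1 i); exact: h.
Qed.

Lemma cmod_zfreq xi j : cmod (zfreq xi j) <= 2 * pi * `|xi|.
Proof.
rewrite /cmod /= expr0n add0r sqrtr_sqr normrN normrM.
rewrite gtr0_norm ?mulr_gt0 ?pi_gt0//; apply: ler_wpM2l.
  by rewrite mulr_ge0 ?pi_ge0.
exact: coord_le_norm.
Qed.

(** The last derivative falls on one of the two factors, and both results have the same
    form; this recursion drives all the estimates on localized plane waves. *)
Lemma kernel_mul_step G s j gam xi (O : set E) : open O -> mtower G -> forall x, O x ->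
  cpartials (rcons s j) (fun x => G gam x * fourier_kernel xi x) x =
  cpartials s (fun x => G (madd gam j) x * fourier_kernel xi x) x +
  zfreq xi j * cpartials s (fun x => G gam x * fourier_kernel xi x) x.
Proof.
move=> oO mG x Ox; rewrite cpartials_rcons.
have -> : cpartial j (fun x => G gam x * fourier_kernel xi x) =
  (fun x => G (madd gam j) x * fourier_kernel xi x +
     zfreq xi j * (G gam x * fourier_kernel xi x)).
  apply/funext => y; have [g1 g2] := mG gam y.
  rewrite cpartialM//; last exact: cdifferentiable_kernel.
  by rewrite g2 cpartial_kernel mulrCA.
have sG g : smooth_on O (fun x => G g x * fourier_kernel xi x).
  by apply: smooth_onM => //; [exact: mtower_smooth|exact: smooth_kernel].
rewrite (cpartialsD oO)//; last exact: smooth_onZ.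
by rewrite (cpartialsZ oO).
Qed.

End Products.

(** * Test functions and seminorms *)

Section TestFunctions.
Variables (R : realType) (d : nat).
Local Notation E := 'rV[R]_d.
Local Notation C := R[i].
Implicit Types (x y : E) (j : 'I_d) (s : seq 'I_d) (U K O : set E) (f g phi psi chi : E -> C).

Lemma neq0_prop (P : Prop) (z : C) : (~ P -> z = 0) -> z != 0 -> P.
Proof. by move=> h z0; apply: contrapT => /h zE; rewrite zE eqxx in z0. Qed.

Lemma csupport_sub f (A : set E) : closed A -> (forall x, f x != 0 -> A x) ->
  csupport f `<=` A.
Proof. by move=> /closure_id cA h; rewrite cA; exact: closureS. Qed.

Lemma csupport_closed f : closed (csupport f).
Proof. exact: closed_closure. Qed.

Lemma out_csupport f x : ~ csupport f x -> f x = 0.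
Proof.
by move=> nx; apply/eqP; apply: contrapT => /negP fx; apply: nx; exact: subset_closure.
Qed.

Lemma csupport_out f O : open O -> (forall x, O x -> f x = 0) ->
  forall x, O x -> ~ csupport f x.
Proof.
move=> oO f0 x Ox.
have h : csupport f `<=` ~` O.
  by apply: csupport_sub => [|y fy /f0 y0]; [exact: open_closedC|rewrite y0 eqxx in fy].
by move=> /h.
Qed.

Lemma open_csupportC f : open (~` csupport f).
Proof. by rewrite openC; exact: csupport_closed. Qed.

Lemma compact_csupport_sub f K : compact K -> (forall x, f x != 0 -> K x) ->
  csupport f `<=` K /\ compact (csupport f).
Proof.
move=> cK fK.
have h : csupport f `<=` K.
  by apply: csupport_sub fK; apply: compact_closed cK; exact: norm_hausdorff.
by split=> //; apply: subclosed_compact cK h; exact: csupport_closed.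
Qed.

Lemma csupport_partials s f : csupport (cpartials s f) `<=` csupport f.
Proof.
apply: csupport_sub => [|x]; first exact: csupport_closed.
apply: neq0_prop => nx.
have oC := @open_csupportC f.
have f0 y : (~` csupport f) y -> f y = (fun _ : E => 0 : C) y by exact: out_csupport.
by rewrite (eq_cpartials s oC f0 nx) cpartials_cst; case: s.
Qed.

Lemma test_smooth U phi O : test_function U phi -> smooth_on O phi.
Proof. by case=> h _ _; exact: smooth_on_sub h. Qed.

Lemma test_of U phi K : smooth_on setT phi -> compact K -> K `<=` U ->
  (forall x, phi x != 0 -> K x) -> test_function U phi.
Proof.
move=> sm cK KU h; have [h1 h2] := compact_csupport_sub cK h.
by split=> // x /h1 /KU.
Qed.

(** Smoothness is local: the product is smooth on [U], and it vanishes on the complement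
    of the support of [chi]. *)
Lemma test_mul U chi psi : open U -> test_function U chi -> smooth_on U psi ->
  test_function U (fun x => chi x * psi x).
Proof.
move=> oU [sc cc cU] sp; apply: (test_of (K := csupport chi)) => //; last first.
  by move=> x; apply: neq0_prop => /out_csupport ->; rewrite mul0r.
apply: (@smooth_on_sub _ _ (U `|` ~` csupport chi)).
  by move=> x _; have [/cU|] := pselect (csupport chi x); [left|right].
apply: smooth_on_bigU; first by apply: smooth_onM => //; exact: smooth_on_sub sc.
apply: (@eq_smooth_on _ _ _ (fun=> 0)); [exact: open_csupportC| |exact: smooth_on_cst].
by move=> x /out_csupport ->; rewrite mul0r.
Qed.

Lemma test_partials U s phi : test_function U phi -> test_function U (cpartials s phi).
Proof.
move=> [sp cp pU]; apply: (test_of (K := csupport phi)) => //.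
  exact: smooth_on_partials.
by move=> x hx; apply: (@csupport_partials s); exact: subset_closure.
Qed.

Lemma test_lin U (a : C) phi psi : test_function U phi -> test_function U psi ->
  test_function U (fun x => a * phi x + psi x).
Proof.
move=> [s1 c1 u1] [s2 c2 u2].
apply: (test_of (K := csupport phi `|` csupport psi)).
- apply: smooth_onD => //; first exact: openT.
  by apply: smooth_onZ => //; exact: openT.
- exact: compactU.
- by move=> x [/u1|/u2].
- move=> x; apply: neq0_prop => /not_orP[/out_csupport -> /out_csupport ->].
  by rewrite mulr0 addr0.
Qed.

Lemma test0 U : test_function U (fun=> 0).
Proof.
apply: (test_of (K := set0)) => //; first exact: smooth_on_cst.
- exact: compact0.
- by move=> x; rewrite eqxx.
Qed.

Lemma testZ U (a : C) phi : test_function U phi -> test_function U (fun x => a * phi x).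
Proof.
move=> tp; have := test_lin a tp (test0 U).
by under eq_fun do rewrite addr0.
Qed.

Lemma testB U phi psi : test_function U phi -> test_function U psi ->
  test_function U (fun x => phi x - psi x).
Proof.
move=> tp tq; have := test_lin (-1) tq tp.
by under eq_fun do rewrite mulN1r addrC.
Qed.

Lemma test_sub U O phi : O `<=` U -> test_function O phi -> test_function U phi.
Proof. by move=> OU [s1 c1 h]; split=> // x /h /OU. Qed.

Section Linear.
Variables (U : set E) (u : (E -> C) -> C).
Hypothesis du : distribution_on U u.

Lemma distr0 : u (fun=> 0) = 0.
Proof.
have [lin _] := du; have := lin 1 _ _ (test0 U) (test0 U).
under [X in u X]eq_fun do rewrite mulr0 addr0.
by rewrite mul1r => /eqP; rewrite -subr_eq0 opprD addrA subrr sub0r oppr_eq0 => /eqP.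
Qed.

Lemma distrZ a phi : test_function U phi -> u (fun x => a * phi x) = a * u phi.
Proof.
move=> tp; have [lin _] := du; have := lin a _ _ tp (test0 U).
by under [X in u X]eq_fun do rewrite addr0; rewrite distr0 addr0.
Qed.

Lemma distrD phi psi : test_function U phi -> test_function U psi ->
  u (fun x => phi x + psi x) = u phi + u psi.
Proof.
move=> tp tq; have [lin _] := du; have := lin 1 _ _ tp tq.
by under [X in u X]eq_fun do rewrite mul1r; rewrite mul1r.
Qed.

Lemma distrB phi psi : test_function U phi -> test_function U psi ->
  u (fun x => phi x - psi x) = u phi - u psi.
Proof.
move=> tp tq; have [lin _] := du; have := lin (-1) _ _ tq tp.
by under [X in u X]eq_fun do rewrite mulN1r addrC; rewrite mulN1r addrC.
Qed.

Lemma test_sum I (r : seq I) (P : pred I) (F : I -> E -> C) :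
  (forall i, P i -> test_function U (F i)) ->
  test_function U (fun x => \sum_(i <- r | P i) F i x).
Proof.
move=> tF; elim: r => [|i r IH].
  by under eq_fun do rewrite big_nil; exact: test0.
under eq_fun do rewrite big_cons; case Pi : (P i) => //.
have := test_lin 1 (tF i Pi) IH.
by under eq_fun do rewrite mul1r.
Qed.

Lemma distr_sum I (r : seq I) (P : pred I) (F : I -> E -> C) :
  (forall i, P i -> test_function U (F i)) ->
  u (fun x => \sum_(i <- r | P i) F i x) = \sum_(i <- r | P i) u (F i).
Proof.
move=> tF; elim: r => [|i r IH].
  by rewrite big_nil; under [X in u X]eq_fun do rewrite big_nil; exact: distr0.
rewrite big_cons; under [X in u X]eq_fun do rewrite big_cons.
case Pi : (P i) => //; rewrite distrD ?IH//; first exact: tF.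
exact: test_sum.
Qed.

End Linear.

Lemma cmod_le_ReIm (z : C) : cmod z <= `|complex.Re z| + `|complex.Im z|.
Proof.
case: z => a b /=; rewrite -[leRHS](ger0_norm (addr_ge0 (normr_ge0 _) (normr_ge0 _))).
rewrite -sqrtr_sqr /cmod /= ler_wsqrtr// sqrrD !real_normK ?num_real//.
by rewrite addrAC lerDl mulrn_wge0// mulr_ge0.
Qed.

Lemma compact_cbound K f : compact K -> (forall x, K x -> cdifferentiable f x) ->
  exists2 M : R, 0 <= M & forall x, K x -> cmod (f x) <= M.
Proof.
move=> cK df.
have [K0|/set0P K0] := eqVneq K set0; first by exists 0 => // x; rewrite K0.
have cont (h : E -> R) : (forall x, K x -> differentiable h x) ->
    exists M : R, forall x, K x -> `|h x| <= M.
  move=> dh; pose k x : R := `|h x|.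
  have ck : {within K, continuous k}.
    apply: continuous_in_subspaceT => x /set_mem /dh /differentiable_continuous hx.
    by apply: continuous_comp hx _; exact: norm_continuous.
  have [c _ hc] := compact_EVT_max K0 cK ck.
  by exists (k c) => x Kx; apply: hc; rewrite inE.
have [M1 h1] := cont (fun x => complex.Re (f x)) (fun x Kx => (df x Kx).1).
have [M2 h2] := cont (fun x => complex.Im (f x)) (fun x Kx => (df x Kx).2).
exists (`|M1| + `|M2|); first by rewrite addr_ge0.
move=> x Kx; apply: le_trans (cmod_le_ReIm _) _; apply: lerD.
- exact: le_trans (h1 x Kx) (ler_norm _).
- exact: le_trans (h2 x Kx) (ler_norm _).
Qed.

Lemma ck_bound K f k : compact K -> (forall s x, K x -> cdifferentiable (cpartials s f) x) ->
  exists2 M : R, 0 <= M &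
    forall s x, (size s <= k)%N -> K x -> cmod (cpartials s f x) <= M.
Proof.
move=> cK; elim: k f => [|k IH] f df.
  have [M M0 h] := compact_cbound cK (df [::]).
  by exists M => // s x; rewrite leqn0 size_eq0 => /eqP -> /h.
have [M M0 h] := compact_cbound cK (df [::]).
have /fin_all_exists[N hN] j : exists N : R, 0 <= N /\
    forall s x, (size s <= k)%N -> K x -> cmod (cpartials s (cpartial j f) x) <= N.
  have [|N N0 hN] := IH (cpartial j f); last by exists N.
  by move=> s x Kx; rewrite -cpartials_rcons; exact: df.
have S0 j : 0 <= \sum_(i | i != j) N i by apply: sumr_ge0 => i _; have [] := hN i.
exists (M + \sum_j N j).
  by rewrite addr_ge0// sumr_ge0// => j _; have [] := hN j.
move=> s x; case/lastP: s => [_ /h Mx|s j].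
  by apply: le_trans Mx _; rewrite lerDl sumr_ge0// => j _; have [] := hN j.
rewrite size_rcons ltnS cpartials_rcons => ks Kx.
apply: le_trans ((hN j).2 _ _ ks Kx) _.
by rewrite (bigD1 j)//= addrCA lerDl addr_ge0.
Qed.

Lemma ck_norm_ge0 K k f : 0 <= ck_norm K k f.
Proof.
rewrite /ck_norm; set A := (X in sup X).
have [hA|nA] := pselect (has_sup A); last by rewrite sup_out.
have [[r Ar] _] := hA; apply: (le_trans _ (ub_le_sup hA.2 Ar)).
by case: Ar => s [x [_ _ ->]]; exact: cmod_ge0.
Qed.

Lemma ck_norm_le K k f (M : R) : 0 <= M ->
  (forall s x, (size s <= k)%N -> K x -> cmod (cpartials s f x) <= M) ->
  ck_norm K k f <= M.
Proof.
move=> M0 h; rewrite /ck_norm; set A := (X in sup X).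
have [/set0P A0|/negP] := boolP (A != set0); last first.
  by move=> /negP; rewrite negbK => /eqP ->; rewrite sup0.
by apply: ge_sup => // r [s [x [ks Kx ->]]]; exact: h.
Qed.

(** Compactness enters because a supremum of an unbounded set is 0 by convention. *)
Lemma le_ck_norm K k f s x : compact K ->
  (forall s x, K x -> cdifferentiable (cpartials s f) x) ->
  (size s <= k)%N -> K x -> cmod (cpartials s f x) <= ck_norm K k f.
Proof.
move=> cK df ks Kx; have [M M0 hM] := ck_bound k cK df.
apply: ub_le_sup; last by exists s, x.
by exists M => r [t [y [kt Ky ->]]]; exact: hM.
Qed.

(** Leibniz's rule produces at most [2 ^ k] terms. *)
Lemma ck_normM U K k f g : open U -> compact K -> K `<=` U -> smooth_on U f ->
  smooth_on U g ->
  ck_norm K k (fun x => f x * g x) <= 2 ^+ k * (ck_norm K k f * ck_norm K k g).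
Proof.
move=> oU cK KU sf sg; apply: ck_norm_le.
  by rewrite mulr_ge0 ?exprn_ge0 ?mulr_ge0 ?ck_norm_ge0.
move=> s x ks Kx; rewrite (cpartialsM oU s sf sg (KU _ Kx)).
apply: le_trans (cmod_sum _ _ _) _.
have c0 : 0 <= ck_norm K k f * ck_norm K k g by rewrite mulr_ge0 ?ck_norm_ge0.
apply: (@le_trans _ _ (\sum_(p <- splits s) ck_norm K k f * ck_norm K k g)).
  rewrite big_seq [leRHS]big_seq; apply: ler_sum => p /splits_size hp.
  rewrite cmodM; apply: ler_pM; rewrite ?cmod_ge0//; apply: le_ck_norm => //.
  - by move=> t y /KU; exact: sf.
  - by apply: leq_trans ks; rewrite -hp leq_addr.
  - by move=> t y /KU; exact: sg.
  - by apply: leq_trans ks; rewrite -hp leq_addl.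
rewrite big_const_seq iter_addr_0 count_predT size_splits -[leLHS]mulr_natl natrX.
by rewrite ler_wpM2r// ler_weXn2l// ler1n.
Qed.

Lemma ck_norm_partials K k s f : compact K -> (forall s x, K x -> cdifferentiable (cpartials s f) x) ->
  ck_norm K k (cpartials s f) <= ck_norm K (k + size s) f.
Proof.
move=> cK df; apply: ck_norm_le; first exact: ck_norm_ge0.
move=> t x kt Kx; rewrite -cpartials_cat; apply: le_ck_norm => //.
by rewrite size_cat leq_add2r.
Qed.

Lemma distr_bound U u K : distribution_on U u -> compact K -> K `<=` U ->
  exists (k : nat) (M : R), 0 <= M /\ forall phi, test_function U phi ->
    csupport phi `<=` K -> cmod (u phi) <= M * ck_norm K k phi.
Proof.
move=> [_ h] cK KU; have [k [M hM]] := h K cK KU; exists k, `|M|; split=> // phi tp pK.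
apply: le_trans (hM phi tp pK) _.
by rewrite ler_wpM2r ?ck_norm_ge0// ler_norm.
Qed.

End TestFunctions.

(** * Partitions of unity, supports and pairings *)

Section Localization.
Variables (R : realType) (d : nat).
Local Notation E := 'rV[R]_d.
Local Notation C := R[i].
Implicit Types (x y : E) (j : 'I_d) (s : seq 'I_d) (U K O V : set E).
Implicit Types (f g phi psi chi : E -> C) (u v : (E -> C) -> C) (r e : R).

Lemma norm_ge_coord x r : 0 < r -> r <= `|x| -> exists j, r <= `|x 0 j|.
Proof.
move=> r0 rx; apply: contrapT => /forallNP h.
suff : `|x| < r by rewrite ltNge rx.
by apply: norm_lt_coord => // j; rewrite ltNge; apply/negP; exact: h.
Qed.

Lemma tensor_plateau (F : nat -> R -> R) r a : 0 < r ->
  (forall n (t : R), r <= `|t| -> F n t = 0) -> (forall t : R, `|t| <= r / 2 -> F 0%N t = 1) ->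
  (forall gam (x : E), r <= `|x - a| -> tensor F a gam x = 0) /\
  (forall x : E, `|x - a| <= r / 2 -> tensor F a (fun=> 0%N) x = 1).
Proof.
move=> r0 F0 F1; have co (x : E) j : x 0 j - a 0 j = (x - a) 0 j by rewrite !mxE.
split=> [gam x /(norm_ge_coord r0)[j hj]|x hx].
  by rewrite /tensor (bigD1 j)//= co F0// mul0r.
rewrite /tensor big1// => j _; rewrite co F1//.
exact: le_trans (coord_le_norm _ _) hx.
Qed.

Lemma box_bump a r : 0 < r -> exists b : E -> C, [/\ smooth_on setT b,
  forall x, `|x - a| <= r / 2 -> b x = 1 & forall x, r <= `|x - a| -> b x = 0].
Proof.
move=> r0; have [F [A [c [tF _ _ _ [F0 F1]]]]] := plateau_exists r0.
have [b0 b1] := tensor_plateau a r0 F0 F1.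
exists (tensor F a (fun=> 0%N)); split=> [|//|x]; last exact: b0.
by apply: mtower_smooth; exact: mtower_tensor.
Qed.

Definition cball a r : set E := [set x | `|x - a| <= r].

Lemma continuous_dist a : continuous (fun x : E => `|x - a|).
Proof.
move=> x; have h : {for x, continuous (fun x : E => x - a)}.
  apply: (@continuousB _ _ _ idfun (cst a)); first by apply: cvg_id.
  exact: cst_continuous.
exact: (continuous_comp h (@norm_continuous _ _ _)).
Qed.

Lemma compact_cball a r : compact (cball a r).
Proof.
apply: bounded_closed_compact.
  exists (`|a| + r); split; first exact: num_real.
  move=> M hM x /= hx; apply: ltW; apply: le_lt_trans hM.
  by rewrite -[x](subrK a) addrC (le_trans (ler_normD _ _))// lerD2l.
have c := @continuous_dist a.
have -> : cball a r = (fun x : E => `|x - a|) @^-1` [set t | t <= r] by [].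
by apply: closed_comp => [x _|]; [exact: c|exact: closed_le].
Qed.

Lemma open_oball a r : open [set x : E | `|x - a| < r].
Proof.
have c := @continuous_dist a.
have -> : [set x : E | `|x - a| < r] = (fun x : E => `|x - a|) @^-1` [set t | t < r] by [].
by apply: open_comp => [x _|]; [exact: c|exact: open_lt].
Qed.

Lemma open_cball O x : open O -> O x -> exists2 r, 0 < r & cball x r `<=` O.
Proof.
move=> oO Ox; have /nbhs_ballP[e /= e0 he] := open_nbhs_nbhs (conj oO Ox).
exists (e / 2); first by rewrite divr_gt0.
move=> y /= hy; apply: he; rewrite -ball_normE /= distrC; apply: le_lt_trans hy _.
by rewrite ltr_pdivrMr// ltr_pMr// ltr1n.
Qed.

(** A finite subcover with bumps attached; [P x r] is the property for the sake of which
    the radius [r] is chosen at [x]. *)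
Lemma bump_cover K (P : E -> R -> Prop) : compact K ->
  (forall x, K x -> exists2 r, 0 < r & P x r) ->
  exists (l : seq E) (rho : E -> R) (b : E -> E -> C),
    [/\ forall x, x \in l -> P x (rho x),
        forall y, K y -> exists2 x, x \in l & `|y - x| < rho x / 2,
        forall x, smooth_on setT (b x),
        forall x y, `|y - x| <= rho x / 2 -> b x y = 1 &
        forall x y, rho x <= `|y - x| -> b x y = 0].
Proof.
move=> cK hP.
have /choice[rho hrho] x : exists r, 0 < r /\ (K x -> P x r).
  have [/hP[r r0 Pr]|nK] := pselect (K x); first by exists r.
  by exists 1.
have /choice[b hb] x : exists b : E -> C, [/\ smooth_on setT b,
    forall y, `|y - x| <= rho x / 2 -> b y = 1 & forall y, rho x <= `|y - x| -> b y = 0].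
  by have [r0 _] := hrho x; exact: box_bump.
have := cK; rewrite compact_cover => /(_ _ K (fun x => [set y | `|y - x| < rho x / 2])).
case=> [x _|y Ky|D hD cov]; first exact: open_oball.
  exists y => //=; rewrite subrr normr0 divr_gt0//; by have [] := hrho y.
exists (finmap.enum_fset D), rho, b; split.
- by move=> x xD; have [_] := hrho x; apply; have := hD x xD; rewrite inE.
- by move=> y /cov[x xD yx]; exists x.
- by move=> x; have [] := hb x.
- by move=> x; have [] := hb x.
- by move=> x; have [] := hb x.
Qed.

Let cprod (b : E -> E -> C) (l : seq E) y := \prod_(x <- l) (1 - b x y).

Let smooth_cprod b l : (forall x, smooth_on setT (b x)) -> smooth_on setT (cprod b l).
Proof.
move=> sb; rewrite /cprod; elim: l => [|x l IH].
  by under eq_fun do rewrite big_nil; exact: smooth_on_cst.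
under eq_fun do rewrite big_cons.
apply: smooth_onM => //; first exact: openT.
have := smooth_onD openT (smooth_on_cst 1) (smooth_onZ openT (-1) (sb x)).
by under eq_fun do rewrite mulN1r.
Qed.

(** A distribution vanishes on the test functions supported away from its support: a
    partition of unity splits such a function into pieces that it kills. *)
Lemma distr_away U v phi : open U -> distribution_on U v -> test_function U phi ->
  (forall x, csupport phi x -> ~ distr_support U v x) -> v phi = 0.
Proof.
move=> oU dv tp away; have [_ cphi phiU] := tp.
have loc x : csupport phi x -> exists2 r, 0 < r &
    forall psi, test_function U psi -> (forall y, r <= `|y - x| -> psi y = 0) -> v psi = 0.
  move=> sx; have Ux := phiU _ sx.
  have [W [oW WU Wx eqW]] : exists W, [/\ open W, W `<=` U, W x & eq_distr_on W v (fun=> 0)].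
    by apply: contrapT => nW; apply: (away x sx); split.
  have [r r0 rW] := open_cball oW Wx; exists r => // psi [sp _ _] h.
  apply: eqW; apply: (test_of sp (@compact_cball x r) rW) => y.
  by apply: neq0_prop => /negP; rewrite -ltNge => /ltW; exact: h.
have [l [rho [b [hl cov sb b1 b0]]]] := bump_cover cphi loc.
have tc k : test_function U (fun y => phi y * cprod b k y).
  by apply: test_mul => //; exact: smooth_on_sub (@subsetT _ U) (smooth_cprod k sb).
have tcb k x : test_function U (fun y => phi y * cprod b k y * b x y).
  by apply: test_mul => //; exact: smooth_on_sub (@subsetT _ U) (sb x).
have step k : {subset k <= l} -> v (fun y => phi y * cprod b k y) = v phi.
  elim: k => [|x k IH] kl.
    by under [X in v X]eq_fun do rewrite /cprod big_nil mulr1.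
  rewrite -IH; last by move=> z zk; apply: kl; rewrite inE zk orbT.
  have -> : (fun y => phi y * cprod b (x :: k) y) =
      (fun y => phi y * cprod b k y - phi y * cprod b k y * b x y).
    by apply/funext => y; rewrite /cprod big_cons; ring.
  rewrite (distrB dv (tc k) (tcb k x)) (hl x _ _ (tcb k x)) ?subr0//.
    by apply: kl; rewrite inE eqxx.
  by move=> y /b0 ->; rewrite mulr0.
rewrite -(step l)//; have -> : (fun y => phi y * cprod b l y) = (fun=> 0).
  apply/funext => y; have [sy|/out_csupport ->] := pselect (csupport phi y); last first.
    by rewrite mul0r.
  have [x xl yx] := cov y sy; rewrite /cprod (big_rem x)//= b1 ?ltW//.
  by rewrite subrr mul0r mulr0.
exact: distr0 dv.
Qed.

Lemma distr_eq_near U v phi psi V : open U -> distribution_on U v -> test_function U phi ->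
  test_function U psi -> open V -> distr_support U v `<=` V ->
  (forall x, V x -> phi x = psi x) -> v phi = v psi.
Proof.
move=> oU dv tp tq oV sV h; apply/eqP; rewrite -subr_eq0 -(distrB dv tp tq); apply/eqP.
apply: (distr_away oU dv) => [|x hx sx]; first exact: testB.
apply: (@csupport_out _ _ (fun x => phi x - psi x) V oV _ x (sV x sx) hx).
by move=> y /h ->; rewrite subrr.
Qed.

(** If the bumps [b_i] are 1 on the sets of a cover of [K], then [1 - prod (1 - b_i)] is
    1 near [K]. *)
Lemma cutoff_exists U K : open U -> compact K -> K `<=` U ->
  exists2 chi, test_function U chi & exists V, [/\ open V, K `<=` V &
    forall x, V x -> chi x = 1].
Proof.
move=> oU cK KU.
have [|l [rho [b [hl cov sb b1 b0]]]] := @bump_cover K (fun x r => cball x r `<=` U) cK.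
  by move=> x /KU; exact: open_cball.
pose A := \big[setU/set0]_(x <- l) cball x (rho x).
have inA y : A y <-> exists2 x, x \in l & `|y - x| <= rho x.
  rewrite /A; elim: (l) => [|x k IH]; first by rewrite big_nil; split => // -[].
  rewrite big_cons; split.
    case=> [h|/IH[z zk h]]; first by exists x; rewrite // inE eqxx.
    by exists z; rewrite // inE zk orbT.
  case=> z; rewrite inE => /orP[/eqP ->|zk] h; first by left.
  by right; apply/IH; exists z.
exists (fun y => 1 - cprod b l y).
  apply: (test_of (K := A)).
  - have := smooth_onD openT (smooth_on_cst 1) (smooth_onZ openT (-1) (smooth_cprod l sb)).
    by under eq_fun do rewrite mulN1r.
  - by apply: bigsetU_compact => x _; exact: compact_cball.
  - by move=> y /inA[x xl h]; exact: (hl x xl).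
  - move=> y; apply: neq0_prop => nA; rewrite /cprod big_seq big1 ?subrr// => x xl.
    rewrite b0 ?subr0//; rewrite leNgt; apply/negP => /ltW h; apply: nA; apply/inA.
    by exists x.
exists [set y | exists2 x, x \in l & `|y - x| < rho x / 2]; split => //.
- rewrite (_ : [set y | _] = \bigcup_(x in [set x | x \in l]) [set y | `|y - x| < rho x / 2]).
    by apply: bigcup_open => x _; exact: open_oball.
  by apply/seteqP; split => y [x]; exists x.
- move=> y [x xl h]; rewrite /cprod (big_rem x)//= b1 ?ltW//.
  by rewrite subrr mul0r subr0.
Qed.

Lemma distr_support_sub U v : distr_support U v `<=` U.
Proof. by move=> x []. Qed.

(** Two cutoffs agree near the support, so the one picked by the definition can be
    exchanged for any other. *)
Lemma pairingE U v chi psi V : open U -> compactly_supported_distribution U v ->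
  test_function U chi -> open V -> distr_support U v `<=` V ->
  (forall x, V x -> chi x = 1) -> smooth_on U psi ->
  distr_pairing U v psi = v (fun x => chi x * psi x).
Proof.
move=> oU [dv cv] tchi oV sV chi1 spsi; rewrite /distr_pairing.
set th := xget _ _.
have [tth [W [oW sW th1]]] : cutoff U v th.
  have [chi0 tc hc] := cutoff_exists oU cv (@distr_support_sub U v).
  rewrite /th; case: xgetP => [z _ //|]; by move=> /(_ chi0) []; split.
apply: (distr_eq_near (V := V `&` W) oU dv).
- exact: test_mul.
- exact: test_mul.
- exact: openI.
- by move=> x sx; split; [exact: sV|exact: sW].
- by move=> x [/chi1 -> /th1 ->].
Qed.

Lemma compact_supp_cutoff U v : open U -> compactly_supported_distribution U v ->
  exists2 chi, test_function U chi & exists V, [/\ open V, distr_support U v `<=` V &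
    forall x, V x -> chi x = 1].
Proof. by move=> oU [dv cv]; exact: cutoff_exists (@distr_support_sub U v). Qed.

Lemma pairing_test U v phi : open U -> compactly_supported_distribution U v ->
  test_function U phi -> distr_pairing U v phi = v phi.
Proof.
move=> oU cv tp; have [chi tc [V [oV sV c1]]] := compact_supp_cutoff oU cv.
rewrite (pairingE oU cv tc oV sV c1); last exact: test_smooth tp.
apply: (distr_eq_near (V := V) oU cv.1) => //.
  apply: test_mul => //; exact: test_smooth tp.
by move=> x /c1 ->; rewrite mul1r.
Qed.

Lemma pairingZ U v (a : C) psi : open U -> compactly_supported_distribution U v ->
  smooth_on U psi -> distr_pairing U v (fun x => a * psi x) = a * distr_pairing U v psi.
Proof.
move=> oU cv sp; have [chi tc [V [oV sV c1]]] := compact_supp_cutoff oU cv.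
rewrite !(pairingE oU cv tc oV sV c1)//; last exact: smooth_onZ.
rewrite -(distrZ cv.1); last exact: test_mul.
by congr v; apply/funext => x; rewrite mulrCA.
Qed.

Lemma pairing_sum U v I (r : seq I) (F : I -> E -> C) :
  open U -> compactly_supported_distribution U v -> (forall i, smooth_on U (F i)) ->
  distr_pairing U v (fun x => \sum_(i <- r) F i x) = \sum_(i <- r) distr_pairing U v (F i).
Proof.
move=> oU cv sF; have [chi tc [V [oV sV c1]]] := compact_supp_cutoff oU cv.
rewrite (pairingE oU cv tc oV sV c1); last exact: smooth_on_sum.
rewrite (eq_bigr (fun i => v (fun x => chi x * F i x))); last first.
  by move=> i _; exact: (pairingE oU cv tc oV sV c1).
rewrite -(distr_sum cv.1); last by move=> i _; exact: test_mul.
by congr v; apply/funext => x; rewrite mulr_sumr.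
Qed.

End Localization.

(** * Operations on distributions and bounded sequences *)

Section Operators.
Variables (R : realType) (d : nat) (U : set 'rV[R]_d).
Hypothesis oU : open U.
Local Notation E := 'rV[R]_d.
Local Notation C := R[i].
Implicit Types (x y xi : E) (j : 'I_d) (s : seq 'I_d) (K O V : set E).
Implicit Types (f g phi psi chi : E -> C) (u v : (E -> C) -> C).

(** Supports are relatively closed, hence compact once trapped in a compact set. *)
Lemma compact_distr_support v K : compact K -> K `<=` U -> distr_support U v `<=` K ->
  compact (distr_support U v).
Proof.
move=> cK KU sK.
pose W : set E := \bigcup_(O in [set O | [/\ open O, O `<=` U & eq_distr_on O v (fun=> 0)]]) O.
have oW : open W by apply: bigcup_open => W1 [].
have -> : distr_support U v = K `&` ~` W.
  apply/seteqP; split => x.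
    move=> sx; split; first exact: sK.
    by move=> [W1 [oO OU eO] Ox]; have [_] := sx; apply; exists W1.
  move=> [Kx nW]; split; first exact: KU.
  by move=> [W1 [oO OU Ox eO]]; apply: nW; exists W1.
by apply: compact_closedI => //; exact: open_closedC.
Qed.

Definition mseq (al : 'I_d -> nat) : seq 'I_d :=
  flatten [seq nseq (al j) j | j <- enum 'I_d].

Lemma size_mseq al : size (mseq al) = mi_order al.
Proof.
rewrite /mseq size_flatten /shape -map_comp /mi_order sumnE big_map big_enum /=.
by apply: eq_bigr => j _; rewrite /= size_nseq.
Qed.

Lemma prod_mseq (z : 'I_d -> C) al : \prod_(j <- mseq al) z j = \prod_j z j ^+ al j.
Proof.
rewrite /mseq big_flatten /= big_map big_enum /=; apply: eq_bigr => j _.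
by rewrite big_nseq iter_mulr_1.
Qed.

Section Pdo.
Variables (m : nat) (c : C) (a : multi_index d m -> C).
Implicit Types al : multi_index d m.

(** The coefficients of the transpose of [P(D)]. *)
Definition pcoef al : C := a al * ((-1) ^+ mi_order al * c ^+ mi_order al).

Lemma pdo_distrE u O phi : distribution_on O u -> test_function O phi ->
  pdo_distr c a u phi =
  \sum_(al : multi_index d m | (mi_order al <= m)%N) pcoef al * u (cpartials (mseq al) phi).
Proof.
move=> du tp; apply: (@eq_bigr _ _ _ (multi_index d m)) => al _; rewrite /mi_partial.
by rewrite (distrZ du); [rewrite /pcoef !mulrA|exact: test_partials].
Qed.

Lemma pdo_distribution u : distribution_on U u -> distribution_on U (pdo_distr c a u).
Proof.
move=> du; split.
  move=> b phi psi tp tq; rewrite (pdo_distrE du tp) (pdo_distrE du tq).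
  rewrite (pdo_distrE du (test_lin b tp tq)) mulr_sumr -big_split; apply: (@eq_bigr _ _ _ (multi_index d m)) => al _ /=.
  have [sp sq] : smooth_on setT phi /\ smooth_on setT psi.
    by split; [exact: test_smooth tp|exact: test_smooth tq].
  have -> : cpartials (mseq al) (fun x => b * phi x + psi x) =
      (fun x => b * cpartials (mseq al) phi x + cpartials (mseq al) psi x).
    apply/funext => x; rewrite (cpartialsD openT _ (smooth_onZ openT b sp) sq)//.
    by rewrite (cpartialsZ openT _ b sp).
  have [lin _] := du; rewrite lin; [|exact: test_partials..].
  by rewrite mulrDr mulrCA.
move=> K cK KU; have [k [M [M0 hM]]] := distr_bound du cK KU.
exists (k + m)%N, (\sum_(al : multi_index d m) cmod (pcoef al) * M) => phi tp pK.
rewrite (pdo_distrE du tp) (le_trans (cmod_sum _ _ _))// mulr_suml.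
rewrite [leRHS](bigID (fun al : multi_index d m => (mi_order al <= m)%N)) /=.
rewrite -[leLHS]addr0; apply: lerD; last first.
  by apply: (@sumr_ge0 _ (multi_index d m)) => al _; rewrite !mulr_ge0 ?cmod_ge0 ?ck_norm_ge0.
apply: (@ler_sum _ (multi_index d m)) => al alm; rewrite cmodM -mulrA ler_wpM2l ?cmod_ge0//.
have tpa := test_partials (mseq al) tp.
apply: le_trans (hM _ tpa (subset_trans (@csupport_partials _ _ _ _) pK)) _.
have sp : smooth_on setT phi := test_smooth tp.
rewrite ler_wpM2l//; apply: le_trans (ck_norm_partials _ _ cK _) _.
  by move=> s x _; exact: sp.
apply: ck_norm_le; first exact: ck_norm_ge0.
move=> s x ks Kx; apply: le_ck_norm => //; first by move=> t y _; exact: sp.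
by apply: leq_trans ks _; rewrite leq_add2l size_mseq.
Qed.

Lemma pdo_eq_on O u v : eq_distr_on O u v -> eq_distr_on O (pdo_distr c a u) (pdo_distr c a v).
Proof.
move=> uv phi tp; apply: (@eq_bigr _ _ _ (multi_index d m)) => al _; congr (_ * (_ * _)); apply: uv.
by apply: testZ; exact: test_partials.
Qed.

Lemma pdo_support u : distr_support U (pdo_distr c a u) `<=` distr_support U u.
Proof.
move=> x [Ux h]; split=> // -[W1 [oO OU Ox eO]]; apply: h; exists W1; split=> // phi tp.
rewrite (pdo_eq_on eO tp); apply: (@big1 _ _ _ (multi_index d m)) => al _.
by rewrite mulr0 mulr0.
Qed.

Lemma pdo_compact u : compactly_supported_distribution U u ->
  compactly_supported_distribution U (pdo_distr c a u).
Proof.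
move=> [du cu]; split; first exact: pdo_distribution.
by apply: compact_distr_support cu (@distr_support_sub _ _ _ _) _; exact: pdo_support.
Qed.

(** Near the support of [v] the cutoff is 1, hence commutes with derivatives. *)
Lemma pairing_pdo v psi : compactly_supported_distribution U v -> smooth_on U psi ->
  distr_pairing U (pdo_distr c a v) psi =
  \sum_(al : multi_index d m | (mi_order al <= m)%N)
     pcoef al * distr_pairing U v (cpartials (mseq al) psi).
Proof.
move=> cv sp; have [chi tc [V [oV sV c1]]] := compact_supp_cutoff oU cv.
rewrite (pairingE oU (pdo_compact cv) tc oV (subset_trans (@pdo_support v) sV) c1 sp).
rewrite (pdo_distrE cv.1); last exact: test_mul.
apply: (@eq_bigr _ _ _ (multi_index d m)) => al _; congr (_ * _).
have spa : smooth_on U (cpartials (mseq al) psi) by exact: smooth_on_partials.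
rewrite (pairingE oU cv tc oV sV c1 spa).
apply: (distr_eq_near (V := V) oU cv.1) => //.
- by apply: test_partials; exact: test_mul.
- exact: test_mul.
- have e y : V y -> chi y * psi y = psi y by move=> /c1 ->; rewrite mul1r.
  by move=> x Vx; rewrite (eq_cpartials _ oV e Vx) c1// mul1r.
Qed.

Lemma bounded_smooth_partials s (B : set (E -> C)) : bounded_smooth U B ->
  bounded_smooth U [set cpartials s psi | psi in B].
Proof.
move=> [sB bB]; split=> [_ [psi Bp <-]|K k cK KU].
  by apply: smooth_on_partials; exact: sB.
have [M hM] := bB K (k + size s)%N cK KU; exists M => _ [psi Bp <-].
apply: le_trans (ck_norm_partials _ _ cK _) (hM psi Bp).
by move=> t y /KU; exact: sB.
Qed.

Lemma pdo_bounded w : bounded_compact_distributions U w ->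
  bounded_compact_distributions U (fun N => pdo_distr c a (w N)).
Proof.
move=> [cw bw]; split=> [N|B bB]; first exact: pdo_compact.
have /fin_all_exists[M hM] (al : multi_index d m) : exists M : R, forall N psi, B psi ->
    cmod (distr_pairing U (w N) (cpartials (mseq al) psi)) <= M.
  have [M hM] := bw _ (bounded_smooth_partials (mseq al) bB).
  by exists M => N psi Bp; apply: hM; exists psi.
exists (\sum_(al : multi_index d m) cmod (pcoef al) * `|M al|) => N psi Bp.
rewrite pairing_pdo//; last by have [sB _] := bB; exact: sB.
rewrite (le_trans (cmod_sum _ _ _))//.
rewrite [leRHS](bigID (fun al : multi_index d m => (mi_order al <= m)%N)) /=.
rewrite -[leLHS]addr0; apply: lerD; last first.
  by apply: (@sumr_ge0 _ (multi_index d m)) => al _; rewrite mulr_ge0 ?cmod_ge0.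
apply: (@ler_sum _ (multi_index d m)) => al _; rewrite cmodM ler_wpM2l ?cmod_ge0//.
exact: le_trans (hM al N psi Bp) (ler_norm _).
Qed.

(** The full symbol: the transpose of [P(D)] multiplies a plane wave by it. *)
Definition psym xi : C := \sum_(al : multi_index d m | (mi_order al <= m)%N)
  pcoef al * \prod_(j <- mseq al) zfreq xi j.

Lemma fourier_pdo v xi : compactly_supported_distribution U v ->
  fourier_distr U (pdo_distr c a v) xi = psym xi * fourier_distr U v xi.
Proof.
move=> cv; rewrite /fourier_distr pairing_pdo//; last exact: smooth_kernel.
rewrite /psym mulr_suml; apply: (@eq_bigr _ _ _ (multi_index d m)) => al _; rewrite -mulrA; congr (_ * _).
rewrite cpartials_kernel pairingZ//; exact: smooth_kernel.
Qed.

Lemma cmod_prod_zfreq s xi : cmod (\prod_(j <- s) zfreq xi j) <= (8 * `|xi|) ^+ size s.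
Proof.
elim: s => [|j s IH]; first by rewrite big_nil cmod1.
rewrite big_cons cmodM exprS; apply: ler_pM; rewrite ?cmod_ge0//.
apply: le_trans (cmod_zfreq _ _) _; rewrite ler_wpM2r//.
by have := pihalf_lt2 R; lra.
Qed.

Lemma psym_le : exists2 A : R, 0 <= A & forall xi, cmod (psym xi) <= A * (1 + `|xi|) ^+ m.
Proof.
exists (\sum_(al : multi_index d m) cmod (pcoef al) * 8 ^+ m).
  by apply: (@sumr_ge0 _ (multi_index d m)) => al _; rewrite mulr_ge0 ?cmod_ge0 ?exprn_ge0.
move=> xi; rewrite (le_trans (cmod_sum _ _ _))// mulr_suml.
rewrite [leRHS](bigID (fun al : multi_index d m => (mi_order al <= m)%N)) /=.
rewrite -[leLHS]addr0; apply: lerD; last first.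
  by apply: (@sumr_ge0 _ (multi_index d m)) => al _; rewrite !mulr_ge0 ?cmod_ge0 ?exprn_ge0 ?addr_ge0.
apply: (@ler_sum _ (multi_index d m)) => al alm; rewrite cmodM -mulrA ler_wpM2l ?cmod_ge0//.
apply: le_trans (cmod_prod_zfreq _ _) _; rewrite size_mseq -exprMn.
apply: (@le_trans _ _ ((8 * (1 + `|xi|)) ^+ mi_order al)).
  by rewrite lerXn2r ?nnegrE ?mulr_ge0 ?addr_ge0// ler_wpM2l// lerDr.
by apply: ler_weXn2l alm; have := normr_ge0 xi; lra.
Qed.

End Pdo.

(** Fourier transforms of a bounded sequence grow polynomially, uniformly: otherwise
    some points [xi_k] would have [|w_k^(xi_k)| > k * (1 + |xi_k|) ^ k], whereas the
    plane waves of frequency [xi_k] divided by [(1 + |xi_k|) ^ k] form a bounded set. *)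
Lemma bounded_fourier_growth w : bounded_compact_distributions U w ->
  exists (mu : nat) (A : R), 0 <= A /\ forall N xi,
    cmod (fourier_distr U (w N) xi) <= A * (1 + `|xi|) ^+ mu.
Proof.
move=> [cw bw]; apply: contrapT => nb.
have /choice[p hp] (k : nat) : exists p : nat * E,
    k%:R * (1 + `|p.2|) ^+ k < cmod (fourier_distr U (w p.1) p.2).
  apply: contrapT => nk; apply: nb; exists k, k%:R; split=> // N xi.
  by rewrite leNgt; apply/negP => h; apply: nk; exists (N, xi).
have q1 k : 1 <= 1 + `|(p k).2| by rewrite lerDl.
have q0 k : 0 < 1 + `|(p k).2| by exact: lt_le_trans (q1 k).
pose psi k x : C := (((1 + `|(p k).2|) ^- k)%:C)%C * fourier_kernel (p k).2 x.
have bB : bounded_smooth U (range psi).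
  split=> [_ [k _ <-]|K r cK KU].
    by apply: smooth_onZ => //; exact: smooth_kernel.
  exists (8 ^+ r * (1 + \sum_(k < r) (1 + `|(p k).2|) ^+ r)) => _ [k _ <-].
  have S0 (P : pred 'I_r) : 0 <= \sum_(k < r | P k) (1 + `|(p k).2|) ^+ r.
    by apply: sumr_ge0 => i _; rewrite exprn_ge0// ltW.
  apply: ck_norm_le.
    by rewrite mulr_ge0 ?exprn_ge0// addr_ge0.
  move=> s x sr Kx; rewrite (cpartialsZ oU s _ (@smooth_kernel _ _ _ _) (KU _ Kx)).
  rewrite cpartials_kernel !cmodM cmod_kernel mulr1 cmod_real ger0_norm; last first.
    by rewrite invr_ge0 exprn_ge0// ltW.
  have h1 : cmod (\prod_(j <- s) zfreq (p k).2 j) <= 8 ^+ r * (1 + `|(p k).2|) ^+ r.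
    apply: le_trans (cmod_prod_zfreq _ _) _; rewrite -exprMn.
    apply: (@le_trans _ _ ((8 * (1 + `|(p k).2|)) ^+ size s)).
      by rewrite lerXn2r ?nnegrE ?mulr_ge0 ?addr_ge0// ler_wpM2l// lerDr.
    by apply: ler_weXn2l sr; have := q1 k; lra.
  rewrite ler_pdivrMl ?exprn_gt0//; apply: le_trans h1 _.
  rewrite mulrCA ler_wpM2l ?exprn_ge0//.
  have [rk|kr] := leqP r k.
    apply: (@le_trans _ _ ((1 + `|(p k).2|) ^+ k)); first by rewrite ler_weXn2l.
    by rewrite ler_peMr ?exprn_ge0 ?(ltW (q0 k))// lerDl.
  rewrite -[leLHS]mul1r; apply: ler_pM; first by [].
  - by rewrite exprn_ge0// ltW.
  - exact: exprn_ege1.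
  - rewrite (bigD1 (Ordinal kr))//= addrCA lerDl addr_ge0//.
have [M hM] := bw _ bB.
pose k := Num.bound `|M|.
have := hM (p k).1 (psi k) (imageP _ I).
rewrite pairingZ//; last exact: smooth_kernel.
rewrite cmodM cmod_real ger0_norm ?invr_ge0 ?exprn_ge0 ?(ltW (q0 k))//.
rewrite ler_pdivrMl ?exprn_gt0// => h.
have := lt_le_trans (hp k) h; rewrite mulrC ltr_pM2l ?exprn_gt0//.
apply/negP; rewrite -leNgt; apply: le_trans (ler_norm M) _.
apply: ltW; exact: archi_boundP.
Qed.

(** A bounded sequence is supported in a common ball, by the same argument applied to
    test functions living further and further out. *)
Lemma bounded_common_support w : bounded_compact_distributions U w ->
  exists2 r : R, 0 < r & forall N phi, test_function U phi ->
    (forall x, `|x| < r -> phi x = 0) -> w N phi = 0.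
Proof.
move=> [cw bw]; apply: contrapT => nb.
have /choice[p hp] (k : nat) : exists p : nat * (E -> C), [/\ test_function U p.2,
    forall x, `|x| < k.+1%:R -> p.2 x = 0 & w p.1 p.2 != 0].
  apply: contrapT => nk; apply: nb; exists k.+1%:R => // N phi tp h.
  by apply: contrapT => /eqP nz; apply: nk; exists (N, phi).
pose psi k x : C := ((k%:R)%:C)%C / w (p k).1 (p k).2 * (p k).2 x.
have tpsi k : test_function U (psi k) by apply: testZ; have [] := hp k.
have bB : bounded_smooth U (range psi).
  split=> [_ [k _ <-]|K r cK KU]; first exact: test_smooth (tpsi k).
  have [n hn] : exists n : nat, forall x, K x -> `|x| < n%:R.
    have [M [_ hM]] := compact_bounded cK.
    have := hM (`|M| + 1); rewrite (le_lt_trans (ler_norm M)) ?ltrDl// => /(_ isT) KM.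
    exists (Num.bound (`|M| + 1)) => x /KM /= h; apply: le_lt_trans h _.
    have M1 : 0 <= `|M| + 1 by rewrite addr_ge0.
    by have := archi_boundP M1.
  exists (\sum_(k < n) ck_norm K r (psi k)) => _ [k _ <-].
  have S0 (P : pred 'I_n) : 0 <= \sum_(k < n | P k) ck_norm K r (psi k).
    by apply: sumr_ge0 => i _; exact: ck_norm_ge0.
  have [nk|kn] := leqP n k; last first.
    by rewrite (bigD1 (Ordinal kn))//= lerDl.
  apply: ck_norm_le => // s x _ Kx.
  have e y : [set y | `|y - 0| < n%:R] y -> psi k y = 0.
    rewrite /= subr0 => yn; have yk : `|y| < k.+1%:R.
      by apply: lt_le_trans yn _; rewrite ler_nat leqW.
    by rewrite /psi; have [_ h _] := hp k; rewrite h// mulr0.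
  rewrite (eq_cpartials s (@open_oball _ _ 0 n%:R) e); last by rewrite /= subr0 hn.
  by rewrite cpartials_cst; case: s; rewrite ?cmod0.
have [M hM] := bw _ bB.
pose k := Num.bound `|M|; have [tk _ nz] := hp k.
have := hM (p k).1 (psi k) (imageP _ I).
rewrite pairing_test// (distrZ (cw _).1 _ tk) divfK//.
rewrite cmod_real ger0_norm//; apply/negP; rewrite -ltNge.
by apply: le_lt_trans (ler_norm M) _; exact: archi_boundP.
Qed.

Section Multiplication.
Variables (u : (E -> C) -> C) (chi : E -> C).
Hypotheses (du : distribution_on U u) (tchi : test_function U chi).

Definition mul_distr : (E -> C) -> C := fun phi => u (fun x => chi x * phi x).

Let tmul phi : test_function U phi -> test_function U (fun x => chi x * phi x).
Proof. by move=> tp; apply: test_mul => //; exact: test_smooth tp. Qed.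

Lemma mul_distribution : distribution_on U mul_distr.
Proof.
split=> [b phi psi tp tq|K cK KU].
  rewrite /mul_distr; have [lin _] := du; rewrite -lin; [|exact: tmul..].
  by congr u; apply/funext => x; ring.
have [k [M [M0 hM]]] := distr_bound du cK KU.
exists k, (M * (2 ^+ k * ck_norm K k chi)) => phi tp pK.
have sK : csupport (fun x => chi x * phi x) `<=` K.
  apply: subset_trans pK; apply: csupport_sub => [|y]; first exact: csupport_closed.
  by apply: neq0_prop => /out_csupport ->; rewrite mulr0.
apply: le_trans (hM _ (tmul tp) sK) _; rewrite -!mulrA ler_wpM2l//.
apply: ck_normM cK KU _ _ => //; [exact: test_smooth tchi|exact: test_smooth tp].
Qed.

Lemma mul_distr_support : distr_support U mul_distr `<=` csupport chi.
Proof.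
move=> x [Ux h]; apply: contrapT => nx; apply: h; exists (U `&` ~` csupport chi); split.
- by apply: openI => //; exact: open_csupportC.
- by move=> y [].
- by [].
- move=> phi [_ _ pO]; rewrite /mul_distr -(distr0 du); congr u; apply/funext => y.
  have [/pO[_ /out_csupport ->]|/out_csupport ->] := pselect (csupport phi y).
    by rewrite mul0r.
  by rewrite mulr0.
Qed.

Lemma mul_distr_compact : compactly_supported_distribution U mul_distr.
Proof.
split; first exact: mul_distribution.
have [_ cc cU] := tchi.
exact: compact_distr_support cc cU mul_distr_support.
Qed.

Lemma pairing_mul psi : smooth_on U psi ->
  distr_pairing U mul_distr psi = u (fun x => chi x * psi x).
Proof.
move=> sp; have [_ cc cU] := tchi; have [th tth [V [oV sV th1]]] := cutoff_exists oU cc cU.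
rewrite (pairingE oU mul_distr_compact tth oV (subset_trans mul_distr_support sV) th1 sp).
rewrite /mul_distr; congr u; apply/funext => x.
have [/sV /th1 ->|/out_csupport ->] := pselect (csupport chi x); first by rewrite mul1r.
by rewrite !mul0r.
Qed.

Lemma mul_distr_bounded : bounded_compact_distributions U (fun=> mul_distr).
Proof.
split=> [_|B [sB bB]]; first exact: mul_distr_compact.
have [_ cc cU] := tchi.
have [k [M [M0 hM]]] := distr_bound du cc cU.
have [N hN] := bB _ k cc cU.
exists (M * (2 ^+ k * (ck_norm (csupport chi) k chi * `|N|))) => _ psi Bp.
rewrite pairing_mul; last exact: sB.
have sK : csupport (fun x => chi x * psi x) `<=` csupport chi.
  apply: csupport_sub => [|y]; first exact: csupport_closed.
  by apply: neq0_prop => /out_csupport ->; rewrite mul0r.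
apply: le_trans (hM _ _ sK) _; first by apply: test_mul => //; exact: sB.
rewrite ler_wpM2l//; apply: le_trans (ck_normM k oU cc cU (test_smooth tchi) (sB _ Bp)) _.
rewrite ler_wpM2l ?exprn_ge0// ler_wpM2l ?ck_norm_ge0//.
exact: le_trans (hN _ Bp) (ler_norm _).
Qed.

End Multiplication.
End Operators.

(** * Factorial growth and the exponent of decay *)

Section FactorialGrowth.
Variable R : realType.
Implicit Types (f g : nat -> R) (t : R) (N q : nat).

(** For a fixed [sigma], these are the sequences of constants that [WF_regular] tolerates
    for some [tau]. The class is stable under all the losses met below: products, fixed
    powers, and passing from [N] to a multiple of [N.+1]. *)
Definition factorial_growth f : Prop := exists A h b : R,
  [/\ 0 <= A, 1 <= h, 0 <= b & forall N, f N <= A * h ^+ N * N`!%:R `^ b].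

Lemma fact_ge1 N : 1 <= N`!%:R :> R.
Proof. by rewrite ler1n fact_gt0. Qed.

Lemma fgrowth_le f g : (forall N, f N <= g N) -> factorial_growth g -> factorial_growth f.
Proof.
move=> fg [A [h [b [A0 h1 b0 H]]]]; exists A, h, b; split=> // N.
exact: le_trans (fg N) (H N).
Qed.

Lemma fgrowth_cst t : factorial_growth (fun=> t).
Proof.
exists `|t|, 1, 0; split=> // N.
by rewrite expr1n powRr0 !mulr1 ler_norm.
Qed.

Let mono A A' (h h' b b' : R) N : 0 <= A -> A <= A' -> 1 <= h -> h <= h' -> b <= b' ->
  A * h ^+ N * N`!%:R `^ b <= A' * h' ^+ N * N`!%:R `^ b'.
Proof.
move=> A0 AA h1 hh bb; have h0 := le_trans ler01 h1.
apply: ler_pM; rewrite ?powR_ge0 ?mulr_ge0 ?exprn_ge0//.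
  apply: ler_pM; rewrite ?exprn_ge0//.
  by rewrite lerXn2r ?nnegrE// (le_trans h0).
by apply: ler_powR bb; exact: fact_ge1.
Qed.

Lemma fgrowthD f g : factorial_growth f -> factorial_growth g ->
  factorial_growth (fun N => f N + g N).
Proof.
move=> [A [h [b [A0 h1 b0 H]]]] [A' [h' [b' [A'0 h'1 b'0 H']]]].
exists (A + A'), (h + h'), (b + b'); split.
- exact: addr_ge0.
- by rewrite ler_wpDr// (le_trans ler01).
- exact: addr_ge0.
- move=> N; rewrite 2!mulrDl; apply: lerD.
    by apply: le_trans (H N) _; apply: mono; rewrite ?lerDl// (le_trans ler01).
  by apply: le_trans (H' N) _; apply: mono; rewrite ?lerDr// (le_trans ler01).
Qed.

Lemma fgrowthM f g : (forall N, 0 <= f N) -> (forall N, 0 <= g N) ->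
  factorial_growth f -> factorial_growth g -> factorial_growth (fun N => f N * g N).
Proof.
move=> f0 g0 [A [h [b [A0 h1 b0 H]]]] [A' [h' [b' [A'0 h'1 b'0 H']]]].
exists (A * A'), (h * h'), (b + b'); split.
- exact: mulr_ge0.
- by rewrite -[1]mulr1 ler_pM.
- exact: addr_ge0.
- move=> N; apply: le_trans (ler_pM (f0 N) (g0 N) (H N) (H' N)) _.
  rewrite powRD ?exprMn; first by apply: le_of_eq; ring.
  by apply/implyP => _; rewrite gt_eqF// (lt_le_trans ltr01 (fact_ge1 N)).
Qed.

Lemma fgrowthX f k : (forall N, 0 <= f N) -> factorial_growth f ->
  factorial_growth (fun N => f N ^+ k).
Proof.
move=> f0 gf; elim: k => [|k IH]; first exact: fgrowth_cst.
apply: fgrowth_le (fgrowthM f0 _ gf IH) => N; first by rewrite exprS.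
exact: exprn_ge0.
Qed.

Lemma fgrowth_powR f t : (forall N, 0 <= f N) -> 0 <= t -> factorial_growth f ->
  factorial_growth (fun N => f N `^ t).
Proof.
move=> f0 t0 [A [h [b [A0 h1 b0 H]]]]; have h0 := le_trans ler01 h1.
exists (A `^ t), (h `^ t), (b * t); split.
- exact: powR_ge0.
- by have := ler_powR h1 t0; rewrite powRr0.
- exact: mulr_ge0.
- move=> N.
  have hN : 0 <= A * h ^+ N * N`!%:R `^ b by rewrite !mulr_ge0 ?exprn_ge0 ?powR_ge0.
  apply: le_trans (ge0_ler_powR t0 _ _ (H N)) _; rewrite ?nnegrE//.
  rewrite powRM ?mulr_ge0 ?exprn_ge0 ?powR_ge0// powRM ?exprn_ge0// -powRrM.
  have e : (h ^+ N) `^ t = (h `^ t) ^+ N.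
    by rewrite -(powR_mulrn N h0) -(powR_mulrn N (powR_ge0 h t)) powRAC.
  by rewrite e.
Qed.

Lemma fgrowth_exp t : 0 <= t -> factorial_growth (fun N => t ^+ N).
Proof.
move=> t0; exists 1, (1 + t), 0; split=> //; first by rewrite lerDl.
by move=> N; rewrite powRr0 mulr1 mul1r lerXn2r ?nnegrE ?addr_ge0// lerDr.
Qed.

Lemma fgrowth_expl t q : 0 <= t -> factorial_growth (fun N => t ^+ (q * N.+1)).
Proof.
move=> t0; have := fgrowthM _ _ (fgrowth_cst (t ^+ q)) (fgrowth_exp (exprn_ge0 q t0)).
move=> /(_ (fun=> exprn_ge0 q t0) (fun N => exprn_ge0 N (exprn_ge0 q t0))).
by apply: fgrowth_le => N; rewrite mulnS exprD exprM.
Qed.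

Lemma fact_mul_le q n : ((q * n)`! <= q ^ (q * n) * n`! ^ q)%N.
Proof.
elim: n => [|n IH]; first by rewrite muln0 expn0 mul1n fact0 exp1n.
have h k : (k <= q)%N -> ((q * n + k)`! <= (q * n)`! * (q * n.+1) ^ k)%N.
  elim: k => [|k IHk] kq; first by rewrite addn0 expn0 muln1.
  rewrite addnS factS mulnC expnSr mulnA leq_mul//; first exact: IHk (ltnW kq).
  by rewrite mulnS addnC -addSn leq_add2r.
have := h q (leqnn q); rewrite addnC -mulnS => /leq_trans; apply.
apply: (leq_trans (leq_mul IH (leqnn _))); apply: eq_leq.
by rewrite factS !expnMn mulnS expnD; nia.
Qed.

Lemma fgrowth_fact q : factorial_growth (fun N => (q * N.+1)`!%:R).
Proof.
pose f N : R := q%:R ^+ (q * N.+1) * ((2 ^+ N * N`!%:R) ^+ q).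
have base : factorial_growth (fun N => N`!%:R).
  by exists 1, 1, 1; split=> // N; rewrite expr1n !mul1r powRr1.
apply: (@fgrowth_le _ f) => [N|].
  apply: (@le_trans _ _ (q ^ (q * N.+1) * (N.+1)`! ^ q)%N%:R).
    by rewrite ler_nat; exact: fact_mul_le.
  rewrite natrM natrX ler_wpM2l ?exprn_ge0// natrX lerXn2r ?nnegrE ?mulr_ge0 ?exprn_ge0//.
  by rewrite factS natrM ler_wpM2r// -natrX ler_nat ltn_expl.
apply: fgrowthM; [by move=> N; exact: exprn_ge0| | |].
- by move=> N; rewrite exprn_ge0// mulr_ge0// exprn_ge0.
- exact: fgrowth_expl.
- apply: fgrowthX => [N|]; first by rewrite mulr_ge0// exprn_ge0.
  apply: fgrowthM; [by move=> N; exact: exprn_ge0|by move=> N; exact: ler0n| |exact: base].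
  exact: fgrowth_exp.
Qed.

Lemma fgrowth_regular f (sigma : R) : 1 < sigma -> factorial_growth f ->
  exists tau A h : R, [/\ 0 < tau, 0 < A, 0 < h &
    forall N, f N <= A * (h ^+ N * N`!%:R `^ (tau / sigma))].
Proof.
move=> s1 [A [h [b [A0 h1 b0 H]]]]; have s0 : 0 < sigma := lt_trans ltr01 s1.
exists ((b + 1) * sigma), (A + 1), h; split.
- by rewrite mulr_gt0// ltr_wpDl.
- by rewrite ltr_wpDl.
- exact: lt_le_trans h1.
- move=> N; apply: le_trans (H N) _; rewrite mulfK ?gt_eqF// mulrA.
  by apply: mono; rewrite ?lerDl.
Qed.

(** The exponent of decay at stage [N]. *)
Definition decay (sigma : R) N : nat := Num.truncn (N%:R `^ sigma^-1).

Lemma decay_le sigma N : 1 < sigma -> (decay sigma N <= N)%N.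
Proof.
move=> s1; have s0 : 0 < sigma := lt_trans ltr01 s1.
rewrite -(ler_nat R); apply: le_trans (_ : N%:R `^ sigma^-1 <= _).
  by rewrite truncn_le powR_ge0.
case: N => [|N]; first by rewrite powR0// invr_eq0 gt_eqF.
by apply: ler1_powR; rewrite ?ler1n// invf_le1// ltW.
Qed.

(** Since [(K * N.+1) ^ (1 / sigma)] is at least [(1 + q) * N.+1 ^ (1 / sigma)] for [K] at
    least [(1 + q) ^ sigma], a multiple of the stage buys [q] more powers. *)
Lemma decay_shift sigma q : 1 < sigma ->
  exists K : nat, forall N, (decay sigma N + q <= decay sigma (K * N.+1))%N.
Proof.
move=> s1; have s0 : 0 < sigma := lt_trans ltr01 s1.
have sV : 0 <= sigma^-1 by rewrite invr_ge0 ltW.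
pose K := (Num.truncn ((1 + q%:R) `^ sigma)).+1; exists K => N.
have q0 : 0 <= 1 + q%:R :> R by rewrite addr_ge0.
have hK : (1 + q%:R) `^ sigma <= K%:R.
  by have /andP[_ /ltW] := truncn_itv (powR_ge0 (1 + q%:R) sigma).
rewrite truncn_ge_nat ?powR_ge0// natrD natrM powRM//.
apply: (@le_trans _ _ (N.+1%:R `^ sigma^-1 + q%:R)).
  rewrite lerD2r; apply: (@le_trans _ _ (N%:R `^ sigma^-1)).
    by rewrite truncn_le powR_ge0.
  by apply: ge0_ler_powR => //; rewrite ?nnegrE// ler_nat.
apply: (@le_trans _ _ ((1 + q%:R) * N.+1%:R `^ sigma^-1)).
  rewrite mulrDl mul1r lerD2l ler_peMr//.
  by have := ler_powR (_ : 1 <= N.+1%:R :> R) sV; rewrite powRr0; apply; rewrite ler1n.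
rewrite ler_wpM2r ?powR_ge0//.
have := ge0_ler_powR sV _ _ hK; rewrite -powRrM mulfV ?gt_eqF// powRr1//.
by apply; rewrite nnegrE ?powR_ge0.
Qed.

End FactorialGrowth.

(** * Stability under differential operators *)

Section Euclidean.
Variables (R : realType) (d : nat).
Local Notation E := 'rV[R]_d.
Implicit Types (x xi : E).

Lemma norm_le_enorm2 x : `|x| <= enorm2 x.
Proof.
apply: norm_le_coord; first exact: sqrtr_ge0.
move=> j; rewrite -sqrtr_sqr ler_wsqrtr// /dot (bigD1 j)//= expr2 lerDl.
by apply: sumr_ge0 => i _; rewrite -expr2 sqr_ge0.
Qed.

Lemma enorm2_le_norm x : enorm2 x <= (1 + d%:R) * `|x|.
Proof.
have d0 : 0 <= (1 + d%:R) * `|x| by rewrite mulr_ge0// addr_ge0.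
rewrite -[leRHS](ger0_norm d0) -sqrtr_sqr ler_wsqrtr//.
apply: (@le_trans _ _ (\sum_(j < d) `|x| ^+ 2)).
  apply: ler_sum => j _; rewrite -expr2 -(real_normK (num_real (x 0 j))).
  by rewrite lerXn2r ?nnegrE// coord_le_norm.
rewrite sumr_const card_ord -[leLHS]mulr_natl exprMn ler_wpM2r ?sqr_ge0//.
have := ler0n R d; nra.
Qed.

Lemma enorm2_gt0 x : x != 0 -> 0 < enorm2 x.
Proof. by move=> x0; apply: lt_le_trans (norm_le_enorm2 x); rewrite normr_gt0. Qed.

(** What is proved below about constants is only their growth; [tau] is read off it. *)
Lemma WF_regular_growth (U : set E) (sigma : R) u x0 xi0 Omega Gamma w (f : nat -> R) :
  1 < sigma -> open Omega -> Omega x0 -> Omega `<=` U -> conic_neighborhood xi0 Gamma ->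
  bounded_compact_distributions U w -> (forall N, eq_distr_on Omega (w N) u) ->
  factorial_growth f ->
  (forall N xi, Gamma xi -> xi != 0 ->
     cmod (fourier_distr U (w N) xi) <= f N / enorm2 xi ^+ decay sigma N) ->
  exists2 tau, 0 < tau & WF_regular U tau sigma u x0 xi0.
Proof.
move=> s1 oO Ox OU cG bw ew gf H.
have [tau [A [h [t0 A0 h0 hf]]]] := fgrowth_regular s1 gf.
exists tau => //; exists Omega, Gamma, w, A, h; split=> // N xi Gxi xi0'.
apply: le_trans (H N xi Gxi xi0') _; rewrite mulrA ler_wpM2r ?hf//.
by rewrite invr_ge0 exprn_ge0// ltW// enorm2_gt0.
Qed.

End Euclidean.

Section FirstInclusion.
Variables (R : realType) (d : nat) (U : set 'rV[R]_d).
Hypothesis oU : open U.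
Local Notation E := 'rV[R]_d.
Local Notation C := R[i].
Variables (m : nat) (c : C) (a : multi_index d m -> C).

(** Applying [P(D)] multiplies Fourier transforms by a polynomial of degree [m]; going
    to the stage [K * N.+1] of the sequence provides the [m] missing powers of [|xi|],
    at the price of a larger [tau]. *)
Lemma WF_regular_pdo tau sigma u x0 xi0 : 1 < sigma -> 0 < tau ->
  WF_regular U tau sigma u x0 xi0 ->
  exists2 tau', 0 < tau' & WF_regular U tau' sigma (pdo_distr c a u) x0 xi0.
Proof.
move=> s1 t0 [Om [Ga [w [A [h [[oO Ox OU] cG [bw ew] [A0 h0] H]]]]]].
have s0 : 0 < sigma := lt_trans ltr01 s1.
have ts : 0 <= tau / sigma by rewrite divr_ge0// ltW.
have [K hK] := decay_shift m s1.
have [B [B0 hB]] := psym_le c a.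
have [mu [D [D0 hD]]] := bounded_fourier_growth oU bw.
pose N' N := (K * N.+1)%N.
pose g N := A * (h ^+ N' N * (N' N)`!%:R `^ (tau / sigma)).
pose f N := B * 2 ^+ m * (g N + D * 2 ^+ mu).
have g0 N : 0 <= g N by rewrite !mulr_ge0 ?exprn_ge0 ?powR_ge0// ltW.
have B2 : 0 <= B * 2 ^+ m by rewrite mulr_ge0// exprn_ge0.
have D2 : 0 <= D * 2 ^+ mu by rewrite mulr_ge0// exprn_ge0.
have gg : factorial_growth g.
  apply: fgrowthM; [by move=> _; exact: ltW| |exact: fgrowth_cst|].
    by move=> N; rewrite mulr_ge0 ?exprn_ge0 ?powR_ge0// ltW.
  apply: fgrowthM; [by move=> N; rewrite exprn_ge0// ltW|by move=> N; exact: powR_ge0| |].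
    by apply: fgrowth_expl; exact: ltW.
  by apply: fgrowth_powR => //; exact: fgrowth_fact.
have gf : factorial_growth f.
  apply: fgrowthM; [by []|by move=> N; exact: addr_ge0|exact: fgrowth_cst|].
  by apply: fgrowthD => //; exact: fgrowth_cst.
apply: (@WF_regular_growth _ _ U sigma _ x0 xi0 Om Ga
    (fun N => pdo_distr c a (w (N' N))) f) => //.
- apply: pdo_bounded => //; have [cw bw2] := bw; split=> [N|S bS]; first exact: cw.
  by have [M hM] := bw2 S bS; exists M => N psi; exact: hM.
- by move=> N; apply: pdo_eq_on; exact: ew.
- move=> N xi Gxi xi0'; have e0 := enorm2_gt0 xi0'; have ne := norm_le_enorm2 xi.
  rewrite fourier_pdo//; last by have [cw _] := bw; exact: cw.
  rewrite cmodM; set e := enorm2 xi in e0 ne *.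
  have hp : cmod (psym c a xi) <= B * (1 + e) ^+ m.
    apply: le_trans (hB xi) _; rewrite ler_wpM2l// lerXn2r ?nnegrE ?addr_ge0 ?(ltW e0)//.
    by rewrite lerD2l.
  have eM k : 0 < e ^+ k by rewrite exprn_gt0.
  have [e1|/ltW e1] := leP 1 e.
    have hw : cmod (fourier_distr U (w (N' N)) xi) <= g N / e ^+ (decay sigma N + m).
      apply: le_trans (H (N' N) xi Gxi xi0') _; rewrite -/e mulrA -/(decay sigma (N' N)).
      by rewrite ler_wpM2l ?g0// lef_pV2 ?posrE// ler_weXn2l.
    apply: le_trans (ler_pM (cmod_ge0 _) (cmod_ge0 _) hp hw) _.
    apply: (@le_trans _ _ (B * (2 ^+ m * e ^+ m) * (g N / e ^+ (decay sigma N + m)))).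
      rewrite ler_wpM2r ?divr_ge0 ?(ltW (eM _))// ler_wpM2l// -exprMn.
      have e2 : 1 + e <= 2 * e by rewrite mulr_natl mulr2n lerD2r.
      by apply: lerXn2r e2; rewrite nnegrE ?addr_ge0 ?mulr_ge0 ?(ltW e0).
    have alg (x y z p q : R) : 0 < p -> 0 < q -> x * (y * q) * (z / (p * q)) = x * y * z / p.
      by move=> p0 q0; field; rewrite !gt_eqF.
    rewrite exprD alg//.
    by rewrite ler_wpM2r ?invr_ge0 ?(ltW (eM _))// ler_wpM2l// lerDl.
  have hw : cmod (fourier_distr U (w (N' N)) xi) <= D * 2 ^+ mu.
    apply: le_trans (hD _ _) _; rewrite ler_wpM2l// lerXn2r ?nnegrE ?addr_ge0//.
    by rewrite -[2]/(1 + 1) lerD2l (le_trans ne).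
  apply: le_trans (ler_pM (cmod_ge0 _) (cmod_ge0 _) hp hw) _.
  rewrite -[leLHS]mulr1; apply: ler_pM => //.
  + by rewrite !mulr_ge0// exprn_ge0// addr_ge0// ltW.
  + apply: ler_pM => //; first by rewrite mulr_ge0// exprn_ge0// addr_ge0// ltW.
      have e2 : 1 + e <= 2 by rewrite -[2]/(1 + 1) lerD2l.
      by rewrite ler_wpM2l//; apply: lerXn2r e2; rewrite nnegrE ?addr_ge0 ?(ltW e0).
    by rewrite lerDr.
  + by rewrite invf_ge1// exprn_ile1// ltW.
Qed.

End FirstInclusion.

(** * Localized plane waves *)

Section ProductEstimate.
Variables (R : realType) (d : nat) (U : set 'rV[R]_d).
Hypothesis oU : open U.
Local Notation E := 'rV[R]_d.
Local Notation C := R[i].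
Implicit Types (x xi kap : E).

Lemma cexpD (s t : R) : cexp (s + t) = cexp s * cexp t.
Proof.
rewrite /cexp cosD sinD; apply/eqP; rewrite eq_complex /=.
by apply/andP; split; apply/eqP; ring.
Qed.

Lemma cexp0 : cexp (0 : R) = 1.
Proof. by rewrite /cexp cos0 sin0. Qed.

Lemma cexp_sum I (r : seq I) (F : I -> R) :
  cexp (\sum_(i <- r) F i) = \prod_(i <- r) cexp (F i).
Proof. by elim/big_rec2: _ => [|i y1 y2 _ <-]; rewrite ?cexp0 ?cexpD. Qed.

Lemma cmod_cexp (t : R) : cmod (cexp t) = 1.
Proof. by rewrite /cmod /= cos2Dsin2 sqrtr1. Qed.

Lemma kernel_cexp xi x : fourier_kernel xi x = cexp (- (2 * pi * dot x xi)).
Proof. by rewrite /cexp cosN sinN. Qed.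

Lemma dotBr x xi kap : dot x (xi - kap) = dot x xi - dot x kap.
Proof.
rewrite /dot -sumrB; apply: eq_bigr => j _; by rewrite !mxE mulrBr.
Qed.

Lemma dotBl x (a : E) kap : dot (x - a) kap = dot x kap - dot a kap.
Proof.
rewrite /dot -sumrB; apply: eq_bigr => j _; by rewrite !mxE mulrBl.
Qed.

Lemma real_complex_prod I (r : seq I) (f : I -> R) :
  ((\prod_(i <- r) f i)%:C)%C = \prod_(i <- r) ((f i)%:C)%C :> C.
Proof. exact: rmorph_prod. Qed.

Lemma prod_dist I (r : seq I) (a b : I -> R) (P e : R) : 1 <= P -> 0 <= e ->
  (forall j, `|a j| <= P) -> (forall j, `|b j| <= P) -> (forall j, `|a j - b j| <= e) ->
  `|\prod_(j <- r) a j - \prod_(j <- r) b j| <= (size r)%:R * P ^+ size r * e.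
Proof.
move=> P1 e0 aP bP ab; have P0 := le_trans ler01 P1.
have pb s : `|\prod_(j <- s) b j| <= P ^+ size s.
  elim: s => [|j s IH]; first by rewrite big_nil normr1.
  by rewrite big_cons normrM exprS; apply: ler_pM.
elim: r => [|j r IH]; first by rewrite !big_nil subrr normr0 !mul0r.
rewrite !big_cons; set x := \prod_(i <- r) a i in IH *; set y := \prod_(i <- r) b i in IH *.
rewrite (_ : _ - _ = a j * (x - y) + (a j - b j) * y); last by ring.
apply: le_trans (ler_normD _ _) _; rewrite !normrM.
apply: (@le_trans _ _ (P * ((size r)%:R * P ^+ size r * e) + e * P ^+ size r)).
  by apply: lerD; apply: ler_pM => //; exact: pb.
rewrite /= exprS -addn1 natrD.
have eP : e * P ^+ size r <= P * P ^+ size r * e.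
  by rewrite mulrC ler_wpM2r// ler_peMl// exprn_ge0.
apply: le_trans (lerD (lexx _) eP) _; apply: le_of_eq; ring.
Qed.

Variables (F : nat -> R -> R) (A1 C1 del r : R) (a : E).
Hypotheses (tF : tower F) (gF : gevrey A1 C1 F) (del0 : 0 < del) (r0 : 0 < r).
Hypothesis F_supp : forall n (t : R), del <= `|t| -> F n t = 0.
Hypothesis aU : cball a del `<=` U.

(** The period: large enough for the ball of radius [2 * r] around the origin, seen
    from [a], to fit in a quarter of it. *)
Definition period : R := 4 * (2 * r + `|a| + del + 1).

Let L := period.
Let L1 : 1 <= L. Proof. by rewrite /L /period; have := normr_ge0 a; move: r0 del0; lra. Qed.
Let L0 : 0 < L. Proof. exact: lt_le_trans L1. Qed.

Let F_supp2 n (t : R) : L / 2 <= `|t| -> F n t = 0.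
Proof.
move=> h; apply: F_supp; apply: le_trans h; rewrite /L /period.
by have := normr_ge0 a; have := r0; have := del0; lra.
Qed.

Let Fbound n : exists2 B : R, 0 <= B & forall t, `|F n t| <= B.
Proof.
exists (A1 * C1 ^+ n * n`!%:R ^+ 2); last exact: gF.
exact: le_trans (normr_ge0 _) (gF n 0).
Qed.

Let F_lip n : exists2 Lam : R, 0 <= Lam & forall x t : R, `|F n x - F n t| <= Lam * `|x - t|.
Proof.
have [B B0 hB] := Fbound n.+1; exists B => //.
suff h (x t : R) : x <= t -> `|F n x - F n t| <= B * `|x - t|.
  move=> x t; have [/h//|/ltW /h] := leP x t.
  by rewrite distrC (distrC t).
move=> xt; have cF : {within `[x, t], continuous (F n)}.
  by apply: continuous_subspaceT => z; exact: (tower_continuous tF).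
have [z _ e] := MVT_segment xt (fun z _ => tF n z) cF.
by rewrite distrC e normrM (distrC x t) ler_wpM2r.
Qed.

Let approx I (e : R) : 0 < e -> \forall n \near \oo, forall i, (i <= I)%N ->
  forall t, `|t| <= L / 4 -> `|fejer L n (F i) t - F i t| <= e.
Proof.
move=> e0; elim: I => [|I IH].
  have [Lam Lam0 hL] := F_lip 0.
  have := fejer_cvg L0 (@tower_continuous _ _ 0 tF) Lam0 hL e0.
  by apply: filterS => n h i; rewrite leqn0 => /eqP ->.
have [Lam Lam0 hL] := F_lip I.+1.
have := fejer_cvg L0 (@tower_continuous _ _ I.+1 tF) Lam0 hL e0.
apply: filterS2 IH => n h1 h2 i; rewrite leq_eqVlt => /orP[/eqP ->//|]; exact: h1.
Qed.

Let G := tensor F a.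
Let H n := tensor (fun i => fejer L n (F i)) a.

Let mG : mtower G. Proof. exact: mtower_tensor. Qed.
Let mH n : mtower (H n).
Proof. by apply: mtower_tensor; exact: fejer_tower. Qed.

Let le_maddl (gam : 'I_d -> nat) s j : (maddl gam s j <= mi_order gam + size s)%N.
Proof.
rewrite addnC -mi_order_maddl /mi_order.
by rewrite (bigD1 j)//= leq_addr.
Qed.

(** The Fejer approximations of a tensor product converge with all their derivatives,
    uniformly on [cball 0 (2 * r)]. *)
Let approxG gam k (e : R) : 0 < e -> exists n, (0 < n)%N /\
  forall s x, (size s <= k)%N -> `|x| <= 2 * r ->
    cmod (cpartials s (fun x => G gam x - H n gam x) x) <= e.
Proof.
move=> e0; pose I := (mi_order gam + k)%N.
have /choice[B hB] i : exists B : R, 0 <= B /\ forall t, `|F i t| <= B.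
  by have [B B0 h] := Fbound i; exists B.
pose P : R := 1 + 1 + \sum_(i < I.+1) B i.
have S0 (Q : pred 'I_I.+1) : 0 <= \sum_(i < I.+1 | Q i) B i.
  by apply: sumr_ge0 => i _; have [] := hB i.
have P1 : 1 <= P by rewrite /P; have := S0 xpredT; lra.
have BP i : (i <= I)%N -> B i + 1 <= P.
  move=> iI; rewrite /P (bigD1 (Ordinal (iI : i < I.+1)%N))//=.
  by have := S0 (fun j => j != Ordinal (iI : i < I.+1)%N); lra.
have P0 := le_trans ler01 P1.
pose D : R := d%:R * P ^+ d + 1.
have D0 : 0 < D by rewrite ltr_wpDl// mulr_ge0// exprn_ge0.
pose e1 := Num.min 1 (e / D).
have e10 : 0 < e1 by rewrite lt_min ltr01 divr_gt0.
have /filter_ex[n [n0 hn]] : \forall n \near \oo, (0 < n)%N /\ forall i, (i <= I)%N ->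
    forall t, `|t| <= L / 4 -> `|fejer L n (F i) t - F i t| <= e1.
  by apply: filterS2 (nbhs_infty_gt 0%N) (approx I e10) => n h1 h2.
exists n; split=> // s x sk xr.
rewrite (mtower_partials s gam (mtowerB mG (mH n))) /G /H /tensor -rmorphB cmod_real.
have gI j : (maddl gam s j <= I)%N.
  by apply: leq_trans (le_maddl gam s j) _; rewrite leq_add2l.
have xL j : `|x 0 j - a 0 j| <= L / 4.
  have := coord_le_norm x j; have := coord_le_norm a j => h1 h2.
  apply: le_trans (ler_normB _ _) _; rewrite /L /period; have := del0; lra.
have near_e j := hn _ (gI j) _ (xL j).
have e11 : e1 <= 1 by rewrite ge_min lexx.
have := @prod_dist _ (index_enum 'I_d) (fun j => F (maddl gam s j) (x 0 j - a 0 j))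
  (fun j => fejer L n (F (maddl gam s j)) (x 0 j - a 0 j)) P e1 P1 (ltW e10).
have -> : size (index_enum 'I_d) = d by rewrite -sum1_size sum_nat_const card_ord muln1.
move=> h; apply: le_trans (h _ _ _) _ => [j|j|j|].
- by apply: le_trans ((hB _).2 _) _; have := BP _ (gI j); lra.
- rewrite -[X in `|X|](subrK (F (maddl gam s j) (x 0 j - a 0 j))).
  apply: le_trans (ler_normD _ _) _.
  by have := (hB (maddl gam s j)).2 (x 0 j - a 0 j); have := BP _ (gI j); have := near_e j; lra.
- by rewrite distrC near_e.
- apply: (@le_trans _ _ (D * e1)).
    by rewrite ler_wpM2r ?(ltW e10)// lerDl.
  rewrite mulrC -ler_pdivlMr// ge_min lexx orbT//.
Qed.

Variable v : (E -> C) -> C.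
Hypothesis cv : compactly_supported_distribution U v.
Hypothesis v_supp : forall phi, test_function U phi ->
  (forall x, `|x| < r -> phi x = 0) -> v phi = 0.

Let smooth_G gam xi : smooth_on U (fun x => G gam x * fourier_kernel xi x).
Proof. by apply: smooth_onM => //; [exact: mtower_smooth|exact: smooth_kernel]. Qed.

Lemma test_tensor gam (O : set E) : cball a del `<=` O -> test_function O (tensor F a gam).
Proof.
move=> aO; apply: (test_of (K := cball a del)) => //; first exact: mtower_smooth.
- exact: compact_cball.
- move=> x; apply: neq0_prop => /negP; rewrite -ltNge => /ltW h.
  have [j hj] := norm_ge_coord del0 h.
  by rewrite /tensor (bigD1 j)//= F_supp ?mul0r//; move: hj; rewrite !mxE.
Qed.

Lemma test_tensor_wave gam xi (O : set E) : cball a del `<=` O ->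
  test_function O (fun x => tensor F a gam x * fourier_kernel xi x).
Proof.
move=> aO; have [sm cm sO] := test_tensor gam aO.
apply: (test_of (K := csupport (tensor F a gam))) => //.
- by apply: smooth_onM => //; [exact: openT|exact: smooth_kernel].
- by move=> x; apply: neq0_prop => /out_csupport ->; rewrite mul0r.
Qed.

(** Expanding the approximation of the tensor product into plane waves turns the
    action of [v] into a sum of values of its Fourier transform. *)
Let pairing_H n gam xi : (0 < n)%N ->
  distr_pairing U v (fun x => H n gam x * fourier_kernel xi x) =
  \sum_(p : {ffun 'I_d -> 'I_n * 'I_n})
    (\prod_j ((n%:R^-1)%:C%C * fourier_coef L (F (gam j)) (freq L (p j)))) *
    cexp (- (2 * pi * dot a (\row_j freq L (p j)))) *
    fourier_distr U v (xi - \row_j freq L (p j)).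
Proof.
move=> n0; have e x : H n gam x * fourier_kernel xi x =
    \sum_(p : {ffun 'I_d -> 'I_n * 'I_n})
    (\prod_j ((n%:R^-1)%:C%C * fourier_coef L (F (gam j)) (freq L (p j))) *
     cexp (- (2 * pi * dot a (\row_j freq L (p j))))) *
    fourier_kernel (xi - \row_j freq L (p j)) x.
  rewrite /H /tensor real_complex_prod.
  under eq_bigr => j _ do rewrite (@fejerE R L n (F (gam j)) (x 0 j - a 0 j) (@tower_continuous _ _ (gam j) tF)).
  rewrite bigA_distr_bigA mulr_suml; apply: eq_bigr => p _.
  rewrite big_split /= -!mulrA; congr (_ * _).
  rewrite -cexp_sum !kernel_cexp -!cexpD; congr cexp.
  set k := \row_j freq L (p j).
  have -> : \sum_j 2 * pi * freq L (p j) * (x 0 j - a 0 j) = 2 * pi * dot (x - a) k.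
    rewrite /dot mulr_sumr; apply: eq_bigr => j _; rewrite !mxE; ring.
  by rewrite dotBl dotBr; ring.
rewrite (funext e) pairing_sum//; last first.
  by move=> p; apply: smooth_onZ => //; exact: smooth_kernel.
by apply: eq_bigr => p _; rewrite pairingZ//; exact: smooth_kernel.
Qed.

Let bound_H n gam xi J T B : (0 < n)%N -> 0 <= T ->
  (forall kap, cmod (fourier_distr U v (xi - kap)) <= T * \prod_j (1 + `|kap 0 j|) ^+ J) ->
  (forall j t, `|F (gam j) t| <= B) -> (forall j t, `|F (J.+2 + gam j)%N t| <= B) ->
  cmod (distr_pairing U v (fun x => H n gam x * fourier_kernel xi x)) <=
  T * (4 * L ^+ 2 * (2 ^+ (J + 4) * B)) ^+ d.
Proof.
move=> n0 T0 hv B1 B2; rewrite pairing_H//.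
apply: le_trans (cmod_sum _ _ _) _.
pose q j (p : 'I_n * 'I_n) : R :=
  cmod ((n%:R^-1)%:C%C * fourier_coef L (F (gam j)) (freq L p)) * (1 + `|freq L p|) ^+ J.
apply: (@le_trans _ _ (\sum_(p : {ffun 'I_d -> 'I_n * 'I_n}) T * \prod_j q j (p j))).
  apply: ler_sum => p _; rewrite 2!cmodM cmod_cexp mulr1 cmod_prod.
  apply: le_trans (ler_wpM2l _ (hv _)) _.
    by apply: prodr_ge0 => j _; exact: cmod_ge0.
  rewrite mulrCA ler_wpM2l// /q big_split /=.
  by apply: le_of_eq; congr (_ * _); apply: eq_bigr => j _; rewrite mxE.
rewrite -mulr_sumr ler_wpM2l// -bigA_distr_bigA /=.
have q0 j : 0 <= \sum_p q j p.
  by apply: sumr_ge0 => p _; rewrite mulr_ge0 ?cmod_ge0// exprn_ge0// addr_ge0.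
apply: (@le_trans _ _ (\prod_(j < d) (4 * L ^+ 2 * (2 ^+ (J + 4) * B)))).
  apply: ler_prod => j _; rewrite q0/=.
  exact: (fejer_coef_sum L1 tF F_supp2 n0 (B1 j) (B2 j)).
by rewrite prodr_const card_ord.
Qed.

(** Microlocalization: the cutoff is a limit of combinations of plane waves of frequency
    [kap] whose coefficients decay fast enough to absorb the losses [(1 + |kap|) ^ J], and
    [v] sees these plane waves through its Fourier transform at [xi - kap]. *)
Lemma tensor_wave_le gam xi J T B : 0 <= T ->
  (forall kap, cmod (fourier_distr U v (xi - kap)) <= T * \prod_j (1 + `|kap 0 j|) ^+ J) ->
  (forall j t, `|F (gam j) t| <= B) -> (forall j t, `|F (J.+2 + gam j)%N t| <= B) ->
  cmod (v (fun x => tensor F a gam x * fourier_kernel xi x)) <=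
  T * (4 * period ^+ 2 * (2 ^+ (J + 4) * B)) ^+ d.
Proof.
move=> T0 hv B1 B2; have dv := cv.1.
have [th tth [V [oV sV th1]]] := compact_supp_cutoff oU cv.
have r2 : 0 < 2 * r by rewrite mulr_gt0.
have [b [sb b1 b0]] := @box_bump _ d 0 _ r2.
(* Beyond the radius [2 * r] the approximations are out of control; [v] does not see it. *)
pose Th x := th x * b x.
have tTh : test_function U Th by apply: test_mul => //; exact: smooth_on_sub sb.
have pairTh psi : smooth_on U psi -> distr_pairing U v psi = v (fun x => Th x * psi x).
  move=> sp; rewrite (pairingE oU cv tth oV sV th1 sp).
  have t1 := test_mul oU tth sp; have t2 := test_mul oU tTh sp.
  apply/eqP; rewrite -subr_eq0 -(distrB dv t1 t2); apply/eqP; apply: v_supp; first exact: testB.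
  move=> x xr; rewrite /Th b1 ?mulr1 ?subrr// subr0; apply: ltW; apply: lt_le_trans xr _.
  by rewrite mulrAC divff ?mul1r.
have [_ cTh ThU] := tTh.
have Th_ball x : csupport Th x -> `|x| <= 2 * r.
  have cl : csupport Th `<=` cball 0 (2 * r).
    apply: csupport_sub => [|y].
      apply: compact_closed; first exact: norm_hausdorff.
      exact: compact_cball.
    apply: neq0_prop => /negP; rewrite -ltNge => /ltW h.
    by rewrite /Th b0 ?mulr0.
  by move=> /cl; rewrite /cball /= subr0.
have [k [M [M0 hM]]] := distr_bound dv cTh ThU.
pose Phi x := Th x * fourier_kernel xi x.
have sPhi : smooth_on U Phi.
  by apply: smooth_onM => //; [exact: test_smooth tTh|exact: smooth_kernel].
pose Z := M * (2 ^+ k * ck_norm (csupport Th) k Phi).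
have Z0 : 0 <= Z by rewrite !mulr_ge0 ?exprn_ge0 ?ck_norm_ge0.
apply/ler_addgt0Pr => e e0.
have e10 : 0 < e / (Z + 1) by rewrite divr_gt0// ltr_wpDl.
have [n [n0 hn]] := approxG gam k e10.
have tw := test_tensor_wave gam xi aU.
rewrite -(pairing_test oU cv tw) pairTh; last exact: smooth_G.
have smH : smooth_on U (fun x => H n gam x * fourier_kernel xi x).
  by apply: smooth_onM => //; [exact: mtower_smooth|exact: smooth_kernel].
have t1 := test_mul oU tTh (@smooth_G gam xi).
have t2 := test_mul oU tTh smH.
have -> : v (fun x => Th x * (tensor F a gam x * fourier_kernel xi x)) =
   v (fun x => Th x * (H n gam x * fourier_kernel xi x)) +
   v (fun x => Phi x * (G gam x - H n gam x)).
  rewrite -(distrD dv t2).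
    by congr v; apply/funext => x; rewrite /Phi /G; ring.
  have -> : (fun x => Phi x * (G gam x - H n gam x)) =
      (fun x => Th x * (G gam x * fourier_kernel xi x) - Th x * (H n gam x * fourier_kernel xi x)).
    by apply/funext => x; rewrite /Phi; ring.
  exact: testB.
apply: le_trans (cmodD _ _) _; apply: lerD.
  by rewrite -pairTh//; exact: bound_H.
have sD : smooth_on U (fun x => G gam x - H n gam x).
  exact: (@mtower_smooth _ _ U _ gam (mtowerB mG (mH n))).
have sPh : csupport (fun x => Phi x * (G gam x - H n gam x)) `<=` csupport Th.
  apply: csupport_sub => [|y]; first exact: csupport_closed.
  by apply: neq0_prop => /out_csupport h; rewrite /Phi h !mul0r.
apply: le_trans (hM _ _ sPh) _.
  have tPhi : test_function U Phi by apply: test_mul => //; exact: smooth_kernel.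
  exact: test_mul.
apply: (@le_trans _ _ (Z * (e / (Z + 1)))); last first.
  rewrite mulrA ler_pdivrMr ?ltr_wpDl// mulrDr mulr1 mulrC lerDl ltW//.
rewrite /Z -!mulrA ler_wpM2l//.
apply: le_trans (ck_normM k oU cTh ThU sPhi sD) _.
rewrite ler_wpM2l ?exprn_ge0// ler_wpM2l ?ck_norm_ge0//.
apply: ck_norm_le; first exact: ltW.
by move=> s x sk /Th_ball; exact: hn.
Qed.

End ProductEstimate.

(** * Elliptic cones and the elliptic recursion *)

Section Cones.
Variables (R : realType) (d : nat).
Local Notation E := 'rV[R]_d.
Local Notation C := R[i].
Implicit Types (x xi kap : E).

Lemma cdiff_near_neq0 (f : E -> C) x : cdifferentiable f x -> f x != 0 ->
  exists b r : R, [/\ 0 < b, 0 < r & forall y, `|y - x| < r -> b <= cmod (f y)].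
Proof.
move=> [/differentiable_continuous c1 /differentiable_continuous c2] fx.
have f0 : 0 < cmod (f x).
  by rewrite lt_neqAle cmod_ge0 andbT eq_sym; apply: contra_neq fx; exact: cmod_eq0.
have e0 : 0 < cmod (f x) / 4 by rewrite divr_gt0.
have near2 : \forall y \near x, `|complex.Re (f x) - complex.Re (f y)| < cmod (f x) / 4 /\
    `|complex.Im (f x) - complex.Im (f y)| < cmod (f x) / 4.
  have n1 := (@cvgrPdist_lt _ R^o _ _ _ _ _).1 c1 _ e0.
  have n2 := (@cvgrPdist_lt _ R^o _ _ _ _ _).1 c2 _ e0.
  exact: filterS2 (n1 (nbhs_filter x)) (n2 (nbhs_filter x)).
have /nbhs_ballP[r /= r0 hr] := near2.
exists (cmod (f x) / 2), r; split=> //; first by rewrite divr_gt0.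
move=> y yx; have [] := hr y; first by rewrite -ball_normE /= distrC.
move=> h1 h2.
have h3 : cmod (f x - f y) <= cmod (f x) / 2.
  apply: le_trans (cmod_le_ReIm _) _.
  have -> : complex.Re (f x - f y) = complex.Re (f x) - complex.Re (f y).
    by case: (f x) (f y) => [? ?] [? ?].
  have -> : complex.Im (f x - f y) = complex.Im (f x) - complex.Im (f y).
    by case: (f x) (f y) => [? ?] [? ?].
  apply: le_trans (lerD (ltW h1) (ltW h2)) _.
  by apply: le_of_eq; move: (cmod _) => t; field.
have h4 : cmod (f x) <= cmod (f x - f y) + cmod (f y).
  by rewrite -[X in cmod X <= _](subrK (f y)); exact: cmodD.
move: h3 h4; move: (cmod (f x)) (cmod (f y)) (cmod _) => p q s; clear; lra.
Qed.

Variables (m : nat) (a : multi_index d m -> C).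

Lemma principal_symbolZ (t : R) xi :
  principal_symbol a (t *: xi) = ((t ^+ m)%:C)%C * principal_symbol a xi.
Proof.
rewrite /principal_symbol mulr_sumr; apply: (@eq_bigr _ _ _ (multi_index d m)) => al /eqP alm.
rewrite [RHS]mulrCA; congr (_ * _).
have -> : t ^+ m = \prod_(j < d) t ^+ al j by rewrite prodrXr -/(mi_order al) alm.
rewrite real_complex_prod -big_split /=; apply: eq_bigr => j _.
have -> : ((t ^+ al j)%:C)%C = (t%:C)%C ^+ al j :> C by exact: (rmorphXn (real_complex R)).
have -> : (((t *: xi) 0 j)%:C)%C = (t%:C)%C * ((xi 0 j)%:C)%C :> C.
  by rewrite mxE; exact: (rmorphM (real_complex R)).
by rewrite exprMn.
Qed.

Lemma cdifferentiable_sum I (r : seq I) (P : pred I) (f : I -> E -> C) x :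
  (forall i, cdifferentiable (f i) x) ->
  cdifferentiable (fun y => \sum_(i <- r | P i) f i y) x.
Proof.
move=> df; elim: r => [|i r IH].
  by under eq_fun do rewrite big_nil; exact: cdifferentiable_cst.
by under eq_fun do rewrite big_cons; case: (P i) => //; exact: cdifferentiableD.
Qed.

Lemma cdifferentiable_prod I (r : seq I) (f : I -> E -> C) x :
  (forall i, cdifferentiable (f i) x) ->
  cdifferentiable (fun y => \prod_(i <- r) f i y) x.
Proof.
move=> df; elim: r => [|i r IH].
  by under eq_fun do rewrite big_nil; exact: cdifferentiable_cst.
by under eq_fun do rewrite big_cons; exact: cdifferentiableM.
Qed.

Lemma cdifferentiableX (f : E -> C) n x :
  cdifferentiable f x -> cdifferentiable (fun y => f y ^+ n) x.
Proof.
move=> df; elim: n => [|n IH].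
  by under eq_fun do rewrite expr0; exact: cdifferentiable_cst.
by under eq_fun do rewrite exprS; exact: cdifferentiableM.
Qed.

Lemma cdifferentiable_principal xi : cdifferentiable (principal_symbol a) xi.
Proof.
apply: cdifferentiable_sum => al; apply: cdifferentiableM; first exact: cdifferentiable_cst.
apply: cdifferentiable_prod => j; apply: cdifferentiableX.
by split => /=; [exact: differentiable_coord|exact: differentiable_cst].
Qed.

Lemma scale_norm1 xi : xi != 0 -> `|(`|xi|^-1) *: xi| = 1.
Proof.
move=> x0; rewrite normrZ normfV normr_id mulVf//.
by rewrite normr_eq0.
Qed.

(** A narrower cone, on which the principal symbol is elliptic and whose points keep a
    fixed angular distance to the complement of [Gamma]. *)
Lemma narrow_cone (Gamma : set E) xi0 : xi0 != 0 -> conic_neighborhood xi0 Gamma ->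
  principal_symbol a xi0 != 0 ->
  exists (Gam2 : set E) (eps b : R), [/\ conic_neighborhood xi0 Gam2, 0 < eps <= 2^-1, 0 < b &
    forall xi, Gam2 xi -> b * `|xi| ^+ m <= cmod (principal_symbol a xi) /\
      forall kap, `|kap| <= eps * `|xi| -> Gamma (xi - kap) /\ `|xi| / 2 <= `|xi - kap|].
Proof.
move=> x0 [oG cG Gx] px.
have n0 : 0 < `|xi0| by rewrite normr_gt0.
pose om := `|xi0|^-1 *: xi0.
have om1 : `|om| = 1 by exact: scale_norm1.
have Gom : Gamma om by apply: cG => //; rewrite invr_gt0.
have pom : principal_symbol a om != 0.
  rewrite /om principal_symbolZ mulf_neq0// fmorph_eq0 expf_neq0//.
  by rewrite invr_eq0 gt_eqF.
have [b [r1 [b0 r10 hb]]] := cdiff_near_neq0 (cdifferentiable_principal om) pom.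
have /nbhs_ballP[r2 /= r20 hr2] := open_nbhs_nbhs (conj oG Gom).
pose eps : R := Num.min 2^-1 (Num.min r1 (r2 / 2)).
have eps0 : 0 < eps by rewrite !lt_min r10 divr_gt0// invr_gt0 ltr0n.
have e1 : eps <= r1 by rewrite !ge_min lexx !orbT.
have e2 : eps <= r2 / 2 by rewrite !ge_min lexx !orbT.
have e3 : eps <= 2^-1 by rewrite ge_min lexx.
pose q xi : R := `|xi - `|xi| *: om| - eps * `|xi|.
have cq : continuous q.
  move=> xi; apply: (@continuousB _ _ _ (fun xi : E => `|xi - `|xi| *: om|)
    (fun xi : E => eps * `|xi|)).
    apply: (@continuous_comp _ _ _ (fun xi : E => xi - `|xi| *: om) (fun z : E => `|z|)).
      apply: (@continuousB _ _ _ idfun (fun xi : E => `|xi| *: om)); first by apply: cvg_id.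
      apply: (@continuous_comp _ _ _ (fun xi : E => `|xi|) (fun t : R^o => t *: om)).
        exact: norm_continuous.
      exact: scalel_continuous.
    exact: norm_continuous.
  apply: (@continuous_comp _ _ _ (fun xi : E => `|xi|) (fun t : R^o => eps * t)).
    exact: norm_continuous.
  exact: mulrl_continuous.
exists [set xi | q xi < 0], eps, b; split => //.
- split.
  + have -> : [set xi | q xi < 0] = q @^-1` [set t | t < 0] by [].
    by apply: open_comp => [xi _|]; [exact: cq|exact: open_lt].
  + move=> t xi t0 /=; rewrite /q normrZ (gtr0_norm t0) -scalerA -scalerBr normrZ (gtr0_norm t0).
    by rewrite mulrCA -mulrBr pmulr_rlt0.
  + rewrite /= /q /om scalerA divff ?gt_eqF// scale1r subrr normr0 sub0r oppr_lt0.
    exact: mulr_gt0.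
- by rewrite eps0.
- move=> xi; rewrite /= /q subr_lt0 => hq.
  have xn : 0 < `|xi|.
    rewrite lt_neqAle normr_ge0 andbT; apply/eqP => h; move: hq; rewrite -h mulr0.
    by rewrite ltNge normr_ge0.
  pose th := `|xi|^-1 *: xi.
  have xiE : xi = `|xi| *: th by rewrite /th scalerA divff ?gt_eqF// scale1r.
  have thom : `|th - om| < eps.
    rewrite -(ltr_pM2l xn) -[X in X * `|th - _|](gtr0_norm xn) -normrZ scalerBr -xiE.
    by rewrite mulrC.
  split.
    rewrite [X in principal_symbol _ X]xiE principal_symbolZ cmodM cmod_real mulrC.
    rewrite ger0_norm ?exprn_ge0// ler_wpM2l ?exprn_ge0//.
    by apply: hb; exact: lt_le_trans thom e1.
  move=> kap hk; split; last first.
    have h1 : `|kap| <= `|xi| / 2 by apply: le_trans hk _; rewrite mulrC ler_wpM2l.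
    have h2 : `|xi| <= `|xi - kap| + `|kap|.
      by rewrite -[X in `|X| <= _](subrK kap); exact: ler_normD.
    by move: h1 h2; move: (`|xi|) (`|kap|) (`|_|) => p1 p2 p3; clear; lra.
  have -> : xi - kap = `|xi| *: (th - `|xi|^-1 *: kap).
    by rewrite scalerBr -xiE scalerA divff ?gt_eqF// scale1r.
  apply: cG => //; apply: hr2; rewrite -ball_normE /= distrC addrAC.
  apply: le_lt_trans (ler_normB _ _) _.
  have h3 : `|(`|xi|^-1) *: kap| <= eps.
    by rewrite normrZ normfV normr_id ler_pdivrMl// mulrC.
  apply: lt_le_trans (ltr_leD thom h3) _.
  by apply: le_trans (lerD e2 e2) _; rewrite -splitr.
Qed.

End Cones.

Section Recursion.
Variables (R : realType) (d : nat).
Local Notation C := R[i].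

(** Differentiating [s] times a product with a plane wave: the derivatives that fall on
    the wave give the leading term, and all others gain a factor [X] on it. *)
Lemma leading_term (V : seq 'I_d -> ('I_d -> nat) -> C) (z : 'I_d -> C) (X W : R) n :
  1 <= X -> (forall s j gam, V (rcons s j) gam = V s (madd gam j) + z j * V s gam) ->
  (forall j, cmod (z j) <= 8 * X) ->
  (forall gam, (mi_order gam <= n)%N -> cmod (V [::] gam) <= W) ->
  forall s gam, (mi_order gam + size s <= n)%N ->
    cmod (V s gam) <= (9 * X) ^+ size s * W /\
    X * cmod (V s gam - (\prod_(j <- s) z j) * V [::] gam) <= (9 * X) ^+ size s * W.
Proof.
move=> X1 Vr zX VW; have X0 := le_trans ler01 X1.
elim/last_ind => [|s j IH] gam.
  rewrite addn0 => gn; rewrite big_nil mul1r subrr cmod0 mulr0 expr0 mul1r.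
  by split; [exact: VW|exact: le_trans (cmod_ge0 _) (VW _ gn)].
rewrite size_rcons => gn.
have g1 : (mi_order (madd gam j) + size s <= n)%N by rewrite mi_order_madd addSnnS.
have g2 : (mi_order gam + size s <= n)%N by apply: leq_trans gn; rewrite leq_add2l.
have [h1 _] := IH _ g1; have [h2 h3] := IH _ g2.
set P := (9 * X) ^+ size s * W in h1 h2 h3.
have P0 : 0 <= P := le_trans (cmod_ge0 _) h1.
have eP : (9 * X) ^+ (size s).+1 * W = 9 * X * P by rewrite /P exprS !mulrA.
rewrite eP Vr -cats1 big_cat big_seq1 /=; split.
  apply: le_trans (cmodD _ _) _; rewrite cmodM.
  apply: le_trans (lerD h1 (ler_pM (cmod_ge0 _) (cmod_ge0 _) (zX j) h2)) _.
  by move: P0 X1; clear; nra.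
set y := \prod_(i <- s) z i in h3 *.
rewrite (_ : _ - _ = V s (madd gam j) + z j * (V s gam - y * V [::] gam)); last by ring.
apply: le_trans (ler_wpM2l X0 (cmodD _ _)) _; rewrite cmodM mulrDr mulrCA.
have h4 : cmod (z j) * (X * cmod (V s gam - y * V [::] gam)) <= 8 * X * P.
  by apply: ler_pM => //; rewrite ?cmod_ge0 ?mulr_ge0 ?cmod_ge0.
apply: le_trans (lerD (ler_wpM2l X0 h1) h4) _.
by rewrite -mulrDl (_ : X + 8 * X = 9 * X)//; ring.
Qed.

(** Iterating an elliptic gain: a power of [X] at the cost of [m] derivatives. *)
Lemma elliptic_iteration (G F : ('I_d -> nat) -> R) (X c T S : R) m J Q : 1 <= X -> 1 <= c ->
  0 <= T -> 0 <= S ->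
  (forall gam W, (forall gam', (mi_order gam' <= mi_order gam + m)%N -> G gam' <= W) ->
     X * G gam <= c * (X * F gam + W)) ->
  (forall gam, (mi_order gam <= J)%N -> G gam <= S) ->
  (forall gam, (mi_order gam <= J)%N -> 0 <= F gam /\ X ^+ Q * F gam <= T) ->
  forall n gam, (n <= Q)%N -> (mi_order gam + n * m <= J)%N ->
    X ^+ n * G gam <= (2 * c) ^+ n * (T + S).
Proof.
move=> X1 c1 T0 S0 step base hF; have X0 : 0 < X := lt_le_trans ltr01 X1.
elim=> [|n IH] gam nQ gn.
  rewrite !expr0 !mul1r (le_trans (base gam _))// ?lerDr//.
  by move: gn; rewrite mul0n addn0.
have Xn : 0 < X ^+ n by rewrite exprn_gt0.
have := step gam ((X ^+ n)^-1 * ((2 * c) ^+ n * (T + S))) _.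
have hW gam' : (mi_order gam' <= mi_order gam + m)%N ->
    G gam' <= (X ^+ n)^-1 * ((2 * c) ^+ n * (T + S)).
  move=> g'; rewrite ler_pdivlMl//; apply: IH; first exact: ltnW.
  by apply: leq_trans gn; rewrite mulSn addnA leq_add2r.
move=> /(_ hW) /(ler_wpM2l (ltW Xn)); rewrite mulrA -exprSr => h.
apply: le_trans h _; rewrite mulrCA mulrDr mulVKf ?gt_eqF// mulrA -exprSr.
have [F0 FT] := hF gam (leq_trans (leq_addr _ _) gn).
have h1 : X ^+ n.+1 * F gam <= T.
  by apply: le_trans FT; rewrite ler_wpM2r// ler_weXn2l.
have c2 : 1 <= (2 * c) ^+ n by apply: exprn_ege1; move: c1; clear; lra.
have c0 : 0 <= c := le_trans ler01 c1.
rewrite (exprS (2 * c)) (_ : 2 * c * _ * _ = c * (2 * ((2 * c) ^+ n * (T + S)))); last by ring.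
rewrite ler_wpM2l//; apply: le_trans (lerD h1 (lexx _)) _.
by move: c2 T0 S0; move: ((2 * c) ^+ n) => p; clear; nra.
Qed.

End Recursion.

(** * Microlocal ellipticity *)

Lemma ge1_mul9 (R : realType) (X : R) : 1 <= X -> 1 <= 9 * X /\ X <= 9 * X.
Proof. by move=> X1; split; lra. Qed.

Section Ellipticity.
Variables (R : realType) (d : nat) (U : set 'rV[R]_d).
Hypothesis oU : open U.
Local Notation E := 'rV[R]_d.
Local Notation C := R[i].
Implicit Types (x xi kap : E) (gam : 'I_d -> nat).
Variables (m : nat) (c : C) (a : multi_index d m -> C).
Hypothesis c0 : c != 0.

Let zeta : C := (0 +i* - (2 * pi))%C.

Lemma zfreqE xi j : zfreq xi j = zeta * ((xi 0 j)%:C)%C.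
Proof.
rewrite /zfreq /zeta; apply/eqP; rewrite eq_complex /=.
by apply/andP; split; apply/eqP; ring.
Qed.

(** The constant relating the derivatives of plane waves to powers of [xi]. *)
Let lead : C := (-1) ^+ m * c ^+ m * zeta ^+ m.

Lemma lead_gt0 : 0 < cmod lead.
Proof.
rewrite /lead !cmodM !cmodX cmodN cmod1 expr1n mul1r mulr_gt0 ?exprn_gt0//.
  rewrite lt_neqAle cmod_ge0 andbT eq_sym; apply: contra_neq c0; exact: cmod_eq0.
by rewrite /zeta /cmod /= expr0n add0r sqrtr_sqr normrN normr_gt0 mulf_neq0// gt_eqF// pi_gt0.
Qed.

Lemma principal_partE xi :
  \sum_(al : multi_index d m | mi_order al == m) pcoef c a al * \prod_(j <- mseq al) zfreq xi j =
  lead * principal_symbol a xi.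
Proof.
rewrite /principal_symbol mulr_sumr.
apply: (@eq_bigr _ _ _ (multi_index d m)) => al /eqP alm.
rewrite prod_mseq /pcoef alm /lead.
have -> : \prod_j zfreq xi j ^+ al j = zeta ^+ m * \prod_(j < d) ((xi 0 j)%:C)%C ^+ al j.
  have -> : zeta ^+ m = \prod_(j < d) zeta ^+ al j by rewrite prodrXr -/(mi_order al) alm.
  by rewrite -big_split; apply: eq_bigr => j _; rewrite zfreqE exprMn.
move: (\prod_(j < d) _) ((-1) ^+ m) (c ^+ m) (zeta ^+ m) => p s t w; ring.
Qed.

Variables (u : (E -> C) -> C) (F : nat -> R -> R) (A1 C1 del : R) (x0 : E).
Hypothesis du : distribution_on U u.
Hypotheses (tF : tower F) (gF : gevrey A1 C1 F) (A1_ge1 : 1 <= A1) (C1_ge1 : 1 <= C1).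
Hypothesis del0 : 0 < del.
Hypothesis F_supp : forall n (t : R), del <= `|t| -> F n t = 0.
Hypothesis xU : cball x0 del `<=` U.

Definition wave gam xi : E -> C := fun x => tensor F x0 gam x * fourier_kernel xi x.

Let test_wave gam xi O : cball x0 del `<=` O -> test_function O (wave gam xi).
Proof. exact: test_tensor_wave tF del0 F_supp gam xi O. Qed.

Let mG : mtower (tensor F x0). Proof. exact: mtower_tensor. Qed.

Let V xi s gam : C := u (cpartials s (wave gam xi)).

Let V_rec xi s j gam :
  V xi (rcons s j) gam = V xi s (madd gam j) + zfreq xi j * V xi s gam.
Proof.
have t1 g : test_function U (cpartials s (wave g xi)).
  by apply: test_partials; exact: test_wave.
rewrite /V -(distrZ du _ (t1 gam)) -(distrD du (t1 _) (testZ _ (t1 gam))).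
congr u; apply/funext => x.
exact: (kernel_mul_step s j gam xi openT mG).
Qed.

Let zfreq_le xi j : cmod (zfreq xi j) <= 8 * `|xi|.
Proof.
apply: le_trans (cmod_zfreq _ _) _; rewrite ler_wpM2r//.
by have := pihalf_lt2 R; lra.
Qed.

Let pV xi gam : pdo_distr c a u (wave gam xi) =
  \sum_(al : multi_index d m | (mi_order al <= m)%N) pcoef c a al * V xi (mseq al) gam.
Proof. by rewrite (pdo_distrE c a du (test_wave gam xi xU)). Qed.

(** Transposing [P(D)] onto the localized wave yields its principal symbol times [u] on that
    wave, and terms where derivatives fall on the cutoff, each losing a power of [|xi|];
    ellipticity allows to divide by the symbol. *)
Lemma elliptic_step (b : R) : 0 < b -> exists2 K : R, 1 <= K & forall xi, 1 <= `|xi| ->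
  b * `|xi| ^+ m <= cmod (principal_symbol a xi) -> forall gam (W : R),
  (forall gam', (mi_order gam' <= mi_order gam + m)%N -> cmod (u (wave gam' xi)) <= W) ->
  `|xi| * cmod (u (wave gam xi)) <= K * (`|xi| * cmod (pdo_distr c a u (wave gam xi)) + W).
Proof.
move=> b0; have l0 := lead_gt0.
pose S := \sum_(al : multi_index d m) cmod (pcoef c a al).
have S0 : 0 <= S by apply: sumr_ge0 => al _; exact: cmod_ge0.
pose k := cmod lead * b; have k0 : 0 < k by rewrite mulr_gt0.
have kV : 0 <= k^-1 by rewrite invr_ge0 ltW.
have S9 : 0 <= S * 9 ^+ m by rewrite mulr_ge0// exprn_ge0.
exists (1 + k^-1 * (1 + S * 9 ^+ m)).
  by rewrite lerDl mulr_ge0// addr_ge0.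
move=> xi X1 bX gam W hW; set X := `|xi| in X1 bX *.
have X0 := lt_le_trans ltr01 X1.
have W0 : 0 <= W by apply: le_trans (cmod_ge0 _) (hW gam _); rewrite leq_addr.
have lt := leading_term X1 (V_rec xi) (zfreq_le xi) hW.
set G := u (wave gam xi); set f := pdo_distr _ _ _ _.
have main : X * cmod (f - lead * principal_symbol a xi * G) <= S * (9 * X) ^+ m * W.
  pose r (al : multi_index d m) : C := V xi (mseq al) gam -
    (if mi_order al == m then (\prod_(j <- mseq al) zfreq xi j) * G else 0).
  have -> : f - lead * principal_symbol a xi * G =
      \sum_(al : multi_index d m | (mi_order al <= m)%N) pcoef c a al * r al.
    rewrite /f pV -principal_partE mulr_suml.
    rewrite [RHS](eq_bigr (fun al : multi_index d m => pcoef c a al * V xi (mseq al) gam -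
       (if mi_order al == m then pcoef c a al * (\prod_(j <- mseq al) zfreq xi j) * G else 0))).
      rewrite sumrB; congr (_ - _); rewrite -big_mkcondr /=.
      apply: eq_bigl => al; apply/idP/idP => [/eqP h|/andP[]//].
      by rewrite h eqxx leqnn.
    move=> al _; rewrite /r mulrBr; congr (_ - _); case: ifP => _; last by rewrite mulr0.
    by rewrite mulrA.
  apply: le_trans (ler_wpM2l (ltW X0) (cmod_sum _ _ _)) _; rewrite mulr_sumr -mulrA mulr_suml.
  rewrite [leRHS](bigID (fun al : multi_index d m => (mi_order al <= m)%N)) /=.
  rewrite -[leLHS]addr0; apply: lerD; last first.
    apply: (@sumr_ge0 _ (multi_index d m)) => al _; rewrite mulr_ge0 ?cmod_ge0// mulr_ge0// exprn_ge0//.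
    by rewrite mulr_ge0// ltW.
  apply: (@ler_sum _ (multi_index d m)) => al alm.
  rewrite cmodM mulrCA ler_wpM2l ?cmod_ge0//.
  have sz : (mi_order gam + size (mseq al) <= mi_order gam + m)%N.
    by rewrite size_mseq leq_add2l.
  have [h1 h2] := lt (mseq al) gam sz.
  rewrite size_mseq in h1 h2; rewrite /r; case: eqP => [e|/eqP e].
    by move: h2; rewrite [in X in _ <= X -> _]e.
  have alm' : (mi_order al < m)%N by rewrite ltn_neqAle e.
  have [X9 X9'] := ge1_mul9 X1.
  rewrite subr0; apply: le_trans (ler_wpM2l (ltW X0) h1) _.
  apply: (@le_trans _ _ ((9 * X) ^+ (mi_order al).+1 * W)).
    rewrite exprS -mulrA; apply: ler_wpM2r X9'.
    by rewrite mulr_ge0// exprn_ge0// (le_trans ler01).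
  by rewrite ler_wpM2r// ler_weXn2l.
have Xm : 0 < X ^+ m by rewrite exprn_gt0.
have lo : k * X ^+ m * cmod G <= cmod (lead * principal_symbol a xi * G).
  rewrite (cmodM _ G) (cmodM lead) ler_wpM2r ?cmod_ge0// /k -mulrA ler_wpM2l ?cmod_ge0//.
have tri : cmod (lead * principal_symbol a xi * G) <=
    cmod f + cmod (f - lead * principal_symbol a xi * G).
  rewrite -[X in cmod X <= _](subKr f); exact: cmodB.
have h1 : (k * X ^+ m) * (X * cmod G) <= X * cmod f + S * 9 ^+ m * X ^+ m * W.
  rewrite mulrCA; apply: le_trans (ler_wpM2l (ltW X0) (le_trans lo tri)) _.
  by rewrite mulrDr lerD2l; apply: le_trans main _; rewrite exprMn mulrA.
have kX : 0 < k * X ^+ m by rewrite mulr_gt0.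
have h2 : X * cmod f <= X ^+ m * (X * cmod f).
  by rewrite ler_peMl ?mulr_ge0 ?cmod_ge0 ?(ltW X0)//; exact: exprn_ege1.
have h3 : k * (X * cmod G) <= X * cmod f + S * 9 ^+ m * W.
  rewrite -(ler_pM2l Xm) mulrA (mulrC _ k).
  by apply: le_trans h1 _; rewrite mulrDr lerD// mulrAC [leRHS]mulrC.
have f0 : 0 <= X * cmod f by rewrite mulr_ge0 ?cmod_ge0// ltW.
have h4 : X * cmod G <= k^-1 * (X * cmod f + S * 9 ^+ m * W) by rewrite ler_pdivlMl.
apply: le_trans h4 _.
move: kV f0 W0 S9; move: (X * cmod f) (k^-1) (S * 9 ^+ m) => p q s q0 p0 w0 s0.
rewrite mulrDl mul1r -mulrA; apply: ler_wpDl; first exact: addr_ge0.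
rewrite ler_wpM2l// mulrDl mul1r lerD//.
  by rewrite lerDl.
by rewrite ler_wpM2l// lerDr.
Qed.

Definition gbound n : R := A1 * C1 ^+ n * n`!%:R ^+ 2.

Lemma gbound_ge1 n : 1 <= gbound n.
Proof.
rewrite /gbound; apply: mulr_ege1; first by apply: mulr_ege1 => //; exact: exprn_ege1.
by apply: exprn_ege1; exact: fact_ge1.
Qed.

Lemma gevrey_le n i (t : R) : (i <= n)%N -> `|F i t| <= gbound n.
Proof.
move=> iN; apply: le_trans (gF i t) _; apply: ler_pM.
- by rewrite mulr_ge0 ?exprn_ge0 ?(le_trans ler01 A1_ge1) ?(le_trans ler01 C1_ge1).
- exact: exprn_ge0.
- by rewrite ler_wpM2l ?(le_trans ler01)// ler_weXn2l.
- by rewrite lerXn2r ?nnegrE// ler_fact.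
Qed.

Lemma le_mi_order gam j : (gam j <= mi_order gam)%N.
Proof. by rewrite /mi_order (bigD1 j)//= leq_addr. Qed.

(** The a priori bound: [u] has finite order near [x0]. *)
Lemma wave_baseline : exists (k : nat) (M : R), 0 <= M /\ forall xi, 1 <= `|xi| ->
  forall n gam, (mi_order gam <= n)%N ->
    cmod (u (wave gam xi)) <= `|xi| ^+ k * (M * gbound (n + k) ^+ d).
Proof.
have [k [M [M0 hM]]] := distr_bound du (@compact_cball _ _ x0 del) xU.
exists k, (M * 9 ^+ k); split; first by rewrite mulr_ge0// exprn_ge0.
move=> xi X1 n gam gn; have tw := test_wave gam xi xU.
have [_ _ sw] := @test_wave gam xi (cball x0 del) (@subset_refl _ _).
apply: le_trans (hM _ tw sw) _.
have g0 : 0 <= gbound (n + k) by exact: le_trans ler01 (gbound_ge1 _).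
have [X9 _] := ge1_mul9 X1.
have X0 : 0 <= `|xi| by [].
have -> : `|xi| ^+ k * (M * 9 ^+ k * gbound (n + k) ^+ d) =
    M * ((9 * `|xi|) ^+ k * gbound (n + k) ^+ d).
  by move: (gbound (n + k) ^+ d) => q; rewrite exprMn; ring.
rewrite ler_wpM2l//; apply: ck_norm_le.
  by rewrite mulr_ge0// exprn_ge0// (le_trans ler01).
move=> s x sk _.
pose V' t g : C := cpartials t (wave g xi) x.
have rec t j g : V' (rcons t j) g = V' t (madd g j) + zfreq xi j * V' t g.
  exact: (kernel_mul_step t j g xi openT mG).
have bas g : (mi_order g <= n + k)%N -> cmod (V' [::] g) <= gbound (n + k) ^+ d.
  move=> gnk; have -> : V' [::] g = tensor F x0 g x * fourier_kernel xi x by [].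
  rewrite cmodM cmod_kernel mulr1 /tensor cmod_real normr_prod.
  apply: (@le_trans _ _ (\prod_(j < d) gbound (n + k))); last first.
    by rewrite prodr_const card_ord.
  apply: ler_prod => j _; rewrite normr_ge0/=; apply: gevrey_le.
  exact: leq_trans (le_mi_order g j) gnk.
have sz : (mi_order gam + size s <= n + k)%N by rewrite leq_add.
have [h _] := leading_term X1 rec (zfreq_le xi) bas sz.
apply: le_trans h _; rewrite ler_wpM2r ?exprn_ge0// ler_weXn2l//.
Qed.

End Ellipticity.

Section Microlocal.
Variables (R : realType) (d : nat).
Local Notation E := 'rV[R]_d.
Local Notation C := R[i].
Implicit Types (xi kap : E).

Lemma norm1_le_prod kap J : (1 + `|kap|) ^+ J <= \prod_j (1 + `|kap 0 j|) ^+ J.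
Proof.
rewrite prodrXl lerXn2r ?nnegrE ?addr_ge0//.
  by apply: prodr_ge0 => j _; rewrite addr_ge0.
have p1 : 1 <= \prod_j (1 + `|kap 0 j|).
  by elim/big_rec: _ => // j y _ y1; apply: mulr_ege1; rewrite ?lerDl.
rewrite -lerBrDl; apply: norm_le_coord; first by rewrite subr_ge0.
move=> j; rewrite lerBrDl (bigD1 j)//= ler_peMr ?addr_ge0//.
by elim/big_rec: _ => // i y _ y1; apply: mulr_ege1; rewrite ?lerDl.
Qed.

(** Decay inside the cone and polynomial growth outside of it combine into a single
    bound around [xi]: out of the cone, the distance to [xi] is at least [eps * |xi|]. *)
Lemma fourier_split (g : E -> R) (Gamma : set E) xi (eps b D : R) (p Q mu : nat) :
  1 <= `|xi| -> 0 < eps <= 2^-1 -> 0 <= b -> 0 <= D -> (Q <= p)%N ->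
  (forall kap, `|kap| <= eps * `|xi| -> Gamma (xi - kap) /\ `|xi| / 2 <= `|xi - kap|) ->
  (forall eta, Gamma eta -> eta != 0 -> g eta <= b / enorm2 eta ^+ p) ->
  (forall eta, g eta <= D * (1 + `|eta|) ^+ mu) ->
  forall kap, g (xi - kap) <=
    (b * 2 ^+ p + D * (1 + eps^-1) ^+ mu * eps^-1 ^+ Q) / `|xi| ^+ Q *
    \prod_j (1 + `|kap 0 j|) ^+ (mu + Q).
Proof.
move=> X1 /andP[e0 e12] b0 D0 Qp cone h1 h2 kap; set X := `|xi| in X1 cone *.
have X0 : 0 < X := lt_le_trans ltr01 X1.
have XQ : 0 < X ^+ Q by rewrite exprn_gt0.
have eV : 0 < eps^-1 by rewrite invr_gt0.
have b2 : 0 <= b * 2 ^+ p by rewrite mulr_ge0// exprn_ge0.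
have D2 : 0 <= D * (1 + eps^-1) ^+ mu * eps^-1 ^+ Q.
  by rewrite !mulr_ge0 ?exprn_ge0 ?addr_ge0 ?(ltW eV).
have k1 : 1 <= 1 + `|kap| by rewrite lerDl.
have kJ : 1 <= (1 + `|kap|) ^+ (mu + Q) by exact: exprn_ege1.
apply: (@le_trans _ _ ((b * 2 ^+ p + D * (1 + eps^-1) ^+ mu * eps^-1 ^+ Q) / X ^+ Q *
    (1 + `|kap|) ^+ (mu + Q))); last first.
  by rewrite ler_wpM2l ?norm1_le_prod// divr_ge0 ?addr_ge0 ?(ltW XQ).
rewrite mulrAC ler_pdivlMr//.
have [kX|kX] := leP `|kap| (eps * X).
  have [Gk hk] := cone kap kX.
  have n0 : 0 < `|xi - kap| by apply: lt_le_trans hk; rewrite divr_gt0.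
  have nz : xi - kap != 0 by rewrite -normr_gt0.
  have e2 : X / 2 <= enorm2 (xi - kap) by exact: le_trans hk (norm_le_enorm2 _).
  have eg : 0 < enorm2 (xi - kap) by exact: enorm2_gt0.
  apply: (@le_trans _ _ (b * 2 ^+ p)); last first.
    by rewrite -[leLHS]mulr1; apply: ler_pM => //; rewrite lerDl.
  apply: le_trans (ler_wpM2r (ltW XQ) (h1 _ Gk nz)) _.
  rewrite -mulrA ler_wpM2l// mulrC ler_pdivrMr ?exprn_gt0//.
  apply: (@le_trans _ _ (X ^+ p)); first by rewrite ler_weXn2l.
  rewrite -exprMn lerXn2r ?nnegrE ?(ltW X0) ?mulr_ge0 ?(ltW eg)//.
  by rewrite mulrC -ler_pdivrMr.
have k0 : 0 <= `|kap| by [].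
have hX : X <= eps^-1 * `|kap| by rewrite ler_pdivlMl// ltW.
apply: (@le_trans _ _ (D * (1 + eps^-1) ^+ mu * eps^-1 ^+ Q * (1 + `|kap|) ^+ (mu + Q))); last first.
  by rewrite ler_wpM2r ?(le_trans ler01 kJ)// lerDr.
apply: le_trans (ler_wpM2r (ltW XQ) (h2 _)) _.
have s1 : (1 + `|xi - kap|) ^+ mu <= ((1 + eps^-1) * (1 + `|kap|)) ^+ mu.
  rewrite lerXn2r ?nnegrE ?mulr_ge0 ?addr_ge0 ?(ltW eV)//.
  apply: (@le_trans _ _ (1 + (X + `|kap|))); first by rewrite lerD2l ler_normB.
  apply: (@le_trans _ _ (1 + (eps^-1 * `|kap| + `|kap|))); first by rewrite !lerD2l lerD2r.
  rewrite (_ : (1 + eps^-1) * (1 + `|kap|) = 1 + (eps^-1 * `|kap| + `|kap|) + eps^-1); last by ring.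
  by rewrite lerDl ltW.
have s2 : X ^+ Q <= (eps^-1 * (1 + `|kap|)) ^+ Q.
  rewrite lerXn2r ?nnegrE ?mulr_ge0 ?addr_ge0 ?(ltW X0) ?(ltW eV)//.
  by apply: le_trans hX _; rewrite ler_wpM2l ?(ltW eV)// lerDr.
rewrite -mulrA -!(mulrA D) ler_wpM2l//.
apply: le_trans (ler_pM _ (ltW XQ) s1 s2) _; first by rewrite exprn_ge0// addr_ge0.
by rewrite !exprMn exprD; apply: le_of_eq; ring.
Qed.

End Microlocal.

(** * The two inclusions *)

Section SecondInclusion.
Variables (R : realType).

Lemma linear_bound p k q n : (q <= k.+1 * n.+1)%N ->
  ((p + q).+2 <= (p + k.+1).+2 * n.+1)%N.
Proof. by move=> h; nia. Qed.

Lemma fgrowth_pow_le (t : R) (e : nat -> nat) q : 1 <= t -> (forall N, (e N <= q * N.+1)%N) ->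
  factorial_growth (fun N => t ^+ e N).
Proof.
move=> t1 he; apply: (fgrowth_le _ (fgrowth_expl q (le_trans ler01 t1))) => N.
by rewrite ler_weXn2l.
Qed.

Lemma fgrowth_gbound (A C : R) (e : nat -> nat) q : 1 <= A -> 1 <= C ->
  (forall N, (e N <= q * N.+1)%N) -> factorial_growth (fun N => gbound A C (e N)).
Proof.
move=> A1 C1 he; have A0 := le_trans ler01 A1; have C0 := le_trans ler01 C1.
apply: fgrowthM.
- by move=> N; rewrite mulr_ge0// exprn_ge0.
- by move=> N; rewrite exprn_ge0.
- apply: fgrowthM; [by []|by move=> N; exact: exprn_ge0|exact: fgrowth_cst|].
  exact: fgrowth_pow_le he.
- apply: fgrowthX; first by [].
  by apply: fgrowth_le (fgrowth_fact R q) => N; exact: ler_fact.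
Qed.

Variables (d : nat) (U : set 'rV[R]_d).
Hypothesis oU : open U.
Local Notation E := 'rV[R]_d.
Local Notation C := R[i].
Variables (m : nat) (c : C) (a : multi_index d m -> C) (u : (E -> C) -> C).
Hypotheses (c0 : c != 0) (du : distribution_on U u).

(** The sequence for [u] is constant, equal to [u] times a tensor cutoff. The elliptic
    recursion, iterated about [N ^ (1 / sigma)] times, costs as many derivatives of that
    cutoff, whose growth is that of a power of [N`!]. *)
Lemma WF_regular_elliptic (tau sigma : R) (x0 xi0 : E) : 1 < sigma -> 0 < tau -> xi0 != 0 ->
  principal_symbol a xi0 != 0 ->
  WF_regular U tau sigma (pdo_distr c a u) x0 xi0 ->
  exists2 tau', 0 < tau' & WF_regular U tau' sigma u x0 xi0.
Proof.
move=> s1 t0 xi00 pxi [Om [Ga [w [A [h [[oO Ox OU] cG [bw ew] [A0 h0] H]]]]]].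
have s0 : 0 < sigma := lt_trans ltr01 s1.
have ts : 0 <= tau / sigma by rewrite divr_ge0// ltW.
have [del del0 xO] := open_cball oO Ox.
have xU := subset_trans xO OU.
have [F [A1 [C1 [tF A11 C11 gF [F0 F1]]]]] := plateau_exists del0.
have [Gam2 [eps [b [cG2 heps b0 hG2]]]] := narrow_cone xi00 cG pxi.
have [K K1 step] := elliptic_step a c0 du tF del0 F0 xU b0.
have [k [M [M0 base]]] := wave_baseline du tF gF A11 C11 del0 F0 xU.
have [mu [D [D0 hD]]] := bounded_fourier_growth oU bw.
have [r r0 w_supp] := bounded_common_support oU bw.
have [Kd hKd] := decay_shift k s1.
pose chi := tensor F x0 (fun=> 0%N).
have tchiO : test_function Om chi.
  exact: (test_tensor tF del0 F0).
have tchi : test_function U chi := test_sub OU tchiO.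
have bchi := mul_distr_bounded oU du tchi.
have [mu1 [D1 [D10 hD1]]] := bounded_fourier_growth oU bchi.
(* Besides the powers to be gained, [k] more pay for the finite order of [u] near [x0]. *)
pose Q N := (decay sigma N + k)%N.
pose N' N := (Kd * N.+1)%N.
pose p N := decay sigma (N' N).
have Qp N : (Q N <= p N)%N by exact: hKd.
pose bN N := A * (h ^+ N' N * (N' N)`!%:R `^ (tau / sigma)).
have bN0 N : 0 <= bN N by rewrite !mulr_ge0 ?exprn_ge0 ?powR_ge0// ltW.
(* The decay of the Fourier transform of [w (N' N)] around the frequency [xi]. *)
pose TT N := bN N * 2 ^+ p N + D * (1 + eps^-1) ^+ mu * eps^-1 ^+ Q N.
pose L := period del r x0.
(* The recursion goes through [m * Q N] derivatives of the cutoff, and summing over its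
   Fourier series takes [mu + Q N] more, plus two for summability. *)
pose nB N := (m * Q N + (mu + Q N).+2)%N.
pose W N := 4 * L ^+ 2 * (2 ^+ (mu + Q N + 4) * gbound A1 C1 (nB N)).
pose S N := M * gbound A1 C1 (m * Q N + k) ^+ d.
pose Z N := (2 * K) ^+ Q N * (TT N * W N ^+ d + S N).
pose f N := (1 + d%:R) ^+ (1 * N.+1) * (Z N + D1 * 2 ^+ mu1).
have [eps0 eps12] := andP heps.
have eV0 : 0 <= eps^-1 by rewrite invr_ge0 ltW.
have eV1 : 1 <= eps^-1.
  by rewrite invf_ge1// (le_trans eps12)// invf_le1// ler1n.
have TT0 N : 0 <= TT N.
  apply: addr_ge0; first by apply: mulr_ge0; [exact: bN0|exact: exprn_ge0].
  by apply: mulr_ge0; [apply: mulr_ge0 => //; rewrite exprn_ge0// addr_ge0|exact: exprn_ge0].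
have g0 n : 0 <= gbound A1 C1 n := le_trans ler01 (gbound_ge1 A11 C11 n).
have W0 N : 0 <= W N.
  apply: mulr_ge0; first by rewrite mulr_ge0// sqr_ge0.
  by apply: mulr_ge0; [exact: exprn_ge0|exact: g0].
have S0 N : 0 <= S N by rewrite mulr_ge0// exprn_ge0.
have K20 : 0 <= 2 * K by rewrite mulr_ge0// (le_trans ler01).
have Z0 N : 0 <= Z N.
  by rewrite mulr_ge0 ?exprn_ge0// addr_ge0// mulr_ge0// exprn_ge0.
have hQ N : (Q N <= k.+1 * N.+1)%N.
  rewrite /Q mulSn; apply: leq_add; first by apply: leqW; exact: decay_le.
  exact: leq_pmulr.
have gbN : factorial_growth bN.
  apply: fgrowthM; [by move=> _; exact: ltW| |exact: fgrowth_cst|].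
    by move=> N; rewrite mulr_ge0 ?exprn_ge0 ?powR_ge0// ltW.
  apply: fgrowthM; [by move=> N; rewrite exprn_ge0// ltW|by move=> N; exact: powR_ge0| |].
    by apply: fgrowth_expl; exact: ltW.
  by apply: fgrowth_powR => //; exact: fgrowth_fact.
have gTT : factorial_growth TT.
  apply: fgrowthD; apply: fgrowthM.
  - exact: bN0.
  - by move=> N; exact: exprn_ge0.
  - exact: gbN.
  - by apply: (fgrowth_pow_le (q := Kd)) => [|N]; [rewrite ler1n|exact: decay_le].
  - by move=> _; rewrite mulr_ge0// exprn_ge0// addr_ge0.
  - by move=> N; exact: exprn_ge0.
  - exact: fgrowth_cst.
  - exact: fgrowth_pow_le hQ.
have gW : factorial_growth W.
  apply: fgrowthM.
  - by move=> _; rewrite mulr_ge0// sqr_ge0.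
  - by move=> N; rewrite mulr_ge0// exprn_ge0.
  - exact: fgrowth_cst.
  apply: fgrowthM; [by move=> N; exact: exprn_ge0|by move=> N; exact: g0| |].
  - apply: (fgrowth_pow_le (q := mu + k.+1 + 4)) => [|N]; first by rewrite ler1n.
    by rewrite !mulnDl !leq_add// leq_pmulr.
  - apply: (fgrowth_gbound (q := m * k.+1 + (mu + k.+1).+2)) => // N.
    rewrite mulnDl leq_add//; first by rewrite -mulnA leq_mul.
    exact: (linear_bound mu (hQ N)).
have gS : factorial_growth S.
  apply: fgrowthM; [by []|by move=> N; exact: exprn_ge0|exact: fgrowth_cst|].
  apply: fgrowthX; first by move=> N; exact: g0.
  apply: (fgrowth_gbound (q := m * k.+1 + k)) => // N.
  by rewrite mulnDl leq_add ?leq_pmulr// -mulnA leq_mul.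
have gZ : factorial_growth Z.
  apply: fgrowthM.
  - by move=> N; exact: exprn_ge0.
  - by move=> N; apply: addr_ge0 (S0 N); apply: mulr_ge0 (TT0 N) _; exact: exprn_ge0.
  - by apply: fgrowth_pow_le hQ; rewrite mulr_ege1 ?ler1n.
  apply: fgrowthD gS; apply: fgrowthM; [exact: TT0|by move=> N; exact: exprn_ge0|exact: gTT|].
  exact: fgrowthX W0 gW.
have gf : factorial_growth f.
  apply: fgrowthM.
  - by move=> N; rewrite exprn_ge0// addr_ge0.
  - by move=> N; apply: addr_ge0 (Z0 N) _; rewrite mulr_ge0// exprn_ge0.
  - by apply: fgrowth_expl; rewrite addr_ge0.
  - by apply: fgrowthD gZ _; exact: fgrowth_cst.
have fourierE xi : fourier_distr U (mul_distr u chi) xi = u (wave F x0 (fun=> 0%N) xi).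
  by rewrite /fourier_distr (pairing_mul oU du tchi)//; exact: smooth_kernel.
have main N xi : Gam2 xi -> 1 <= `|xi| ->
    `|xi| ^+ decay sigma N * cmod (u (wave F x0 (fun=> 0%N) xi)) <= Z N.
  move=> Gxi X1; have [ell cone] := hG2 xi Gxi.
  have X0 : 0 < `|xi| := lt_le_trans ltr01 X1.
  have split := @fourier_split _ _ (fun eta => cmod (fourier_distr U (w (N' N)) eta)) Ga xi
    eps (bN N) D (p N) (Q N) mu X1 heps (bN0 N) D0 (Qp N) cone _ (hD (N' N)).
  have {}split := split (fun eta Ge en => le_trans (H (N' N) eta Ge en) (le_of_eq (mulrA _ _ _))).
  have cw : compactly_supported_distribution U (w (N' N)) by have [] := bw.
  have hF gam : (mi_order gam <= m * Q N)%N ->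
      0 <= cmod (pdo_distr c a u (wave F x0 gam xi)) /\
      `|xi| ^+ Q N * cmod (pdo_distr c a u (wave F x0 gam xi)) <= TT N * W N ^+ d.
    move=> gm; split; first exact: cmod_ge0.
    rewrite -(ew (N' N) _ (test_tensor_wave tF del0 F0 gam xi xO)).
    have XQ : 0 < `|xi| ^+ Q N by rewrite exprn_gt0.
    have B1 j t : `|F (gam j) t| <= gbound A1 C1 (nB N).
      apply: (gevrey_le gF A11 C11); apply: leq_trans (le_mi_order gam j) _.
      exact: leq_trans gm (leq_addr _ _).
    have B2 j t : `|F ((mu + Q N).+2 + gam j)%N t| <= gbound A1 C1 (nB N).
      apply: (gevrey_le gF A11 C11); rewrite addnC leq_add2r.
      exact: leq_trans (le_mi_order gam j) gm.
    have T0 : 0 <= TT N / `|xi| ^+ Q N by rewrite divr_ge0// ltW.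
    have := tensor_wave_le oU tF gF del0 r0 F0 xU cw (w_supp (N' N)) T0 split B1 B2.
    move=> /(ler_wpM2l (ltW XQ)); rewrite mulrA [X in _ <= X * _]mulrCA divff ?gt_eqF//.
    by rewrite mulr1.
  have hG gam : (mi_order gam <= m * Q N)%N ->
      cmod (u (wave F x0 gam xi)) <= `|xi| ^+ k * S N.
    by move=> gm; exact: base.
  have TW0 : 0 <= TT N * W N ^+ d by rewrite mulr_ge0// exprn_ge0.
  have XS0 : 0 <= `|xi| ^+ k * S N by rewrite mulr_ge0// exprn_ge0.
  have gam0 : (mi_order (fun _ : 'I_d => 0%N) + Q N * m <= m * Q N)%N.
    by rewrite /mi_order big1// add0n mulnC.
  have := elliptic_iteration X1 K1 TW0 XS0 (step xi X1 ell) hG hF (leqnn _) gam0.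
  move: (cmod (u _)) => G0.
  have Xk : 1 <= `|xi| ^+ k by exact: exprn_ege1.
  have Xk0 : 0 < `|xi| ^+ k by exact: lt_le_trans Xk.
  rewrite exprD => hit; rewrite -(ler_pM2r Xk0) mulrAC; apply: le_trans hit _.
  rewrite /Z -mulrA ler_wpM2l ?exprn_ge0//; move: TW0 Xk.
  move: (TT N * W N ^+ d) (S N) (`|xi| ^+ k) => p1 q1 y1 p10 y11.
  by rewrite mulrDl (mulrC q1) lerD2r ler_peMr.
apply: (@WF_regular_growth _ _ U sigma u x0 xi0 [set x | `|x - x0| < del / 2] Gam2
    (fun=> mul_distr u chi) f) => //.
- exact: open_oball.
- by rewrite /= subrr normr0 divr_gt0.
- move=> x /= hx; apply: xU; rewrite /cball /= (le_trans (ltW hx))//.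
  by rewrite ler_pdivrMr// ler_peMr ?(ltW del0)// ler1n.
- move=> N phi [_ _ sphi]; rewrite /mul_distr; congr u; apply/funext => x.
  have [/sphi /= hx|/out_csupport ->] := pselect (csupport phi x); last by rewrite mulr0.
  have [_ one] := tensor_plateau x0 del0 F0 F1.
  by rewrite /chi one ?mul1r// ltW.
- move=> N xi Gxi xin; rewrite fourierE.
  have e0 := enorm2_gt0 xin; have ne := enorm2_le_norm xi.
  rewrite ler_pdivlMr ?exprn_gt0//.
  (* Below the unit sphere the growth bound of the constant sequence is enough. *)
  have Y : `|xi| ^+ decay sigma N * cmod (u (wave F x0 (fun=> 0%N) xi)) <= Z N + D1 * 2 ^+ mu1.
    have [X1|/ltW X1] := leP 1 `|xi|.
      apply: le_trans (main N xi Gxi X1) _.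
      by rewrite lerDl mulr_ge0// exprn_ge0.
    rewrite -fourierE -[leLHS]add0r; apply: lerD => //.
    rewrite -[leRHS]mul1r; apply: ler_pM; rewrite ?exprn_ge0 ?cmod_ge0//.
      exact: exprn_ile1.
    apply: le_trans (hD1 0%N xi) _; rewrite ler_wpM2l// lerXn2r ?nnegrE ?addr_ge0//.
    by rewrite -[2]/(1 + 1) lerD2l.
  have dd : 1 <= 1 + d%:R :> R by rewrite lerDl.
  have d0 := le_trans ler01 dd.
  apply: (@le_trans _ _ (cmod (u (wave F x0 (fun=> 0%N) xi)) *
      ((1 + d%:R) * `|xi|) ^+ decay sigma N)).
    rewrite ler_wpM2l ?cmod_ge0// lerXn2r ?nnegrE ?(ltW e0) ?mulr_ge0//.
  rewrite exprMn mulrCA [X in _ * X <= _]mulrC /f; apply: ler_pM; last exact: Y.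
  + exact: exprn_ge0.
  + by rewrite mulr_ge0 ?exprn_ge0 ?cmod_ge0.
  + by rewrite ler_weXn2l// mul1n; apply: leqW; exact: decay_le.
Qed.

End SecondInclusion.

Theorem corollary1p1 (R : realType) (d : nat) (U : set 'rV[R]_d)
  (u : ('rV[R]_d -> R[i]) -> R[i])
  (m : nat) (c : R[i]) (a : multi_index d m -> R[i]) :
  open U -> distribution_on U u -> c != 0 -> has_order a ->
  WF_0_infty U (pdo_distr c a u) `<=` WF_0_infty U u /\
  WF_0_infty U u `<=` WF_0_infty U (pdo_distr c a u) `|` (U `*` Char a).
Proof.
move=> oU du c0 _; split=> -[x xi] [sigma /= s1 wf].
  exists sigma => //= tau /= t0; have [Ux xi0 _] := wf 1 ltr01; split=> //= reg.
  have [tau' t'0 reg'] := WF_regular_pdo oU c a s1 t0 reg.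
  by have [_ _] := wf tau' t'0.
have [Ux xi0 _] := wf 1 ltr01.
have [pxi|pxi] := eqVneq (principal_symbol a xi) 0; first by right.
left; exists sigma => //= tau /= t0; split=> //= reg.
have [tau' t'0 reg'] := WF_regular_elliptic oU c0 du s1 t0 xi0 pxi reg.
by have [_ _] := wf tau' t'0.
Qed.
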